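(* Let $q$ be a real locally integrable function on $\mathbb{R}$ such that the operator $\mathbb{L}_q=-\partial_x^2+q(x)$ is semibounded below, and such that for a.e. real $k$ the equation $\mathbb{L}_qu=k^2u$ has a right Jost solution $\psi(x,k)$, i.e. $\psi(x,k)\sim e^{\mathrm{i}kx}$, $\psi'(x,k)\sim \mathrm{i}ke^{\mathrm{i}kx}$ as $x\to+\infty$. Let $R(k)$ be the right reflection coefficient. Let $0<\omega_1,\dots,\omega_N$ ($N<\infty$) be distinct and suppose: 1. (Resonance condition) for each $1\le n\le N$, the equation $\mathbb{L}_qu=\omega_n^2u$ has a unique (up to a scalar multiple) solution in $L^2(-\infty)$; 2. (Continuity condition) $\psi(x,k)$ and $R(k)$ are continuous (in real $k$) at each $k=\omega_n$. Let $\alpha_1,\dots,\alpha_N$ be arbitrary nonzero real numbers and set $$\phi_n(x):=2\operatorname{Re}\big[R(\omega_n)^{1/2}\psi(x,\omega_n)\big],\quad 1\le n\le N,$$ with the square root taken with argument in $(-\pi,\pi]$. Then: (i) each $\phi_n\in L^2(-\infty)$; (ii) consequently the $N\times N$ matrix $\mathbf{G}_+(x)$ with entries $(\mathbf{G}_+(x))_{mn}=\alpha_m\alpha_n\int_{-\infty}^x\phi_m(s)\phi_n(s)\,\mathrm{d}s$ is well defined and positive semidefinite; (iii) the potential $q_{+N}(x)=q(x)-2\partial_x^2\log\det(\mathbf{I}+\mathbf{G}_+(x))$ has embedded eigenvalues (embedded bound states) at $\omega_n^2$, $1\le n\le N$; (iv) the associated eigenfunctions $y_1,\dots,y_N$ of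 $-\partial_x^2+q_{+N}$ (orthogonal in $L^2(\mathbb{R})$) are uniquely determined by the linear system $\mathbf{y}(x)(\mathbf{I}+\mathbf{G}_+(x))=-\big(\alpha_1\phi_1(x),\dots,\alpha_N\phi_N(x)\big)$, where $\mathbf{y}=(y_1,\dots,y_N)$ is a row vector; i.e. $y_n(x)+\sum_{m=1}^N y_m(x)\,\alpha_m\alpha_n\int_{-\infty}^x\phi_m\phi_n\,\mathrm{d}s=-\alpha_n\phi_n(x)$.
   Context: $L^2(\pm\infty)$ means $L^2(a,\pm\infty)$ for any finite $a$. Under the hypotheses, $q$ is in the limit point case at $\pm\infty$; for real $k$ let $\varphi(x,k)$ denote the boundary value on the real axis of the left Weyl solution (a solution of $\mathbb{L}_qu=k^2u$ lying in $L^2(-\infty)$ for $\operatorname{Im}k>0$). The right reflection coefficient is defined for a.e. real $k$ by $R(k)=-W(\varphi(x,k),\overline{\psi(x,k)})/W(\varphi(x,k),\psi(x,k))$ (independent of the normalization of $\varphi$); equivalently $\varphi$ can be normalized so that $\varphi(x,k)=\overline{\psi(x,k)}+R(k)\psi(x,k)$. Here $W(f,g)=fg'-f'g$. An embedded eigenvalue is a positive eigenvalue of the selfadjoint operator on $L^2(\mathbb{R})$ (it lies in the continuous spectrum). *)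

(* Defs.v *)
From HB Require Import structures.
From mathcomp Require Import all_boot all_order all_algebra.
From mathcomp Require Import all_classical all_reals all_analysis.
From mathcomp.real_closed Require Import complex.
Set Implicit Arguments.
Unset Strict Implicit.
Unset Printing Implicit Defensive.
Import Order.TTheory GRing.Theory Num.Theory.
Local Open Scope ring_scope.
Local Open Scope classical_set_scope.

Section SchrodingerDefs.
Variable R : realType.
Local Notation leb := (@lebesgue_measure R).

Definition cabs (z : R[i]) : R := Num.sqrt (complex.Re z ^+ 2 + complex.Im z ^+ 2).

Definition cR (r : R) : R[i] := Complex r 0.

Definition loc_int (f : R -> R) : Prop :=
  forall a b : R, leb.-integrable `[a, b] (EFin \o f).

Definition cloc_int (f : R -> R[i]) : Prop :=
  loc_int (fun t => complex.Re (f t)) /\ loc_int (fun t => complex.Im (f t)).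

Definition cint (a b : R) (f : R -> R[i]) : R[i] :=
  Complex (Rintegral leb `[a, b] (fun t => complex.Re (f t)))
          (Rintegral leb `[a, b] (fun t => complex.Im (f t))).

Definition L2left (f : R -> R) : Prop :=
  forall a : R, leb.-integrable `]-oo, a] (fun t => (f t ^+ 2)%:E).

Definition cL2left (u : R -> R[i]) : Prop :=
  forall a : R, leb.-integrable `]-oo, a]
                  (fun t => (complex.Re (u t) ^+ 2 + complex.Im (u t) ^+ 2)%:E).

Definition L2 (f : R -> R) : Prop :=
  leb.-integrable setT (fun t => (f t ^+ 2)%:E).

(* Real functions: u, du locally absolutely continuous, du = u', and
   -u'' + q u = f a.e. (Caratheodory sense, f locally integrable after
   subtracting q u). *)
Definition rop (q u du f : R -> R) : Prop :=
  loc_int du /\ loc_int (fun t => q t * u t - f t) /\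
  forall a b : R, a <= b ->
    u b - u a = Rintegral leb `[a, b] du /\
    du b - du a = Rintegral leb `[a, b] (fun t => q t * u t - f t).

Definition csol (q : R -> R) (lam : R[i]) (u du : R -> R[i]) : Prop :=
  cloc_int du /\ cloc_int (fun t => (cR (q t) - lam) * u t) /\
  forall a b : R, a <= b ->
    u b - u a = cint a b du /\
    du b - du a = cint a b (fun t => (cR (q t) - lam) * u t).

(* The operator L_q = -d^2/dx^2 + q is semibounded below: its quadratic form
   on compactly supported functions of its domain is bounded below. *)
Definition semibounded (q : R -> R) : Prop :=
  exists c : R, forall u du f : R -> R,
    rop q u du f -> (exists A : R, forall x, A < `|x| -> u x = 0) -> L2 f ->
    c * Rintegral leb setT (fun t => u t ^+ 2)
      <= Rintegral leb setT (fun t => f t * u t).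

Definition jost (q : R -> R) (psi dpsi : R -> R -> R[i]) (k : R) : Prop :=
  csol q (cR (k ^+ 2)) (fun x => psi x k) (fun x => dpsi x k) /\
  (cabs (psi x k - Complex (cos (k * x)) (sin (k * x))) @[x --> +oo] --> 0) /\
  (cabs (dpsi x k - Complex (- k * sin (k * x)) (k * cos (k * x)))
     @[x --> +oo] --> 0).

(* M = m_-(lam): Weyl-Titchmarsh m-function of the left half line
   (reference point 0): M = u'(0)/u(0) for the left Weyl solution u, i.e. a
   nonzero solution lying in L^2(-oo). *)
Definition weyl_m (q : R -> R) (lam : R[i]) (M : R[i]) : Prop :=
  exists u du : R -> R[i], csol q lam u du /\ cL2left u /\
    (exists x, u x != 0) /\ du 0 = M * u 0.

Definition weyl_bv (q : R -> R) (k : R) (M : R[i]) : Prop :=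
  forall d : R, 0 < d -> exists e : R, 0 < e /\
    forall eps : R, 0 < eps -> eps < e ->
      forall M' : R[i], weyl_m q ((Complex k eps) ^+ 2) M' -> cabs (M' - M) < d.

(* Rk is the right reflection coefficient at k:
   Rk = - W(phi, conj psi) / W(phi, psi), where phi = boundary value of the
   left Weyl solution normalized by phi(0) = 1, phi'(0) = m_-(k^2 + i0). *)
Definition refl_coef (q : R -> R) (psi dpsi : R -> R -> R[i]) (k : R)
    (Rk : R[i]) : Prop :=
  exists M : R[i], weyl_bv q k M /\
    let D := dpsi 0 k - M * psi 0 k in
    let Dc := (dpsi 0 k)^*%C - M * (psi 0 k)^*%C in
    D != 0 /\ Rk * D = - Dc.

Definition good (q : R -> R) (psi dpsi : R -> R -> R[i]) (Rc : R -> R[i]) :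
    set R := [set k | jost q psi dpsi k /\ refl_coef q psi dpsi k (Rc k)].

Definition cont_along (S : set R) (f : R -> R[i]) (w : R) : Prop :=
  forall e : R, 0 < e -> exists d : R, 0 < d /\
    forall k : R, S k -> `|k - w| < d -> cabs (f k - f w) < e.

Definition resonance (q : R -> R) (w : R) : Prop :=
  exists u0 du0 : R -> R[i],
    csol q (cR (w ^+ 2)) u0 du0 /\ cL2left u0 /\ (exists x, u0 x != 0) /\
    forall u du : R -> R[i], csol q (cR (w ^+ 2)) u du -> cL2left u ->
      exists c : R[i], forall x, u x = c * u0 x.

Definition is_eigen (q : R -> R) (lam : R) : Prop :=
  exists u du : R -> R, rop q u du (fun t => lam * u t) /\ L2 u /\
    exists x, u x != 0.

Definition phi_fun (psi : R -> R -> R[i]) (Rc : R -> R[i]) (w : R) (x : R) : R :=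
  2 * complex.Re (sqrtc (Rc w) * psi x w).

Definition Gplus (N : nat) (alpha : 'I_N -> R) (phi : 'I_N -> R -> R) (x : R) :
    'M[R]_N :=
  \matrix_(m < N, n < N)
    (alpha m * alpha n * Rintegral leb `]-oo, x] (fun s => phi m s * phi n s)).

End SchrodingerDefs.

(* Main.v *)
(* Boundary values. Let u0 be the real solution at energy w^2 which is square
   integrable at -oo, and let theta_n(., z) be the solution at energy z with the
   data of u0 at -n-1. The Cayley transform F_n(z) of theta_n'(0,z)/theta_n(0,z)
   is bounded by 1 and analytic in the upper half-plane, it converges to the
   Cayley transform of the Weyl function, and the Wronskian identity gives
   |F_n(z) - F_0|^2 = O(|z - w^2|^2 / Im z), uniformly in n, where F_0 belongs to
   u0. By Cauchy's theorem on a rectangle of size r standing on the real axis,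
   the mean of F_n - F_0 over the base is O(r^(1/2)); hence a continuous boundary
   value of the Weyl function at w is u0'(0)/u0(0). With the relation defining R
   this gives that R psi + conj psi is proportional to u0 at k = w, that |R| = 1,
   and that phi_n is a nonzero real multiple of u0.

   Darboux transformation. Put v_n = alpha_n phi_n, A = (1 + G)^-1, y = - v A.
   Wronskians of the v_n vanish at -oo (otherwise a second solution would be
   square integrable there, against uniqueness), so that
   W(v_m, v_n) = (w_m^2 - w_n^2) G_mn; this yields the equation for y.
   Since A' = - y^T y, the functions y_n are in L^2 and the integral of y_m y_n
   over [-b, b] is A_mn(-b) - A_mn(b).

   Orthogonality amounts to A_mn(+oo) = 0 for m <> n. Positivity bounds
   int_{X-l}^X (sum_m v_m(s) A_mn(X))^2 ds by A_nn(X-l) - A_nn(X), which tends to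
   0. On [X-l, X] each v_m is close to a free wave of frequency k_m near w_m, and
   free waves of distinct frequencies are almost orthogonal on long intervals, so
   A_mn(X) (|v_m| + |v_m'|)(X) -> 0. Hence y and v' A vanish at +oo, and so does
   A_mn (w_n^2 - w_m^2), the Wronskian of y_m and y_n. *)

(* Continuity is assumed along the set [good] of full measure, which need not contain the points
   w_n, and for psi and R but not psi'. So psi(x, w_n) is not known to have Jost asymptotics, v_n is
   not known to be bounded at +oo, and the limit of psi' must be recovered from psi. For this reason
   orthogonality is proved with Jost solutions at frequencies k_m near w_m, on windows whose length
   is fixed before the k_m, and with errors measured relative to the unknown amplitudes.

   The Weyl quotient enters as a relation, without uniqueness or analyticity: [weyl_bv] constrains
   all quotients, and compactness of the shooting solutions provides one. Analyticity is used for
   each fixed n only, where an exact formula for F_n(z) - F_n(w) yields a quadratic remainder.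

   Close to the base of the rectangle the estimate by |z - w^2|^2 / Im z is useless; there |F_n -
   F_0| <= 2 is enough, since that part of the sides has length a small fraction of r. The boundary
   values come as a limit in n inside a limit in the height of the base, for almost every k, so an
   Egorov argument for iterated limits selects one height and one n. *)
Require Import Defs.
From HB Require Import structures.
From mathcomp Require Import all_boot all_order all_algebra.
From mathcomp Require Import all_classical all_reals all_analysis.
From mathcomp.real_closed Require Import complex.
From mathcomp Require Import perm ring lra.
Set Implicit Arguments.
Unset Strict Implicit.
Unset Printing Implicit Defensive.
Import Order.TTheory GRing.Theory Num.Theory.
Import numFieldNormedType.Exports.
Local Open Scope ring_scope.
Local Open Scope classical_set_scope.

(** * Primitives of locally integrable functions *)

Section RealPrimitives.
Variable R : realType.
Local Notation leb := (@lebesgue_measure R).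
Implicit Types (f g h u v w p : R -> R) (a b c x y : R).

(* Integral form of "u is locally absolutely continuous and u' = f a.e.". *)
Definition prim u f : Prop :=
  loc_int f /\ forall a b, a <= b -> u b - u a = Rintegral leb `[a, b] f.

Lemma ext_eq f g : (forall x, f x = g x) -> f = g.
Proof. by move=> e; apply/funext. Qed.

Lemma cts_epsP f x : {for x, continuous f} <->
  forall e : R, 0 < e -> exists2 d : R, 0 < d &
    forall t, `|t - x| < d -> `|f t - f x| < e.
Proof.
split.
- move=> /cvgrPdist_lt cf e e0; have := cf e e0.
  move=> /nbhs_ballP [d /= d0 hd]; exists d => // t tx.
  by rewrite distrC; apply: hd; rewrite /ball/= distrC.
- move=> H; apply/cvgrPdist_lt => e e0; have [d d0 hd] := H e e0.
  apply/nbhs_ballP; exists d => // t /=; rewrite /ball/= => tx.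
  by rewrite distrC; apply: hd; rewrite distrC.
Qed.

Lemma cts_loc_int f : continuous f -> loc_int f.
Proof.
move=> cf a b; apply: continuous_compact_integrable.
  exact: segment_compact.
exact: continuous_subspaceT.
Qed.

Lemma loc_intD f g : loc_int f -> loc_int g -> loc_int (fun x => f x + g x).
Proof.
move=> hf hg a b; have := integrableD _ (hf a b) (hg a b).
by apply.
Qed.

Lemma loc_intZ c f : loc_int f -> loc_int (fun x => c * f x).
Proof.
move=> hf a b.
by have := integrableZl _ c (hf a b); apply.
Qed.

Lemma loc_intN f : loc_int f -> loc_int (fun x => - f x).
Proof.
move=> hf; have := loc_intZ (-1) hf.
by congr (loc_int); apply/ext_eq => x; rewrite mulN1r.
Qed.

Lemma loc_intB f g : loc_int f -> loc_int g -> loc_int (fun x => f x - g x).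
Proof. by move=> hf hg; exact: loc_intD hf (loc_intN hg). Qed.

Lemma loc_int_norm f : loc_int f -> loc_int (fun x => `|f x|).
Proof. by move=> hf a b; exact: (integrable_norm (hf a b)). Qed.

Lemma loc_intM f g : loc_int f -> continuous g -> loc_int (fun x => f x * g x).
Proof.
move=> hf cg a b.
have mI : measurable `[a, b] by [].
have := @integrableMl _ _ _ leb `[a, b] mI (EFin \o f) g (hf a b).
apply.
- exact: measurable_funS (measurable_realfun.continuous_measurable_fun cg).
- have cs : {within `[a, b], continuous g} by exact: continuous_subspaceT.
  have /compact_bounded[M [_ mrt]] := continuous_compact cs (@segment_compact _ a b).
  by exists M; split; rewrite ?num_real // => ? ? ? ?; exact: mrt.
Qed.

Lemma loc_int_cst c : loc_int (fun=> c).
Proof. by apply: cts_loc_int => x; exact: cst_continuous. Qed.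

Lemma Rintegral_chasles f a b c : loc_int f -> a <= b -> b <= c ->
  Rintegral leb `[a, c] f = Rintegral leb `[a, b] f + Rintegral leb `[b, c] f.
Proof.
move=> hf ab bc.
have := @Rintegral_itvB R f (BLeft a) (BRight c) b (hf a c).
rewrite !bnd_simp => /(_ ab bc).
rewrite Rintegral_itv_obnd_cbnd; last first.
  by apply: integrableS (hf b c) => //; apply: subset_itvr; rewrite bnd_simp.
by move=> <-; rewrite addrC subrK.
Qed.

Lemma prim_ext u f v g : prim u f -> (forall x, u x = v x) ->
  (forall x, f x = g x) -> prim v g.
Proof. by move=> + /ext_eq <- /ext_eq <-. Qed.

Lemma primD u f v g : prim u f -> prim v g ->
  prim (fun x => u x + v x) (fun x => f x + g x).
Proof.
move=> [lf hf] [lg hg]; split; first exact: loc_intD.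
move=> a b ab; rewrite RintegralD//.
by rewrite -hf// -hg//; ring.
Qed.

Lemma primZ c u f : prim u f -> prim (fun x => c * u x) (fun x => c * f x).
Proof.
move=> [lf hf]; split; first exact: loc_intZ.
by move=> a b ab; rewrite RintegralZl// -?hf//; ring.
Qed.

Lemma primN u f : prim u f -> prim (fun x => - u x) (fun x => - f x).
Proof.
by move=> /(primZ (-1)) h; apply: prim_ext h _ _ => x; rewrite mulN1r.
Qed.

Lemma primB u f v g : prim u f -> prim v g ->
  prim (fun x => u x - v x) (fun x => f x - g x).
Proof. by move=> hu hv; exact: primD hu (primN hv). Qed.

Lemma Rintegral_point f a : Rintegral leb `[a, a] f = 0.
Proof. by rewrite set_itv1 Rintegral_set1. Qed.

Lemma prim_cst c : prim (fun=> c) (fun=> 0).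
Proof.
split; first exact: loc_int_cst.
by move=> a b ab; rewrite Rintegral_cst// mul0r subrr.
Qed.

Lemma prim_id : prim id (fun=> 1).
Proof.
split; first exact: loc_int_cst.
move=> a b ab; rewrite Rintegral_cst//= mul1r lebesgue_measure_itv/=.
rewrite lte_fin; case: ltP => //= ba.
by have -> : a = b; [lra|rewrite subrr].
Qed.

Lemma prim_sum (I : Type) (r : seq I) (P : pred I) (u f : I -> R -> R) :
  (forall i, prim (u i) (f i)) ->
  prim (fun x => \sum_(i <- r | P i) u i x) (fun x => \sum_(i <- r | P i) f i x).
Proof.
move=> h; elim: r => [|i r ih].
  by apply: prim_ext (prim_cst 0) _ _ => x; rewrite big_nil.
case Pi: (P i).
  by apply: prim_ext (primD (h i) ih) _ _ => x; rewrite big_cons Pi.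
by apply: prim_ext ih _ _ => x; rewrite big_cons Pi.
Qed.

Lemma ex_prim f a : loc_int f -> exists u, prim u f /\ u a = 0.
Proof.
move=> lf.
pose I x y := Rintegral leb `[x, y] f.
exists (fun x => if a <= x then I a x else - I x a); split; last first.
  by rewrite lexx /I Rintegral_point.
split=> // x y xy; rewrite -/(I x y).
case: (leP a x) => ax; case: (leP a y) => ay.
- by rewrite {1}/I (Rintegral_chasles lf ax xy) /I; ring.
- by exfalso; lra.
- by rewrite /I (Rintegral_chasles lf (ltW ax) ay); ring.
- by rewrite opprK [I x a]/I (Rintegral_chasles lf xy (ltW ay)) /I; ring.
Qed.

Lemma prim_le u f a b : prim u f -> a <= b ->
  (forall x, a <= x <= b -> 0 <= f x) -> u a <= u b.
Proof.
move=> [lf hf] ab h; rewrite -subr_ge0 hf//; apply: Rintegral_ge0 => x /=.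
by rewrite in_itv/=; exact: h.
Qed.

Lemma prim_le2 u f v g a b : prim u f -> prim v g -> a <= b ->
  (forall x, a <= x <= b -> f x <= g x) -> u b - u a <= v b - v a.
Proof.
move=> hu hv ab h.
have := @prim_le _ _ a b (primB hv hu) ab.
have h' : forall x, a <= x <= b -> 0 <= g x - f x.
  by move=> x /h; rewrite subr_ge0.
by move=> /(_ h'); lra.
Qed.

Lemma prim_norm_le u f v g a b : prim u f -> prim v g -> a <= b ->
  (forall x, a <= x <= b -> `|f x| <= g x) -> `|u b - u a| <= v b - v a.
Proof.
move=> hu hv ab h; rewrite ler_norml; apply/andP; split.
  have := @prim_le2 _ _ _ _ a b (primN hv) hu ab.
  have h' : forall x, a <= x <= b -> - g x <= f x.
    by move=> x /h; rewrite ler_norml => /andP[].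
  by move=> /(_ h'); lra.
apply: (prim_le2 hu hv ab) => x /h; by rewrite ler_norml => /andP[].
Qed.

Lemma prim_unique u v f a : prim u f -> prim v f -> u a = v a ->
  forall x, u x = v x.
Proof.
move=> [_ hu] [_ hv] e x; case: (leP a x) => ax.
  by have := hu _ _ ax; rewrite -hv// e => /eqP; rewrite subr_eq subrK => /eqP.
have := hu _ _ (ltW ax); rewrite -hv ?ltW// e => h; lra.
Qed.

Lemma prim_cts u f : prim u f -> continuous u.
Proof.
move=> [lf hf] x; move: x => /= x.
have h1 : x - 1 <= x + 1 by lra.
have := parameterized_integral_continuous h1 (lf _ _).
have h2 : x - 1 < x + 1 by lra.
move=> /(continuous_within_itvP _ h2) [/(_ x) + _ _].
rewrite in_itv/= => /(_ _)/wrap[]; first by apply/andP; split; lra.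
rewrite /parameterized_integral => H.
apply/cts_epsP => e e0.
have [d d0 hd] := (cts_epsP _ _).1 H e e0.
exists (Num.min d 1); first by rewrite lt_min d0 ltr01.
move=> t; rewrite lt_min => /andP[td t1].
have t1' : x - 1 <= t.
  by move: t1; rewrite ltr_norml => /andP[]; lra.
have := hd t td.
rewrite -hf// -hf; last by lra.
by rewrite opprB addrA subrK.
Qed.

(* A sup argument: the set of x on which |D x - D a| <= e (H x - H a) is both
   open and closed to the right. *)
Lemma straddle (D H : R -> R) a b : a <= b ->
  (forall e x : R, 0 < e -> a <= x <= b -> exists2 d : R, 0 < d &
     forall s t, a <= s -> s <= x -> x <= t -> t <= b -> x - d < s -> t < x + d ->
       `|D t - D s| <= e * (H t - H s)) ->
  D b = D a.
Proof.
move=> ab h.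
have key e : 0 < e -> `|D b - D a| <= e * (H b - H a).
  move=> e0.
  pose S := [set x | a <= x <= b /\ `|D x - D a| <= e * (H x - H a)].
  have Sa : S a by split; rewrite ?lexx ?ab// !subrr normr0 mulr0.
  have Ss : has_sup S.
    by split; [exists a|exists b => x [/andP[]]].
  set c := sup S.
  have ac : a <= c by apply: ub_le_sup => //; exact: Ss.2.
  have cb : c <= b by apply: ge_sup => [|x [/andP[]]//]; exists a.
  have [d d0 hd] := h e c e0 ltac:(by rewrite ac cb).
  have cd : c - d < c by lra.
  have [s [/andP[as_ sb] Ds] cs] := sup_adherent d0 Ss.
  have sc : s <= c by apply: ub_le_sup; [exact: Ss.2|split=> //; rewrite as_ sb].
  have step t : c <= t -> t <= b -> t < c + d -> S t.
    move=> ct tb tc; split; first by rewrite tb (le_trans ac).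
    have h1 := hd s t as_ sc ct tb cs tc.
    have -> : D t - D a = (D t - D s) + (D s - D a) by ring.
    apply: (le_trans (ler_normD _ _)).
    have -> : e * (H t - H a) = e * (H t - H s) + e * (H s - H a) by ring.
    exact: lerD.
  case: (ltP b (c + d)) => bc.
    by have [] := step b cb (lexx _) bc.
  have [] : c + d / 2 <= c.
    2: lra.
  apply: ub_le_sup; first exact: Ss.2.
  apply: step; lra.
apply/eqP; rewrite -subr_eq0 -normr_le0; apply/ler_addgt0Pr => e e0.
rewrite add0r.
pose K := `|H b - H a| + 1.
have K0 : 0 < K by rewrite /K ltr_wpDl.
have := key (e / K) ltac:(exact: divr_gt0).
move=> /le_trans; apply.
rewrite mulrAC ler_pdivrMr// ler_pM2l//.
by rewrite /K; have := ler_norm (H b - H a); lra.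
Qed.

(** No almost everywhere differentiation is used. For s <= x <= t the function v(t) u + u(s) v - w
    has the same increment over [s, t] as u v - w, and its density (v(t) - v) f + (u(s) - u) g is
    small compared with |f| + |g| by continuity. *)
Lemma primM u f v g : prim u f -> prim v g ->
  prim (fun x => u x * v x) (fun x => f x * v x + u x * g x).
Proof.
move=> pu pv.
have cu := prim_cts pu; have cv := prim_cts pv.
have lf : loc_int (fun x => f x * v x + u x * g x).
  apply: loc_intD; first exact: loc_intM pu.1 cv.
  have := loc_intM pv.1 cu; congr loc_int.
  by apply/ext_eq => x; rewrite mulrC.
split=> // a b ab.
have [w [pw _]] := ex_prim a lf.
rewrite -(pw.2 _ _ ab).
have [H [pH _]] := ex_prim a (loc_intD (loc_int_norm pu.1) (loc_int_norm pv.1)).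
suff : u b * v b - w b = u a * v a - w a by lra.
apply: (@straddle (fun x => u x * v x - w x) H a b ab) => e x e0 _.
have e2 : 0 < e / 2 by rewrite divr_gt0.
have [d1 d10 hd1] := (cts_epsP _ _).1 (cu x) _ e2.
have [d2 d20 hd2] := (cts_epsP _ _).1 (cv x) _ e2.
exists (Num.min d1 d2); first by rewrite lt_min d10 d20.
move=> s t _ sx xt _ /[dup] + +; rewrite -!ltrBlDl.
move=> _ xs tx.
have near r : s <= r <= t -> `|u r - u x| < e/2 /\ `|v r - v x| < e/2.
  move=> /andP[sr rt].
  have : `|r - x| < Num.min d1 d2.
    rewrite ltr_norml; apply/andP; split; lra.
  by rewrite lt_min => /andP[/hd1 ? /hd2 ?].
have st : s <= t by lra.
have pU := primB (primD (primZ (v t) pu) (primZ (u s) pv)) pw.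
have := prim_norm_le pU (primZ e pH) st.
have -> : v t * u t + u s * v t - w t - (v t * u s + u s * v s - w s) =
   u t * v t - w t - (u s * v s - w s) by ring.
rewrite -mulrBr; apply => r rst.
have -> : v t * f r + u s * g r - (f r * v r + u r * g r) =
  (v t - v r) * f r + (u s - u r) * g r by ring.
apply: (le_trans (ler_normD _ _)); rewrite !normrM mulrDr.
have [u1 v1] := near r rst.
have [u2 _] : `|u s - u x| < e/2 /\ `|v s - v x| < e/2.
  by apply: near; rewrite lexx st.
have [_ v2] : `|u t - u x| < e/2 /\ `|v t - v x| < e/2.
  by apply: near; rewrite lexx st.
apply: lerD; apply: ler_wpM2r => //; apply: ltW.
  move: v1 v2; rewrite !ltr_norml => /andP[? ?] /andP[? ?].
  apply/andP; split; lra.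
move: u1 u2; rewrite !ltr_norml => /andP[? ?] /andP[? ?].
apply/andP; split; lra.
Qed.

Lemma derive_epsP (phi : R -> R) y l : is_derive y 1 phi l ->
  forall e : R, 0 < e -> exists2 d : R, 0 < d & forall t, `|t - y| < d ->
   `|phi t - phi y - l * (t - y)| <= e * `|t - y|.
Proof.
move=> hd e e0.
have dphi : derivable phi y 1 by exact: ex_derive.
have vphi : 'D_1 phi y = l by exact: derive_val.
have : (fun h : R => h^-1 *: (phi (h *: 1 + y) - phi y)) @ 0^' --> l.
  by rewrite -vphi; exact: dphi.
move=> /cvgrPdist_lt/(_ e e0).
move=> /nbhs_ballP [d /= d0 hh]; exists d => // t ty.
have [->|tny] := eqVneq t y.
  by rewrite !subrr mulr0 subrr normr0 mulr0.
have n0 : t - y != 0 by rewrite subr_eq0.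
have := hh (t - y); rewrite /ball/= sub0r normrN => /(_ ty n0).
rewrite [_%:A](_ : _ = t - y); last by rewrite /GRing.scale/= mulr1.
rewrite subrK /GRing.scale/= => H.
have -> : phi t - phi y - l * (t - y) = - ((t - y) * (l - (t - y)^-1 * (phi t - phi y))).
  by field.
by rewrite normrN normrM mulrC ler_wpM2r// ltW.
Qed.

(** Near x the map phi is replaced by its tangent at u(x). The tangent error is at most e/2 times |u
    - u(x)|, hence e/2 times an increment of the primitive H of |f|; what remains is linear in u. *)
Lemma prim_comp (phi dphi : R -> R) u f : (forall y, is_derive y 1 phi (dphi y)) ->
  continuous dphi -> prim u f ->
  prim (fun x => phi (u x)) (fun x => dphi (u x) * f x).
Proof.
move=> hd cd pu.
have cu := prim_cts pu.
have cdu : continuous (fun x => dphi (u x)).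
  by move=> x; apply: (@continuous_comp _ _ _ u dphi); [exact: cu|exact: cd].
have lf : loc_int (fun x => dphi (u x) * f x).
  have := loc_intM pu.1 cdu; congr loc_int.
  by apply/ext_eq => x; rewrite mulrC.
split=> // a b ab.
have [w [pw _]] := ex_prim a lf.
rewrite -(pw.2 _ _ ab).
have [H [pH _]] := ex_prim a (loc_int_norm pu.1).
suff : phi (u b) - w b = phi (u a) - w a by lra.
apply: (@straddle (fun x => phi (u x) - w x) (H) a b ab) => e x e0 _.
have e2 : 0 < e / 2 by rewrite divr_gt0.
have [d1 d10 hd1] := derive_epsP (hd (u x)) e2.
have [d2 d20 hd2] := (cts_epsP _ _).1 (cu x) _ d10.
have [d3 d30 hd3] := (cts_epsP _ _).1 (cdu x) _ e2.
exists (Num.min d2 d3); first by rewrite lt_min d20 d30.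
move=> s t _ sx xt _ xs tx.
have near r : s <= r <= t -> `|u r - u x| < d1 /\ `|dphi (u r) - dphi (u x)| < e/2.
  move=> /andP[sr rt].
  have : `|r - x| < Num.min d2 d3.
    rewrite ltr_norml; apply/andP; split; lra.
  by rewrite lt_min => /andP[/hd2 ? /hd3 ?].
have st : s <= t by lra.
have hs := hd1 (u s) (near s ltac:(by rewrite lexx st)).1.
have ht := hd1 (u t) (near t ltac:(by rewrite lexx st)).1.
have pU := primB (primZ (dphi (u x)) pu) pw.
have hU : `|dphi (u x) * u t - w t - (dphi (u x) * u s - w s)| <=
    e/2 * H t - e / 2 * H s.
  apply: (prim_norm_le pU (primZ (e/2) pH) st) => r rst.
  rewrite -mulrBl normrM; apply: ler_wpM2r => //; apply: ltW.
  by rewrite distrC; exact: (near r rst).2.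
have hus : `|u x - u s| <= H x - H s by exact: (prim_norm_le pu pH sx).
have hut : `|u t - u x| <= H t - H x by exact: (prim_norm_le pu pH xt).
rewrite distrC in hus.
have -> : phi (u t) - w t - (phi (u s) - w s) =
  (phi (u t) - phi (u x) - dphi (u x) * (u t - u x))
  - (phi (u s) - phi (u x) - dphi (u x) * (u s - u x)) +
  (dphi (u x) * u t - w t - (dphi (u x) * u s - w s)) by ring.
apply: (le_trans (ler_normD _ _)).
have A := ler_normB (phi (u t) - phi (u x) - dphi (u x) * (u t - u x))
  (phi (u s) - phi (u x) - dphi (u x) * (u s - u x)).
have Bs : e/2 * `|u s - u x| <= e/2 * (H x - H s) by rewrite ler_pM2l.
have Bt : e/2 * `|u t - u x| <= e/2 * (H t - H x) by rewrite ler_pM2l.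
nra.
Qed.

Lemma prim_FTC (phi dphi : R -> R) : (forall y, is_derive y 1 phi (dphi y)) ->
  continuous dphi -> prim phi dphi.
Proof.
move=> h c; apply: prim_ext (prim_comp h c prim_id) _ _ => x //.
by rewrite mulr1.
Qed.

(** Near a continuity point of f, the increments of u - f(x) id are dominated by e times those of
    id. This is the bridge from integral primitives to the classical derivatives in the theorem. *)
Lemma prim_is_derive u f x : prim u f -> {for x, continuous f} -> is_derive x 1 u (f x).
Proof.
move=> pu /cts_epsP cf.
have H : (fun h : R => h^-1 *: (u (h *: 1 + x) - u x)) @ 0^' --> f x.
  apply/cvgrPdist_le => e e0; have [d d0 hd] := cf e e0.
  apply/nbhs_ballP; exists d => // h; rewrite /ball/= sub0r normrN => hd' h0.
  rewrite [_%:A](_ : _ = h); last by rewrite /GRing.scale/= mulr1.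
  rewrite /GRing.scale/=.
  have nh : h != 0 by [].
  have -> : f x - h^-1 * (u (h + x) - u x) = - (h^-1 * (u (h + x) - u x - f x * h)).
    by field.
  rewrite normrN normrM normfV ler_pdivrMl ?normr_gt0// [leRHS]mulrC.
  have pU := primB pu (primZ (f x) prim_id).
  case: (leP 0 h) => h00.
    have := @prim_norm_le _ _ _ _ x (h + x) pU (primZ e prim_id) ltac:(lra).
    have -> : u (h + x) - f x * id (h + x) - (u x - f x * id x) = u (h + x) - u x - f x * h.
      by rewrite /=; ring.
    have -> : e * id (h + x) - e * id x = e * h by rewrite /=; ring.
    rewrite [X in _ -> _ <= e * X](ger0_norm h00); apply => r /andP[xr rh].
    rewrite !mulr1; apply/ltW/hd.
    by rewrite ger0_norm; [move: hd'; rewrite ger0_norm//; lra|lra].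
  have := @prim_norm_le _ _ _ _ (h + x) x pU (primZ e prim_id) ltac:(lra).
  have -> : u x - f x * id x - (u (h + x) - f x * id (h + x)) = - (u (h + x) - u x - f x * h).
    by rewrite /=; ring.
  rewrite normrN [X in _ -> _ <= e * X](ltr0_norm h00).
  have -> : e * id x - e * id (h + x) = e * - h by rewrite /=; ring.
  apply => r /andP[xr rh].
  rewrite !mulr1; apply/ltW/hd.
  move: hd'; rewrite ltr0_norm// => hd'; rewrite ler0_norm; lra.
apply: DeriveDef.
  by apply/cvg_ex; exists (f x); exact: H.
by apply/cvg_lim => //; exact: H.
Qed.

Lemma prim_expR p f : prim p f -> prim (fun x => expR (p x)) (fun x => expR (p x) * f x).
Proof.
by move=> pp; apply: prim_comp pp; exact: continuous_expR.
Qed.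

(* With W' = p g, the function (W + c) e^{-P} is nonincreasing. *)
Lemma gronwall_right (g p P W : R -> R) c a b : prim P p -> prim W (fun x => p x * g x) ->
  a <= b -> (forall x, a <= x <= b -> 0 <= p x) ->
  (forall x, a <= x <= b -> g x <= c + (W x - W a)) ->
  g b <= c * expR (P b - P a).
Proof.
move=> pP pW ab p0 hg.
have pW' := primB pW (prim_cst (W a - c)).
have := prim_le (primN (primM pW' (prim_expR (primN pP)))) ab.
have h0 : forall x, a <= x <= b -> 0 <= - ((p x * g x - 0) * expR (- P x) +
   (W x - (W a - c)) * (expR (- P x) * (- p x))).
  move=> x xab.
  have -> : - ((p x * g x - 0) * expR (- P x) +
      (W x - (W a - c)) * (expR (- P x) * (- p x))) =
     p x * expR (- P x) * (c + (W x - W a) - g x) by ring.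
  apply: mulr_ge0; last by rewrite subr_ge0; exact: hg.
  by apply: mulr_ge0; [exact: p0|exact: expR_ge0].
move=> /(_ h0) H.
apply: (le_trans (hg b ltac:(by rewrite ab lexx))).
rewrite expRD.
have H1 : (c + (W b - W a)) * expR (- P b) <= c * expR (- P a).
  move: H; rewrite lerN2 => H.
  have e1 : W b - (W a - c) = c + (W b - W a) by ring.
  have e2 : W a - (W a - c) = c by ring.
  by move: H; rewrite e1 e2.
have e0 : 0 < expR (P b) by exact: expR_gt0.
rewrite mulrCA mulrC -ler_pdivrMr// -expRN.
by [].
Qed.

Lemma gronwall_left (g p P W : R -> R) c a b : prim P p -> prim W (fun x => p x * g x) ->
  a <= b -> (forall x, a <= x <= b -> 0 <= p x) ->
  (forall x, a <= x <= b -> g x <= c + (W b - W x)) ->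
  g a <= c * expR (P b - P a).
Proof.
move=> pP pW ab p0 hg.
have pW' := primB (prim_cst (W b + c)) pW.
have := prim_le (primM pW' (prim_expR pP)) ab.
have h0 : forall x, a <= x <= b -> 0 <= (0 - p x * g x) * expR (P x) +
   (W b + c - W x) * (expR (P x) * (p x)).
  move=> x xab.
  have -> : (0 - p x * g x) * expR (P x) + (W b + c - W x) * (expR (P x) * (p x)) =
     p x * expR (P x) * (c + (W b - W x) - g x) by ring.
  apply: mulr_ge0; last by rewrite subr_ge0; exact: hg.
  by apply: mulr_ge0; [exact: p0|exact: expR_ge0].
move=> /(_ h0) H.
apply: (le_trans (hg a ltac:(by rewrite ab lexx))).
rewrite expRD expRN mulrA ler_pdivlMr ?expR_gt0//.
have -> : c + (W b - W a) = W b + c - W a by ring.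
by apply: (le_trans H); rewrite (_ : W b + c - W b = c)//; ring.
Qed.

End RealPrimitives.

(** * Linear systems with locally integrable coefficients *)

Section LinearSystems.
Variable R : realType.
Implicit Types (f u p : R -> R) (a b x y : R).

Lemma prim_exp u f n : prim u f ->
  prim (fun x => u x ^+ n.+1) (fun x => n.+1%:R * u x ^+ n * f x).
Proof.
move=> pu; elim: n => [|n ih].
  by apply: prim_ext pu _ _ => x; rewrite ?expr1 // expr0 mul1r mul1r.
apply: prim_ext (primM pu ih) _ _ => x; first by rewrite [RHS]exprS.
by rewrite exprS -(natr1 n.+1); ring.
Qed.

Lemma cancel_frac (A B C p m : R) : A != 0 -> B != 0 ->
  C / (A * B) * (A * p * m) = m * (C * (p / B)).
Proof. by move=> A0 B0; field; rewrite A0 B0. Qed.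

Lemma loc_int_sum (I : Type) (r : seq I) (h : I -> R -> R) :
  (forall i, loc_int (h i)) -> loc_int (fun x => \sum_(i <- r) h i x).
Proof.
move=> hl; elim: r => [|i r ih].
  have := @loc_int_cst R 0; congr loc_int; apply/ext_eq => x.
  by rewrite big_nil.
have := loc_intD (hl i) ih; congr loc_int; apply/ext_eq => x.
by rewrite big_cons.
Qed.

Lemma cts_uniform_limit f :
  (forall x e : R, 0 < e -> exists g : R -> R, continuous g /\
     forall t, `|t - x| < 1 -> `|f t - g t| <= e) -> continuous f.
Proof.
move=> h x; apply/cts_epsP => e e0.
have e4 : 0 < e / 4 by rewrite divr_gt0.
have [g [cg hg]] := h x _ e4.
have [d d0 hd] := (cts_epsP _ _).1 (cg x) _ e4.
exists (Num.min d 1); first by rewrite lt_min d0 ltr01.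
move=> t; rewrite lt_min => /andP[/hd t1 /hg t2].
have t3 := hg x ltac:(by rewrite subrr normr0).
move: t1 t2 t3; rewrite !ltr_norml !ler_norml.
by move=> /andP[? ?] /andP[? ?] /andP[? ?]; apply/andP; split; lra.
Qed.

Lemma series_tail_le (s t : nat -> R) m : (forall n, `|s n| <= t n) -> cvgn (series t) ->
  cvgn (series s) /\ `|limn (series s) - series s m| <= limn (series t) - series t m.
Proof.
move=> st ct.
have t0 n : 0 <= t n by apply: le_trans (st n).
have cs : cvgn (series s).
  apply: normed_cvg; apply: series_le_cvg ct => //= n; exact: st.
split=> //.
have H : (fun n => limn (series t) - series t m - `|series s n - series s m|) @ \oo -->
  limn (series t) - series t m - `|limn (series s) - series s m|.
  apply: cvgB; first exact: cvg_cst.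
  by apply: cvg_norm; apply: cvgB => //; exact: cvg_cst.
rewrite -subr_ge0 -(cvg_lim _ H)//.
apply: limr_ge; first by apply/cvg_ex; eexists; exact: H.
exists m => // n /= mn; rewrite subr_ge0.
have h1 : `|series s n - series s m| <= series t n - series t m.
  rewrite !sub_series_geq//; apply: (le_trans (ler_norm_sum _ _ _)).
  exact: ler_sum.
apply: (le_trans h1); rewrite lerD2r.
apply: nondecreasing_cvgn_le => //.
by apply: nondecreasing_series => i _ _; exact: t0.
Qed.

Variables (I : finType) (M : I -> I -> R -> R).
Hypothesis lM : forall i j, loc_int (M i j).

(** Picard iteration, with x measured by the primitive P of the sum m of all |M i j|: the n-th
    iterate is bounded by C |P|^n / n!, so the series of iterates converges locally uniformly like
    the exponential series. *)
Lemma linear_system_ex (x0 : R) (c : I -> R) : exists Y : I -> R -> R,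
  (forall i, Y i x0 = c i) /\
  forall i, prim (Y i) (fun x => \sum_j M i j x * Y j x).
Proof.
(* A total primitive operator, with a dummy value off the locally integrable functions: the iterates
   are then defined by plain recursion, and their continuity is proved afterwards. *)
pose prm f : R -> R :=
  if pselect (loc_int f) is left h then sval (cid (ex_prim x0 h)) else fun=> 0.
have prmP f : loc_int f -> prim (prm f) f /\ prm f x0 = 0.
  by move=> lf; rewrite /prm; case: pselect => // h; exact: svalP (cid (ex_prim x0 h)).
pose Z := fix Z n : I -> R -> R := if n is n'.+1 then
   fun i => prm (fun x => \sum_j M i j x * Z n' j x) else fun i => fun=> c i.
pose m x := \sum_i \sum_j `|M i j x|.
have lm : loc_int m.
  by do 2 (apply: loc_int_sum => ?); exact: loc_int_norm.
have m0 x : 0 <= m x by apply: sumr_ge0 => i _; exact: sumr_ge0.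
have [P [pP P0]] := ex_prim x0 lm.
pose C := \sum_i `|c i|.
have C0 : 0 <= C by exact: sumr_ge0.
have mi i x : \sum_j `|M i j x| <= m x.
  by rewrite /m [leRHS](bigD1 i)//= lerDl; apply: sumr_ge0 => k _; exact: sumr_ge0.
have lMZ (z : I -> R -> R) i : (forall j, continuous (z j)) ->
    loc_int (fun x => \sum_j M i j x * z j x).
  by move=> cz; apply: loc_int_sum => j; exact: loc_intM.
have cZ n i : continuous (Z n i).
  elim: n i => [|n ih] i; first by move=> x; exact: cst_continuous.
  by have [pZ _] := prmP _ (lMZ (Z n) i ih); exact: prim_cts pZ.
have pZ n i : prim (Z n.+1 i) (fun x => \sum_j M i j x * Z n j x) /\ Z n.+1 i x0 = 0.
  exact: prmP (lMZ (Z n) i (cZ n)).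
have MZ (z : I -> R) i x B : (forall j, `|z j| <= B) ->
    `|\sum_j M i j x * z j| <= m x * B.
  move=> zB; apply: (le_trans (ler_norm_sum _ _ _)).
  have B0 : 0 <= B by exact: le_trans (zB i).
  apply: (@le_trans _ _ (\sum_j `|M i j x| * B)).
    by apply: ler_sum => j _; rewrite normrM ler_wpM2l.
  by rewrite -mulr_suml ler_wpM2r.
have bZ n i x : `|Z n i x| <= C * (`|P x| ^+ n / n`!%:R).
  elim: n i x => [|n ih] i x.
    rewrite expr0 fact0 divr1 mulr1 /= /C (bigD1 i)//= lerDl.
    exact: sumr_ge0.
  have [pZi Zi0] := pZ n i.
  have fn0 : (n`!%:R : R) != 0 by rewrite pnatr_eq0 -lt0n fact_gt0.
  have n0 : (n.+1%:R : R) != 0 by rewrite pnatr_eq0.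
  (* To the left of x0 the primitive P is nonpositive, so the bound is integrated there with powers
     of - P. *)
  have [xx|/ltW xx] := leP x0 x.
    have Px t : x0 <= t <= x -> 0 <= P t.
      move=> /andP[t1 t2]; rewrite -P0; apply: (prim_le pP t1) => r _; exact: m0.
    have pv := primZ (C / n.+1`!%:R) (prim_exp n pP).
    have := prim_norm_le pZi pv xx.
    rewrite Zi0 P0 subr0 expr0n /= mulr0 subr0 [in X in _ -> _ <= X](ger0_norm); last first.
      by apply: Px; rewrite xx lexx.
    rewrite mulrAC -mulrA; apply => t tx.
    rewrite factS natrM.
    have -> : C / (n.+1%:R * n`!%:R) * (n.+1%:R * P t ^+ n * m t) =
       m t * (C * (P t ^+ n / n`!%:R)) by rewrite ?mulrN ?opprK; exact: cancel_frac.
    by apply: MZ => j; rewrite -[P t]ger0_norm ?Px//; exact: ih.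
  have Px t : x <= t <= x0 -> P t <= 0.
    move=> /andP[t1 t2]; rewrite -P0; apply: (prim_le pP t2) => r _; exact: m0.
  have pv := primN (primZ (C / n.+1`!%:R) (prim_exp n (primN pP))).
  have := prim_norm_le pZi pv xx.
  rewrite Zi0 P0 sub0r normrN oppr0 expr0n /= mulr0 oppr0 sub0r opprK.
  rewrite [in X in _ -> _ <= X](ler0_norm); last first.
    by apply: Px; rewrite xx lexx.
  rewrite mulrAC -mulrA; apply => t tx.
  rewrite factS natrM.
  have -> : - (C / (n.+1%:R * n`!%:R) * (n.+1%:R * (- P t) ^+ n * - m t)) =
     m t * (C * ((- P t) ^+ n / n`!%:R)) by rewrite ?mulrN ?opprK; exact: cancel_frac.
  by apply: MZ => j; rewrite -[- P t]ler0_norm ?Px//; exact: ih.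
pose S i x := limn (series (fun n => Z n i x)).
pose T k i x := series (fun n => Z n i x) k.
have cT k i : continuous (T k i).
  elim: k => [|k ih].
    have -> : T 0%N i = fun=> 0 by apply/ext_eq => x; rewrite /T /series/= big_geq.
    by move=> x; exact: cst_continuous.
  have -> : T k.+1 i = fun x => T k i x + Z k i x.
    by apply/ext_eq => x; rewrite /T seriesSr.
  by move=> x; apply: cvgD; [exact: ih|exact: cZ].
have pT k i : prim (T k.+1 i) (fun x => \sum_j M i j x * T k j x).
  elim: k => [|k ih].
    apply: prim_ext (prim_cst (c i)) _ _ => x; rewrite /T /series/=.
      by rewrite big_nat1.
    by rewrite big1// => j _; rewrite big_geq// mulr0.
  apply: prim_ext (primD ih (pZ k i).1) _ _ => x; first by rewrite /T [RHS]seriesSr.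
  rewrite -big_split/=; apply: eq_bigr => j _.
  by rewrite -mulrDr /T [in RHS]seriesSr.
have tail L e : 0 < e -> exists k0, forall k, (k0 <= k)%N ->
    forall i x, `|x - x0| <= L -> `|S i x - T k i x| <= e.
  move=> e0.
  pose K := Num.max `|P (x0 - L)| `|P (x0 + L)|.
  have PK x : `|x - x0| <= L -> `|P x| <= K.
    rewrite ler_norml => /andP[x1 x2].
    have h1 : P (x0 - L) <= P x by apply: (prim_le pP) => [|*]; [lra|exact: m0].
    have h2 : P x <= P (x0 + L) by apply: (prim_le pP) => [|*]; [lra|exact: m0].
    rewrite /K le_max !ler_normr.
    case: (leP 0 (P x)) => Px; [rewrite ger0_norm// h2 orbT|rewrite ltr0_norm//].
      by [].
    by rewrite lerN2 h1 orbT.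
  pose t n := C * (K ^+ n / n`!%:R).
  have ct : cvgn (series t).
    have -> : t = C *: exp_coeff K by apply/funext.
    by apply: is_cvg_seriesZ; exact: is_cvg_series_exp_coeff.
  move: (ct) => /cvgrPdist_le/(_ _ e0) [k0 _ hk].
  exists k0 => k kk i x xL.
  have bt n : `|Z n i x| <= t n.
    apply: (le_trans (bZ n i x)); apply: ler_wpM2l => //.
    by apply: ler_wpM2r => //; apply: lerXn2r; rewrite ?nnegrE// ?(PK x)//
      (le_trans _ (PK x xL)).
  have [_ h] := series_tail_le k bt ct.
  by apply: (le_trans h); apply: le_trans (hk k kk); exact: ler_norm.
have cS i : continuous (S i).
  apply: cts_uniform_limit => x e e0.
  have [k0 h] := tail (`|x - x0| + 1) e e0.
  exists (T k0 i); split=> // t tx; apply: h => //.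
  have -> : t - x0 = (t - x) + (x - x0) by ring.
  by apply: (le_trans (ler_normD _ _)); lra.
have S0 i : S i x0 = c i.
  rewrite /S.
  apply/cvg_lim => //; apply: cvg_near_cst; exists 1%N => // k /= k1.
  case: k k1 => // k _; rewrite /series/= big_nat_recl//= big1 ?addr0// => j _.
  exact: (pZ j i).2.
exists S; split=> // i; split; first exact: lMZ.
move=> a b ab.
have [W [pW _]] := ex_prim a (lMZ S i cS).
rewrite -(pW.2 _ _ ab).
apply/eqP; rewrite -subr_eq0 -normr_le0; apply/ler_addgt0Pr => e e0; rewrite add0r.
pose L := Num.max `|a - x0| `|b - x0|.
(* Replacing S by a partial sum costs e / K at each end point and (e / K) (P b - P a) under the
   integral. *)
pose K := 2 + (P b - P a).
have Pab : P a <= P b by apply: (prim_le pP ab) => *; exact: m0.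
have K0 : 0 < K by rewrite /K; lra.
have [k0 h] := tail L (e / K) ltac:(by rewrite divr_gt0).
have pD := primB (pT k0 i) pW.
have hD : `|T k0.+1 i b - W b - (T k0.+1 i a - W a)| <= e / K * P b - e / K * P a.
  apply: (prim_norm_le pD (primZ (e/K) pP) ab) => r /andP[r1 r2].
  rewrite -sumrB [leRHS]mulrC.
  under eq_bigr do rewrite -mulrBr.
  apply: MZ => j; rewrite distrC; apply: h => //.
  rewrite /L le_max !ler_normr.
  case: (leP x0 r) => rx; [rewrite ger0_norm ?subr_ge0//|rewrite ltr0_norm ?subr_lt0//].
    by apply/orP; right; apply/orP; left; lra.
  by apply/orP; left; apply/orP; right; lra.
have ha := h k0.+1 (leqnSn _) i a ltac:(by rewrite /L le_max lexx).
have hb := h k0.+1 (leqnSn _) i b ltac:(by rewrite /L le_max lexx orbT).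
have -> : S i b - S i a - (W b - W a) = (S i b - T k0.+1 i b) - (S i a - T k0.+1 i a) +
  (T k0.+1 i b - W b - (T k0.+1 i a - W a)) by ring.
apply: (le_trans (ler_normD _ _)).
apply: (@le_trans _ _ (e / K + e / K + (e / K * P b - e / K * P a))).
  apply: lerD => //; apply: (le_trans (ler_normB _ _)); exact: lerD.
have -> : e / K + e / K + (e / K * P b - e / K * P a) = e / K * K by rewrite /K; ring.
by rewrite divfK// gt_eqF.
Qed.

End LinearSystems.

(** * Complex-valued solutions *)

Section ComplexModulus.
Variable R : realType.
Implicit Types (z w : R[i]) (r s : R).
Local Notation Re := complex.Re.
Local Notation Im := complex.Im.

Lemma cReM z w : Re (z * w) = Re z * Re w - Im z * Im w.
Proof. by case: z; case: w. Qed.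
Lemma cImM z w : Im (z * w) = Re z * Im w + Im z * Re w.
Proof. by case: z; case: w. Qed.
Lemma cReD z w : Re (z + w) = Re z + Re w.
Proof. by case: z; case: w. Qed.
Lemma cImD z w : Im (z + w) = Im z + Im w.
Proof. by case: z; case: w. Qed.
Lemma cReN z : Re (- z) = - Re z.
Proof. by case: z. Qed.
Lemma cImN z : Im (- z) = - Im z.
Proof. by case: z. Qed.
Lemma cReJ z : Re z^*%C = Re z.
Proof. by case: z. Qed.
Lemma cImJ z : Im z^*%C = - Im z.
Proof. by case: z. Qed.
Definition ReImE := (cReM, cImM, cReD, cImD, cReN, cImN, cReJ, cImJ).

Lemma complex_ext z w : Re z = Re w -> Im z = Im w -> z = w.
Proof. by case: z => a b; case: w => c d /= -> ->. Qed.

Lemma cabsE z : cabs z = ComplexField.Normc.normc z.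
Proof. by case: z. Qed.

Lemma cabs_ge0 z : 0 <= cabs z.
Proof. exact: sqrtr_ge0. Qed.

Lemma cabs0 : cabs (0 : R[i]) = 0.
Proof. by rewrite cabsE ComplexField.Normc.normc0. Qed.

Lemma cabs_eq0 z : cabs z = 0 -> z = 0.
Proof. by rewrite cabsE; exact: ComplexField.Normc.eq0_normc. Qed.

Lemma cabs_gt0 z : z != 0 -> 0 < cabs z.
Proof.
move=> z0; rewrite lt_neqAle cabs_ge0 andbT eq_sym.
by apply: contra_neq z0; exact: cabs_eq0.
Qed.

Lemma cabsM z w : cabs (z * w) = cabs z * cabs w.
Proof. by rewrite !cabsE ComplexField.Normc.normcM. Qed.

Lemma cabsV z : cabs z^-1 = (cabs z)^-1.
Proof. by rewrite !cabsE ComplexField.Normc.normcV. Qed.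

Lemma cabs_sqr z : cabs z ^+ 2 = Re z ^+ 2 + Im z ^+ 2.
Proof. by rewrite sqr_sqrtr// addr_ge0 ?sqr_ge0. Qed.

Lemma cabsD z w : cabs (z + w) <= cabs z + cabs w.
Proof. by rewrite !cabsE; exact: le_normcD. Qed.

Lemma cabsN z : cabs (- z) = cabs z.
Proof. by rewrite /cabs cReN cImN !sqrrN. Qed.

Lemma cabsJ z : cabs z^*%C = cabs z.
Proof. by rewrite /cabs cReJ cImJ sqrrN. Qed.

Lemma cabsB z w : cabs (z - w) <= cabs z + cabs w.
Proof. by rewrite -(cabsN w); exact: cabsD. Qed.

Lemma cabs_distC z w : cabs (z - w) = cabs (w - z).
Proof. by rewrite -cabsN opprB. Qed.

Lemma cabs_Re z : `|Re z| <= cabs z.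
Proof.
rewrite -(ler_pXn2r (n := 2)) ?nnegrE ?cabs_ge0//.
by rewrite cabs_sqr real_normK ?num_real// lerDl sqr_ge0.
Qed.

Lemma cabs_Im z : `|Im z| <= cabs z.
Proof.
rewrite -(ler_pXn2r (n := 2)) ?nnegrE ?cabs_ge0//.
by rewrite cabs_sqr real_normK ?num_real// lerDr sqr_ge0.
Qed.

Lemma cabs_ReIm z : cabs z <= `|Re z| + `|Im z|.
Proof.
rewrite -(ler_pXn2r (n := 2)) ?nnegrE ?cabs_ge0 ?addr_ge0//.
rewrite cabs_sqr -(real_normK (num_real (Re z))) -(real_normK (num_real (Im z))).
have := mulr_ge0 (normr_ge0 (Re z)) (normr_ge0 (Im z)); nra.
Qed.

Lemma cabs_cR r : cabs (cR r) = `|r|.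
Proof. by rewrite /cabs /cR /= expr0n/= addr0 sqrtr_sqr. Qed.

Lemma cRM r s : cR (r * s) = cR r * cR s.
Proof. by apply: complex_ext; rewrite !ReImE /=; ring. Qed.
Lemma cRD r s : cR (r + s) = cR r + cR s.
Proof. by apply: complex_ext; rewrite !ReImE /=; ring. Qed.
Lemma cRN r : cR (- r) = - cR r.
Proof. by apply: complex_ext; rewrite !ReImE /=; ring. Qed.
Lemma cRJ r : (cR r)^*%C = cR r.
Proof. by apply: complex_ext; rewrite !ReImE /=; ring. Qed.

End ComplexModulus.

(** * Complex primitives and existence of solutions *)

Section ComplexPrimitives.
Variable R : realType.
Implicit Types (z w lam : R[i]) (r s : R) (u v f g : R -> R[i]).
Local Notation Re := complex.Re.
Local Notation Im := complex.Im.

Definition cprim u f : Prop :=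
  prim (fun x => Re (u x)) (fun x => Re (f x)) /\
  prim (fun x => Im (u x)) (fun x => Im (f x)).

Lemma csolE (q : R -> R) lam u v : csol q lam u v <->
  cprim u v /\ cprim v (fun t => (cR (q t) - lam) * u t).
Proof.
have E (a b : R) (h k : R -> R[i]) : h b - h a = cint a b k <->
  Re (h b) - Re (h a) = Rintegral lebesgue_measure `[a, b] (fun t => Re (k t)) /\
  Im (h b) - Im (h a) = Rintegral lebesgue_measure `[a, b] (fun t => Im (k t)).
  split=> [e|[e1 e2]].
    have := congr1 (@complex.Re R) e; have := congr1 (@complex.Im R) e.
    by rewrite !ReImE.
  by apply: complex_ext; rewrite !ReImE.
split=> [[[l1 l2] [[l3 l4] h]]|[[[l1 h1] [l2 h2]] [[l3 h3] [l4 h4]]]].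
  by split; split; split=> // a b ab; have [/E[? ?] /E[? ?]] := h a b ab.
split; first by split.
split; first by split.
by move=> a b ab; split; apply/E; split; [exact: h1|exact: h2|exact: h3|exact: h4].
Qed.

Lemma cprim_ext u f v g : cprim u f -> (forall x, u x = v x) ->
  (forall x, f x = g x) -> cprim v g.
Proof. by move=> + /funext <- /funext <-. Qed.

Lemma cprimD u f v g : cprim u f -> cprim v g ->
  cprim (fun x => u x + v x) (fun x => f x + g x).
Proof.
move=> [h1 h2] [h3 h4]; split.
  by apply: prim_ext (primD h1 h3) _ _ => x; rewrite cReD.
by apply: prim_ext (primD h2 h4) _ _ => x; rewrite cImD.
Qed.

Lemma cprimM u f v g : cprim u f -> cprim v g ->
  cprim (fun x => u x * v x) (fun x => f x * v x + u x * g x).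
Proof.
move=> [h1 h2] [h3 h4]; split.
  apply: prim_ext (primB (primM h1 h3) (primM h2 h4)) _ _ => x; rewrite !ReImE//; ring.
apply: prim_ext (primD (primM h1 h4) (primM h2 h3)) _ _ => x; rewrite !ReImE//; ring.
Qed.

Lemma cprim_cst z : cprim (fun=> z) (fun=> 0).
Proof. by split; exact: prim_cst. Qed.

Lemma cprimZ z u f : cprim u f -> cprim (fun x => z * u x) (fun x => z * f x).
Proof.
move=> h; apply: cprim_ext (cprimM (cprim_cst z) h) _ _ => x //.
by rewrite mul0r add0r.
Qed.

Lemma cprimN u f : cprim u f -> cprim (fun x => - u x) (fun x => - f x).
Proof. by move=> /(cprimZ (-1)) h; apply: cprim_ext h _ _ => x; rewrite mulN1r. Qed.

Lemma cprimB u f v g : cprim u f -> cprim v g ->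
  cprim (fun x => u x - v x) (fun x => f x - g x).
Proof. by move=> hu hv; exact: cprimD hu (cprimN hv). Qed.

Lemma cprimJ u f : cprim u f -> cprim (fun x => (u x)^*%C) (fun x => (f x)^*%C).
Proof.
move=> [h1 h2]; split; first by apply: prim_ext h1 _ _ => x; rewrite cReJ.
by apply: prim_ext (primN h2) _ _ => x; rewrite cImJ.
Qed.

Lemma cprim_cR (p k : R -> R) : prim p k -> cprim (fun x => cR (p x)) (fun x => cR (k x)).
Proof. by move=> h; split=> //; exact: prim_cst. Qed.

(* Pairing with the conjugate of the increment reduces to the real case. *)
Lemma cprim_cabs_le u f (V h : R -> R) (a b : R) : cprim u f -> prim V h -> a <= b ->
  (forall x, a <= x <= b -> cabs (f x) <= h x) -> cabs (u b - u a) <= V b - V a.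
Proof.
move=> pu pV ab fh.
set z := u b - u a.
have [->|z0] := eqVneq z 0.
  rewrite cabs0 subr_ge0; apply: (prim_le pV ab) => x /fh; apply: le_trans.
  exact: cabs_ge0.
have zp := cabs_gt0 z0.
have [h1 _] := cprimZ z^*%C pu.
have := prim_norm_le h1 (primZ (cabs z) pV) ab.
have -> : Re (z^*%C * u b) - Re (z^*%C * u a) = cabs z ^+ 2.
  by rewrite cabs_sqr /z !ReImE; ring.
have H x : a <= x <= b -> `|Re (z^*%C * f x)| <= cabs z * h x.
  move=> /fh fx; apply: (le_trans (cabs_Re _)).
  by rewrite cabsM cabsJ ler_wpM2l// cabs_ge0.
move=> /(_ H); rewrite ger0_norm ?sqr_ge0// -mulrBr expr2.
by rewrite ler_pM2l.
Qed.

Definition ccts u := continuous (fun x => Re (u x)) /\ continuous (fun x => Im (u x)).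

Lemma cprim_ccts u f : cprim u f -> ccts u.
Proof. by case=> h1 h2; split; [exact: prim_cts h1|exact: prim_cts h2]. Qed.

Lemma ccts_cabs u : ccts u -> continuous (fun x => cabs (u x)).
Proof.
move=> [h1 h2] x; apply/cts_epsP => e e0.
have e2 : 0 < e / 2 by rewrite divr_gt0.
have [d1 d10 hd1] := (cts_epsP _ _).1 (h1 x) _ e2.
have [d2 d20 hd2] := (cts_epsP _ _).1 (h2 x) _ e2.
exists (Num.min d1 d2); first by rewrite lt_min d10 d20.
move=> t; rewrite lt_min => /andP[/hd1 t1 /hd2 t2].
have A : cabs (u t - u x) < e.
  apply: (le_lt_trans (cabs_ReIm _)); rewrite !ReImE; lra.
rewrite ltr_norml; apply/andP; split.
  have := cabsB (u t) (u t - u x); rewrite opprB addrC subrK.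
  lra.
have := cabsD (u t - u x) (u x); rewrite subrK; lra.
Qed.

Lemma sum_bool_bool (F : bool * bool -> R) :
  \sum_p F p = F (true, true) + F (true, false) + F (false, true) + F (false, false).
Proof.
have -> : \sum_p F p = \sum_a \sum_b F (a, b).
  by rewrite pair_bigA; apply: eq_bigr => -[].
rewrite big_bool/= !big_bool/=; ring.
Qed.

Lemma csol_ex (q : R -> R) lam (x0 : R) (c d : R[i]) : loc_int q ->
  exists u v, [/\ csol q lam u v, u x0 = c & v x0 = d].
Proof.
move=> lq.
(* A real system in four unknowns: the first Boolean tells u' from u, the second the imaginary from
   the real part. *)
pose M (i j : bool * bool) (x : R) : R := match i, j with
  | (false, b), (true, b') => (b == b')%:R
  | (true, false), (false, false) => q x - Re lam
  | (true, false), (false, true) => Im lam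
  | (true, true), (false, true) => q x - Re lam
  | (true, true), (false, false) => - Im lam
  | _, _ => 0 end.
have lM i j : loc_int (M i j).
  case: i => -[] []; case: j => -[] []; rewrite /M; try exact: loc_int_cst.
    by apply: loc_intB lq _; exact: loc_int_cst.
  by apply: loc_intB lq _; exact: loc_int_cst.
pose c0 (i : bool * bool) : R := match i with
  | (false, false) => Re c | (false, true) => Im c
  | (true, false) => Re d | (true, true) => Im d end.
have [Y [Y0 pY]] := linear_system_ex lM x0 c0.
exists (fun x => Complex (Y (false, false) x) (Y (false, true) x)).
exists (fun x => Complex (Y (true, false) x) (Y (true, true) x)).
split; last 2 first.
- by rewrite !Y0 /=; case: (c).
- by rewrite !Y0 /=; case: (d).
apply/csolE; split; split.
- by apply: prim_ext (pY (false, false)) _ _ => x //=; rewrite sum_bool_bool /M/=; ring.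
- by apply: prim_ext (pY (false, true)) _ _ => x //=; rewrite sum_bool_bool /M/=; ring.
- by apply: prim_ext (pY (true, false)) _ _ => x //=; rewrite sum_bool_bool /M !ReImE/=; ring.
- by apply: prim_ext (pY (true, true)) _ _ => x //=; rewrite sum_bool_bool /M !ReImE/=; ring.
Qed.

End ComplexPrimitives.

(** * Gronwall bounds and dependence on the energy *)

Section Schrodinger.
Variable R : realType.
Variable q : R -> R.
Hypothesis lq : loc_int q.
Implicit Types (z w lam : R[i]) (u v f g : R -> R[i]).
Local Notation Re := complex.Re.
Local Notation Im := complex.Im.

Lemma csolD lam u du v dv : csol q lam u du -> csol q lam v dv ->
  csol q lam (fun x => u x + v x) (fun x => du x + dv x).
Proof.
move=> /csolE[h1 h2] /csolE[h3 h4]; apply/csolE; split; first exact: cprimD.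
by apply: cprim_ext (cprimD h2 h4) _ _ => x //; rewrite mulrDr.
Qed.

Lemma csolZ lam z u du : csol q lam u du ->
  csol q lam (fun x => z * u x) (fun x => z * du x).
Proof.
move=> /csolE[h1 h2]; apply/csolE; split; first exact: cprimZ.
by apply: cprim_ext (cprimZ z h2) _ _ => x //; rewrite mulrCA.
Qed.

Lemma csolJ lam u du : csol q lam u du ->
  csol q lam^*%C (fun x => (u x)^*%C) (fun x => (du x)^*%C).
Proof.
move=> /csolE[h1 h2]; apply/csolE; split; first exact: cprimJ.
apply: cprim_ext (cprimJ h2) _ _ => x //.
by apply: complex_ext; rewrite !ReImE /=; ring.
Qed.

Lemma wronskian_cprim lam mu u du v dv : csol q lam u du -> csol q mu v dv ->
  cprim (fun x => u x * dv x - du x * v x) (fun x => (lam - mu) * (u x * v x)).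
Proof.
move=> /csolE[h1 h2] /csolE[h3 h4].
apply: cprim_ext (cprimB (cprimM h1 h4) (cprimM h2 h3)) _ _ => x //; ring.
Qed.

(** Gronwall for |u| + |u'|, whose growth rate is at most 1 + |q| + K for all lam in the disc of
    radius K. The source h is there for the difference of two solutions at distinct energies. *)
Lemma csol_gronwall lam u du h (H K A B x0 y : R) (P : R -> R) :
  prim P (fun x => 1 + `|q x| + K) ->
  cprim u du -> cprim du (fun t => (cR (q t) - lam) * u t + h t) ->
  cabs lam <= K -> 0 <= H ->
  (forall t, A <= t <= B -> cabs (h t) <= H) ->
  A <= x0 <= B -> A <= y <= B ->
  cabs (u y) + cabs (du y) <= (cabs (u x0) + cabs (du x0) + H * (B - A)) * expR (P B - P A).
Proof.
move=> pP pu pdu lK H0 hH /andP[Ax xB] /andP[Ay yB].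
pose N x := cabs (u x) + cabs (du x).
pose p x := 1 + `|q x| + K.
have K0 : 0 <= K by apply: le_trans lK; exact: cabs_ge0.
have p0 x : 0 <= p x by rewrite /p; have := normr_ge0 (q x); lra.
have N0 x : 0 <= N x by rewrite /N addr_ge0 ?cabs_ge0.
have cu := ccts_cabs (cprim_ccts pu); have cdu := ccts_cabs (cprim_ccts pdu).
have cN : continuous N by move=> x; apply: cvgD; [exact: cu|exact: cdu].
have [W [pW _]] := ex_prim x0 (loc_intM pP.1 cN).
have plu := cts_loc_int cu; have pldu := cts_loc_int cdu.
have [Wd [pWd _]] := ex_prim x0 pldu.
have lg : loc_int (fun x => (`|q x| + K) * cabs (u x) + H).
  apply: loc_intD; last exact: loc_int_cst.
  apply: loc_intM cu; apply: loc_intD; [exact: loc_int_norm|exact: loc_int_cst].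
have [Wg [pWg _]] := ex_prim x0 lg.
have dist s t : A <= s -> s <= t -> t <= B ->
    cabs (u t - u s) + cabs (du t - du s) <= W t - W s + H * (t - s).
  move=> As st tB.
  have e1 := cprim_cabs_le pu pWd st (fun x _ => lexx _).
  have e2 : cabs (du t - du s) <= Wg t - Wg s.
    apply: (cprim_cabs_le pdu pWg st) => x /andP[sx xt].
    apply: (le_trans (cabsD _ _)); apply: lerD; last first.
      by apply: hH; rewrite (le_trans As sx) (le_trans xt tB).
    rewrite cabsM ler_wpM2r ?cabs_ge0//.
    by apply: (le_trans (cabsB _ _)); rewrite cabs_cR lerD2l.
  apply: (le_trans (lerD e1 e2)).
  have := prim_le2 (primD pWd pWg) (primD pW (primZ H (@prim_id R))) st.
  have hh x : s <= x <= t -> cabs (du x) + ((`|q x| + K) * cabs (u x) + H) <=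
      (1 + `|q x| + K) * N x + H * 1.
    move=> _; rewrite mulr1 /N.
    have := mulr_ge0 (addr_ge0 (normr_ge0 (q x)) K0) (cabs_ge0 (du x)).
    have := cabs_ge0 (u x); lra.
  by move=> /(_ hh) /=; lra.
have Px s t : s <= t -> P s <= P t.
  by move=> st; apply: (prim_le pP st) => x _; exact: p0.
have AB : A <= B by lra.
have fin s t : A <= s -> s <= t -> t <= B ->
    (N x0 + H * (B - A)) * expR (P t - P s) <= (N x0 + H * (B - A)) * expR (P B - P A).
  move=> As st tB; apply: ler_wpM2l.
    by apply: addr_ge0 => //; apply: mulr_ge0; lra.
  by rewrite ler_expR; have := Px _ _ As; have := Px _ _ tB; lra.
have tri z w : cabs z <= cabs w + cabs (z - w).
  by have := cabsD w (z - w); rewrite addrC subrK.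
have [xy|/ltW yx] := leP x0 y.
  apply: le_trans (fin x0 y Ax xy yB).
  apply: (@gronwall_right R N p P W (N x0 + H * (B - A)) x0 y pP pW xy) => [x _//|x /andP[xx xyy]].
  have := dist x0 x Ax xx ltac:(lra); have := tri (u x) (u x0); have := tri (du x) (du x0).
  have : H * (x - x0) <= H * (B - A) by apply: ler_wpM2l => //; lra.
  rewrite /N; lra.
apply: le_trans (fin y x0 Ay yx xB).
apply: (@gronwall_left R N p P W (N x0 + H * (B - A)) y x0 pP pW yx) => [x _//|x /andP[xx xyy]].
have := dist x x0 ltac:(lra) xyy xB; have := tri (u x) (u x0); have := tri (du x) (du x0).
rewrite (cabs_distC (u x)) (cabs_distC (du x)).
have : H * (x0 - x) <= H * (B - A) by apply: ler_wpM2l => //; lra.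
rewrite /N; lra.
Qed.

Lemma ex_gronwall_prim (K : R) : exists P : R -> R, prim P (fun x => 1 + `|q x| + K).
Proof.
have [|P [pP _]] := @ex_prim R (fun x => 1 + `|q x| + K) 0; last by exists P.
by do 2 (try apply: loc_intD); try exact: loc_int_cst; exact: loc_int_norm.
Qed.

Lemma csol_bound (K A B : R) : exists C : R, 0 <= C /\ forall lam u du x0 y,
  cabs lam <= K -> csol q lam u du -> A <= x0 <= B -> A <= y <= B ->
  cabs (u y) + cabs (du y) <= C * (cabs (u x0) + cabs (du x0)).
Proof.
have [P pP] := ex_gronwall_prim K.
exists (expR (P B - P A)); split; first exact: expR_ge0.
move=> {}lam u du x0 y lK /csolE[h1 h2] x0AB yAB.
have h2' : cprim du (fun t => (cR (q t) - lam) * u t + 0).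
  by apply: cprim_ext h2 _ _ => x //; rewrite addr0.
have := csol_gronwall (H := 0) pP h1 h2' lK (lexx _) _ x0AB yAB.
rewrite mul0r addr0 mulrC; apply => t _; by rewrite cabs0.
Qed.

Lemma csol_zero lam u du (x0 : R) : csol q lam u du -> u x0 = 0 -> du x0 = 0 ->
  forall x, u x = 0 /\ du x = 0.
Proof.
move=> hs u0 du0 x.
have [C [C0 hC]] := csol_bound (cabs lam) (Num.min x x0) (Num.max x x0).
have := hC _ _ _ x0 x (lexx _) hs.
rewrite u0 du0 cabs0 addr0 mulr0 !ge_min !le_max !lexx !orbT => /(_ isT isT).
have := cabs_ge0 (u x); have := cabs_ge0 (du x) => h1 h2 h3.
by split; apply: cabs_eq0; lra.
Qed.

Lemma csol_unique lam u du v dv (x0 : R) : csol q lam u du -> csol q lam v dv ->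
  u x0 = v x0 -> du x0 = dv x0 -> forall x, u x = v x /\ du x = dv x.
Proof.
move=> hu hv e1 e2 x.
have hs := csolD hu (csolZ (-1) hv).
have [] := csol_zero hs (x0 := x0) _ _ x.
- by rewrite e1; ring.
- by rewrite e2; ring.
by rewrite !mulN1r => /eqP; rewrite subr_eq0 => /eqP -> /eqP; rewrite subr_eq0 => /eqP ->.
Qed.

(** The difference u - v has zero data at x0 and solves the equation at energy lam with source (mu -
    lam) v, where v is already bounded by [csol_bound]. *)
Lemma csol_continuous_dep (K A B x0 c0 : R) : A <= x0 <= B ->
  exists C : R, 0 <= C /\ forall lam mu u du v dv,
  cabs lam <= K -> cabs mu <= K -> csol q lam u du -> csol q mu v dv ->
  u x0 = v x0 -> du x0 = dv x0 -> cabs (u x0) + cabs (du x0) <= c0 ->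
  forall y, A <= y <= B ->
    cabs (u y - v y) + cabs (du y - dv y) <= C * cabs (lam - mu).
Proof.
move=> x0AB.
have [C1 [C10 hC1]] := csol_bound K A B.
have [P pP] := ex_gronwall_prim K.
have AB : 0 <= B - A by case/andP: x0AB; lra.
pose c1 := Num.max c0 0.
have c10 : 0 <= c1 by rewrite le_max lexx orbT.
exists (C1 * c1 * (B - A) * expR (P B - P A)); split.
  by rewrite !mulr_ge0 ?expR_ge0.
move=> lam mu u du v dv lK mK hu hv e1 e2 uc y yAB.
have vb t : A <= t <= B -> cabs (v t) <= C1 * c1.
  move=> tAB; have := hC1 _ _ _ x0 t mK hv x0AB tAB.
  rewrite -e1 -e2 => h; have := cabs_ge0 (dv t).
  have : C1 * (cabs (u x0) + cabs (du x0)) <= C1 * c1.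
    by apply: ler_wpM2l => //; rewrite le_max uc.
  lra.
move: (hu) (hv) => /csolE[h1 h2] /csolE[h3 h4].
have pd : cprim (fun t => du t - dv t)
    (fun t => (cR (q t) - lam) * (u t - v t) + (mu - lam) * v t).
  by apply: cprim_ext (cprimB h2 h4) _ _ => x //; ring.
have H0 : 0 <= cabs (lam - mu) * (C1 * c1) by rewrite !mulr_ge0 ?cabs_ge0.
have := csol_gronwall pP (cprimB h1 h3) pd lK H0 _ x0AB yAB.
rewrite e1 e2 !subrr cabs0 !add0r => h.
apply: (le_trans (h _)).
  move=> t /vb vt; rewrite cabsM cabs_distC ler_wpM2l ?cabs_ge0//.
rewrite le_eqVlt; apply/orP; left; apply/eqP; ring.
Qed.

End Schrodinger.

(** * Cauchy's theorem on a rectangle *)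

Section CauchyRectangle.
Variable R : realType.
Implicit Types (z w : R[i]) (r s t x y : R) (u v f g : R -> R[i]).
Local Notation Re := complex.Re.
Local Notation Im := complex.Im.

Lemma cprim_cint u f (a b : R) : cprim u f -> a <= b -> u b - u a = cint a b f.
Proof.
move=> [[_ h1] [_ h2]] ab; apply: complex_ext; rewrite !ReImE /=.
  exact: h1.
exact: h2.
Qed.

Lemma ex_cprim f (a : R) : ccts f -> exists u, cprim u f /\ u a = 0.
Proof.
move=> [h1 h2].
have [u1 [p1 e1]] := ex_prim a (cts_loc_int h1).
have [u2 [p2 e2]] := ex_prim a (cts_loc_int h2).
exists (fun x => Complex (u1 x) (u2 x)); split=> //.
by rewrite e1 e2.
Qed.

Lemma ccts_lipschitz f K : (forall x y, cabs (f x - f y) <= K * `|x - y|) -> ccts f.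
Proof.
move=> h; have gen (F : R -> R) : (forall x y, `|F x - F y| <= cabs (f x - f y)) -> continuous F.
  move=> hF x; apply/cts_epsP => e e0.
  have K1 : 0 < `|K| + 1 by rewrite ltr_wpDl.
  exists (e / (`|K| + 1)); first exact: divr_gt0.
  move=> t; rewrite ltr_pdivlMr// => tx.
  apply: (le_lt_trans (hF t x)); apply: (le_lt_trans (h t x)).
  apply: le_lt_trans tx; rewrite mulrC ler_wpM2l//.
  by have := ler_norm K; lra.
split; apply: gen => x y.
  by have := cabs_Re (f x - f y); rewrite !ReImE.
by have := cabs_Im (f x - f y); rewrite !ReImE.
Qed.

(** Quadratic increments leave no room for a derivative. This takes the place of differentiation
    under the integral sign: increments need only be known up to second order. *)
Lemma quadratic_const f K (a b : R) : a <= b ->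
  (forall s t, a <= s -> s <= t -> t <= b -> cabs (f t - f s) <= K * (t - s) ^+ 2) ->
  f b = f a.
Proof.
move=> ab h.
have gen (F : R -> R) : (forall x y, `|F x - F y| <= cabs (f x - f y)) -> F b = F a.
  move=> hF; apply: (@straddle _ F id a b ab) => e x e0 _.
  have K1 : 0 < `|K| + 1 by rewrite ltr_wpDl.
  exists (e / (`|K| + 1) / 2); first by rewrite !divr_gt0.
  move=> s t as_ sx xt tb xs tx.
  apply: (le_trans (hF t s)); apply: (le_trans (h s t as_ (le_trans sx xt) tb)).
  rewrite expr2 mulrA; apply: ler_wpM2r; first by lra.
  apply: (@le_trans _ _ ((`|K| + 1) * (t - s))).
    by apply: ler_wpM2r; [lra|have := ler_norm K; lra].
  by rewrite mulrC -ler_pdivlMr//; lra.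
apply: complex_ext.
  by apply: (gen (fun x => Re (f x))) => x y; have := cabs_Re (f x - f y); rewrite !ReImE.
by apply: (gen (fun x => Im (f x))) => x y; have := cabs_Im (f x - f y); rewrite !ReImE.
Qed.

Lemma cprim_linear_approx u f K (s t : R) : cprim u f -> s <= t ->
  (forall x, s <= x <= t -> cabs (f x - f s) <= K * (x - s)) ->
  0 <= K ->
  cabs (u t - u s - f s * cR (t - s)) <= K * (t - s) ^+ 2.
Proof.
move=> pu st h K0.
have pi := cprim_cR (@prim_id R).
have pU := cprimB pu (cprimZ (f s) pi).
have := cprim_cabs_le pU (primZ (K * (t - s)) (@prim_id R)) st.
have -> : u t - f s * cR t - (u s - f s * cR s) = u t - u s - f s * cR (t - s).
  by rewrite cRD cRN; ring.
have -> : K * (t - s) * id t - K * (t - s) * id s = K * (t - s) ^+ 2 by rewrite /=; ring.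
apply => x /andP[sx xt]; rewrite (_ : cR 1 = 1)// !mulr1.
apply: (le_trans (h x _)); first by rewrite sx xt.
by rewrite ler_wpM2l//; lra.
Qed.

(** Precomposing with this projection extends estimates from the rectangle to the whole plane, so
    that primitives along its sides exist on all of R. *)
Definition clamp (a b x : R) := Num.max a (Num.min b x).

Lemma clamp_in a b x : a <= b -> a <= clamp a b x <= b.
Proof.
by move=> ab; rewrite /clamp le_max lexx/= ge_max ab ge_min lexx.
Qed.

Lemma clamp_id a b x : a <= x <= b -> clamp a b x = x.
Proof.
by move=> /andP[ax xb]; rewrite /clamp min_r// max_r.
Qed.

Lemma clamp_lip a b x y : a <= b -> `|clamp a b x - clamp a b y| <= `|x - y|.
Proof.
move=> ab.
have E t : clamp a b t = if t <= a then a else if b <= t then b else t.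
  rewrite /clamp; case: (leP t a) => ta; first by rewrite max_l// ge_min ta orbT.
  by case: (leP b t) => bt; rewrite max_r// ltW.
rewrite !E ler_norml.
have n1 := ler_norm (x - y); have n2 := ler_norm (y - x); rewrite (distrC y) in n2.
by case: (leP x a) => h1; case: (leP y a) => h2; case: (leP b x) => h3; case: (leP b y) => h4;
  apply/andP; split; lra.
Qed.

Definition pt (x y : R) : R[i] := Complex x y.

Lemma cabs_pt x y : cabs (pt x y) <= `|x| + `|y|.
Proof. exact: cabs_ReIm. Qed.

(* Each of the three integrals is compared, on a strip of height h, with its
   first-order approximation; the errors are O(h^2). *)
Lemma cauchy_rectangle_clamped (f g : R -> R -> R[i]) (x1 x2 y1 y2 K : R)
  (V : R -> R -> R[i]) (V1 V2 : R -> R[i]) :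
  x1 <= x2 -> y1 <= y2 -> 0 <= K ->
  (forall x y x' y', cabs (f x y - f x' y') <= K * (`|x - x'| + `|y - y'|)) ->
  (forall x y x' y', cabs (g x y - g x' y') <= K * (`|x - x'| + `|y - y'|)) ->
  (forall x y x' y', x1 <= x <= x2 -> x1 <= x' <= x2 -> y1 <= y <= y2 -> y1 <= y' <= y2 ->
    cabs (f x' y' - f x y - g x y * pt (x' - x) (y' - y)) <=
      K * (`|x' - x| + `|y' - y|) ^+ 2) ->
  (forall y, cprim (V y) (f^~ y)) -> cprim V1 (f x1) -> cprim V2 (f x2) ->
  V y2 x2 - V y2 x1 - (V y1 x2 - V y1 x1) =
    pt 0 1 * (V2 y2 - V2 y1 - (V1 y2 - V1 y1)).
Proof.
move=> x12 y12 K0 lf lg qfg pV pV1 pV2.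
have cg y : ccts (g^~ y).
  by apply: (@ccts_lipschitz _ K) => x x'; have := lg x y x' y; rewrite subrr normr0 addr0.
(* On each horizontal segment g integrates to the increment of f, because f minus the primitive of g
   has quadratic increments. *)
have step1 y : y1 <= y <= y2 -> exists W, cprim W (g^~ y) /\
    W x2 - W x1 = f x2 y - f x1 y.
  move=> yy; have [W [pW _]] := ex_cprim x1 (cg y); exists W; split=> //.
  have := @quadratic_const (fun x => f x y - W x) (K + K) x1 x2 x12.
  have H s t : x1 <= s -> s <= t -> t <= x2 ->
      cabs (f t y - W t - (f s y - W s)) <= (K + K) * (t - s) ^+ 2.
    move=> xs st tx.
    have h1 := qfg s y t y ltac:(lra) ltac:(lra) yy yy.
    have h2 := @cprim_linear_approx W (g^~ y) K s t pW st _ K0.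
    have h3 : forall x, s <= x <= t -> cabs (g x y - g s y) <= K * (x - s).
      move=> x /andP[sx _]; apply: (le_trans (lg _ _ _ _)).
      by rewrite subrr normr0 addr0 ger0_norm// subr_ge0.
    have {}h2 := h2 h3.
    have -> : f t y - W t - (f s y - W s) = (f t y - f s y - g s y * pt (t - s) (y - y)) -
      (W t - W s - g s y * cR (t - s)).
      rewrite subrr /pt -/(cR _); ring.
    apply: (le_trans (cabsB _ _)).
    move: h1; rewrite subrr normr0 addr0 ger0_norm ?subr_ge0// mulrDl => h1.
    exact: lerD.
  by move=> /(_ H) h; have -> : W x2 = W x1 + (f x2 y - f x1 y);
    [have -> : W x2 = f x2 y - (f x2 y - W x2) by ring|]; [rewrite h; ring|ring].
(* J is the integral of f over the segment at height y. Its rate of change is i times the integral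
   of g there, that is i times the increment of f, which is also the rate of i (V2 - V1). *)
pose J y := V y x2 - V y x1.
have pd : cprim (fun y => pt 0 1 * (V2 y - V1 y)) (fun y => pt 0 1 * (f x2 y - f x1 y)).
  exact: cprimZ (cprimB pV2 pV1).
have := @quadratic_const (fun y => J y - pt 0 1 * (V2 y - V1 y)) (K * (x2 - x1) + (K + K)) y1 y2 y12.
have H s t : y1 <= s -> s <= t -> t <= y2 ->
   cabs (J t - pt 0 1 * (V2 t - V1 t) - (J s - pt 0 1 * (V2 s - V1 s)))
    <= (K * (x2 - x1) + (K + K)) * (t - s) ^+ 2.
  move=> ys st ty.
  have sy : y1 <= s <= y2 by lra.
  have [W [pW eW]] := step1 s sy.
  have p1 := cprimB (cprimB (pV t) (pV s)) (cprimZ (pt 0 (t - s)) pW).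
  have h1 := cprim_cabs_le p1 (primZ (K * (t - s) ^+ 2) (@prim_id R)) x12.
  have h1' : forall x, x1 <= x <= x2 ->
     cabs (f x t - f x s - pt 0 (t - s) * g x s) <= K * (t - s) ^+ 2 * 1.
    move=> x xx; have := qfg x s x t xx xx sy ltac:(lra).
    rewrite subrr normr0 add0r (ger0_norm (x := t - s)) ?subr_ge0// mulr1.
    by rewrite (mulrC (g x s)).
  have {}h1 := h1 h1'.
  have h2 := @cprim_linear_approx _ _ (K + K) s t pd st _ (addr_ge0 K0 K0).
  have h2' : forall x, s <= x <= t ->
     cabs (pt 0 1 * (f x2 x - f x1 x) - pt 0 1 * (f x2 s - f x1 s)) <= (K + K) * (x - s).
    move=> x /andP[sx _].
    have -> : pt 0 1 * (f x2 x - f x1 x) - pt 0 1 * (f x2 s - f x1 s) =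
      pt 0 1 * ((f x2 x - f x2 s) - (f x1 x - f x1 s)) by ring.
    rewrite cabsM (_ : cabs (pt 0 1) = 1) ?mul1r; last first.
      by rewrite /cabs /= expr0n/= add0r expr1n sqrtr1.
    apply: (le_trans (cabsB _ _)); rewrite mulrDl; apply: lerD;
      by apply: (le_trans (lf _ _ _ _)); rewrite subrr normr0 add0r ger0_norm// subr_ge0.
  have {}h2 := h2 h2'.
  have -> : J t - pt 0 1 * (V2 t - V1 t) - (J s - pt 0 1 * (V2 s - V1 s)) =
     (V t x2 - V s x2 - pt 0 (t - s) * W x2 - (V t x1 - V s x1 - pt 0 (t - s) * W x1))
     - (pt 0 1 * (V2 t - V1 t) - pt 0 1 * (V2 s - V1 s) -
        pt 0 1 * (f x2 s - f x1 s) * cR (t - s)).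
    have e : pt 0 (t - s) = pt 0 1 * cR (t - s).
      by apply: complex_ext; rewrite !ReImE /=; ring.
    have eW2 : W x2 = W x1 + (f x2 s - f x1 s) by rewrite -eW; ring.
    rewrite e eW2 /J; ring.
  apply: (le_trans (cabsB _ _)).
  rewrite [leRHS]mulrDl; apply: lerD => //.
  by apply: (le_trans h1); rewrite le_eqVlt; apply/orP; left; apply/eqP; rewrite /=; ring.
move=> /(_ H) h.
have h' : J y2 = J y1 - pt 0 1 * (V2 y1 - V1 y1) + pt 0 1 * (V2 y2 - V1 y2).
  by rewrite -h; ring.
move: h'; rewrite /J => ->; ring.
Qed.

(** The vertical sides are cut at ym since the intended f has only a crude bound S1 near the base
    and a good one S2 above. The smoothness constant K does not enter the final bound. *)
Lemma cauchy_rectangle_bound (f g : R[i] -> R[i]) (x1 x2 y1 ym y2 K T S1 S2 : R) :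
  let rect p := x1 <= Re p <= x2 /\ y1 <= Im p <= y2 in
  x1 <= x2 -> y1 <= ym -> ym <= y2 -> 0 <= K ->
  (forall p p', rect p -> rect p' -> cabs (f p' - f p) <= K * cabs (p' - p)) ->
  (forall p p', rect p -> rect p' ->
     cabs (f p' - f p - g p * (p' - p)) <= K * cabs (p' - p) ^+ 2) ->
  (forall x, x1 <= x <= x2 -> cabs (f (pt x y2)) <= T) ->
  (forall y, y1 <= y <= ym -> cabs (f (pt x1 y)) <= S1 /\ cabs (f (pt x2 y)) <= S1) ->
  (forall y, ym <= y <= y2 -> cabs (f (pt x1 y)) <= S2 /\ cabs (f (pt x2 y)) <= S2) ->
  exists V, cprim V (fun x => f (pt (clamp x1 x2 x) y1)) /\
    cabs (V x2 - V x1) <= T * (x2 - x1) + 2 * (S1 * (ym - y1) + S2 * (y2 - ym)).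
Proof.
move=> rect x12 y1m ym2 K0 lf qf hT hS1 hS2.
have y12 : y1 <= y2 by lra.
pose c x y := pt (clamp x1 x2 x) (clamp y1 y2 y).
have cr x y : rect (c x y) by split; exact: clamp_in.
have dc x y x' y' : cabs (c x y - c x' y') <= `|x - x'| + `|y - y'|.
  apply: (le_trans (cabs_ReIm _)); rewrite !ReImE /=; apply: lerD; exact: clamp_lip.
have lfc x y x' y' : cabs (f (c x y) - f (c x' y')) <= (2 * K) * (`|x - x'| + `|y - y'|).
  apply: (le_trans (lf _ _ (cr _ _) (cr _ _))).
  have := dc x y x' y'; have := cabs_ge0 (c x y - c x' y'); nra.
(* Adding the first-order expansions at p and at p' shows that the derivative itself is Lipschitz,
   with constant 2 K. *)
have lg p p' : rect p -> rect p' -> cabs (g p - g p') <= 2 * K * cabs (p - p').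
  move=> rp rp'; have [->|pp] := eqVneq p p'; first by rewrite !subrr cabs0 mulr0.
  have pp0 : 0 < cabs (p - p') by apply: cabs_gt0; rewrite subr_eq0.
  rewrite -(ler_pM2r pp0) -cabsM.
  have -> : (g p - g p') * (p - p') = (f p - f p' - g p' * (p - p')) +
     (f p' - f p - g p * (p' - p)) by ring.
  apply: (le_trans (cabsD _ _)).
  have := qf _ _ rp rp'; have := qf _ _ rp' rp; rewrite (cabs_distC p' p) expr2; lra.
have lgc x y x' y' : cabs (g (c x y) - g (c x' y')) <= (2 * K) * (`|x - x'| + `|y - y'|).
  apply: (le_trans (lg _ _ (cr _ _) (cr _ _))).
  by apply: ler_wpM2l; [lra|exact: dc].
have K20 : 0 <= 2 * K by lra.
have qfc x y x' y' : x1 <= x <= x2 -> x1 <= x' <= x2 -> y1 <= y <= y2 -> y1 <= y' <= y2 ->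
    cabs (f (c x' y') - f (c x y) - g (c x y) * pt (x' - x) (y' - y)) <=
      2 * K * (`|x' - x| + `|y' - y|) ^+ 2.
  move=> xx xx' yy yy'.
  have -> : pt (x' - x) (y' - y) = c x' y' - c x y.
    by rewrite /c !clamp_id//; apply: complex_ext; rewrite !ReImE.
  apply: (le_trans (qf _ _ (cr _ _) (cr _ _))).
  apply: ler_pM => //; [by rewrite exprn_ge0 ?cabs_ge0|lra|].
  by apply: lerXn2r; rewrite ?nnegrE ?cabs_ge0 ?addr_ge0//; exact: dc.
have cx y : ccts (fun x => f (c x y)).
  by apply: (@ccts_lipschitz _ (2 * K)) => x x'; have := lfc x y x' y; rewrite subrr normr0 addr0.
have cy x : ccts (fun y => f (c x y)).
  by apply: (@ccts_lipschitz _ (2 * K)) => y y'; have := lfc x y x y'; rewrite subrr normr0 add0r.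
have /choice [V hV] : forall y, exists v, cprim v (fun x => f (c x y)).
  by move=> y; have [v [pv _]] := ex_cprim x1 (cx y); exists v.
have [V1 [pV1 _]] := ex_cprim y1 (cy x1).
have [V2 [pV2 _]] := ex_cprim y1 (cy x2).
have H := @cauchy_rectangle_clamped (fun x y => f (c x y)) (fun x y => g (c x y)) x1 x2 y1 y2
  (2 * K) V V1 V2 x12 y12 K20 lfc lgc qfc hV pV1 pV2.
have cl1 : clamp y1 y2 y1 = y1 by rewrite clamp_id// lexx.
have cl2 : clamp y1 y2 y2 = y2 by rewrite clamp_id// lexx y12.
have clx1 : clamp x1 x2 x1 = x1 by rewrite clamp_id// lexx.
have clx2 : clamp x1 x2 x2 = x2 by rewrite clamp_id// lexx x12.
exists (V y1); split.
  by apply: cprim_ext (hV y1) _ _ => x //; rewrite /c cl1.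
have hV2 : cabs (V y2 x2 - V y2 x1) <= T * (x2 - x1).
  rewrite mulrBr; apply: (cprim_cabs_le (hV y2) (primZ T (@prim_id R)) x12) => x xx.
  by rewrite mulr1 /c cl2 clamp_id//; exact: hT.
have side (v : R -> R[i]) (z : R) : cprim v (fun y => f (c z y)) ->
   (forall y, y1 <= y <= ym -> cabs (f (pt (clamp x1 x2 z) y)) <= S1) ->
   (forall y, ym <= y <= y2 -> cabs (f (pt (clamp x1 x2 z) y)) <= S2) ->
   cabs (v y2 - v y1) <= S1 * (ym - y1) + S2 * (y2 - ym).
  move=> pv s1 s2.
  have -> : v y2 - v y1 = (v ym - v y1) + (v y2 - v ym) by ring.
  apply: (le_trans (cabsD _ _)); rewrite !mulrBr; apply: lerD.
    apply: (cprim_cabs_le pv (primZ S1 (@prim_id R)) y1m) => y yy.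
    by rewrite mulr1 /c (clamp_id (a := y1)); [exact: s1|lra].
  apply: (cprim_cabs_le pv (primZ S2 (@prim_id R)) ym2) => y yy.
  by rewrite mulr1 /c (clamp_id (a := y1)); [exact: s2|lra].
have h1 := side V1 x1 pV1; have h2 := side V2 x2 pV2.
rewrite clx1 in h1; rewrite clx2 in h2.
have {}h1 := h1 (fun y yy => (hS1 y yy).1) (fun y yy => (hS2 y yy).1).
have {}h2 := h2 (fun y yy => (hS1 y yy).2) (fun y yy => (hS2 y yy).2).
have -> : V y1 x2 - V y1 x1 = (V y2 x2 - V y2 x1) - pt 0 1 * ((V2 y2 - V2 y1) - (V1 y2 - V1 y1)).
  by rewrite -H; ring.
apply: (le_trans (cabsB _ _)); apply: lerD => //.
rewrite cabsM (_ : cabs (pt 0 1) = 1) ?mul1r; last first.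
  by rewrite /cabs /= expr0n/= add0r expr1n sqrtr1.
apply: (le_trans (cabsB _ _)); lra.
Qed.

End CauchyRectangle.

(** * Shooting solutions *)

Section Shooting.
Variable R : realType.
Variable q : R -> R.
Hypothesis lq : loc_int q.
Implicit Types (z w lam : R[i]).
Local Notation Re := complex.Re.
Local Notation Im := complex.Im.

Lemma ex_shoot (x0 : R) (c d : R[i]) : exists th : R[i] -> (R -> R[i]) * (R -> R[i]),
  forall z, [/\ csol q z (th z).1 (th z).2, (th z).1 x0 = c & (th z).2 x0 = d].
Proof.
have /choice [th h] : forall z, exists y : (R -> R[i]) * (R -> R[i]),
    [/\ csol q z y.1 y.2, y.1 x0 = c & y.2 x0 = d].
  by move=> z; have [u [v h]] := csol_ex z x0 c d lq; exists (u, v).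
by exists th.
Qed.

Variables (L A B : R).
Hypothesis L0 : 0 < L.
Variables th : R[i] -> (R -> R[i]) * (R -> R[i]).
Hypothesis thP : forall z, [/\ csol q z (th z).1 (th z).2,
   (th z).1 (- L) = cR A & (th z).2 (- L) = cR B].
Hypothesis nz : (A != 0) || (B != 0).

Local Notation a z := ((th z).1 0).
Local Notation b z := ((th z).2 0).
(** Denominator of the Cayley transform of v / u in homogeneous form, so that u = 0 is allowed. It
    dominates the numerator in modulus when Im (conj u v) <= 0, the sign found for solutions shot
    from the left at Im z >= 0. *)
Definition cayley_den (u v : R[i]) := v - pt 0 1 * u.
Definition cayley_num (u v : R[i]) := v + pt 0 1 * u.
Local Notation D z := (cayley_den (a z) (b z)).
Local Notation N z := (cayley_num (a z) (b z)).
Local Notation F z := (N z / D z).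
Local Notation S z w := (cint (- L) 0 (fun t => (th z).1 t * (th w).1 t)).

Let L0' : - L <= 0. Proof. by rewrite oppr_le0 ltW. Qed.

Lemma th_ccts z : ccts (th z).1.
Proof. by have [/csolE[h _] _ _] := thP z; exact: cprim_ccts h. Qed.

Lemma cctsM (f g : R -> R[i]) : ccts f -> ccts g -> ccts (fun t => f t * g t).
Proof.
move=> [f1 f2] [g1 g2]; split.
  have -> : (fun x => Re (f x * g x)) = (fun x => Re (f x) * Re (g x) - Im (f x) * Im (g x)).
    by apply/funext => x; rewrite cReM.
  by move=> x; apply: cvgB; apply: cvgM; [exact: f1|exact: g1|exact: f2|exact: g2].
have -> : (fun x => Im (f x * g x)) = (fun x => Re (f x) * Im (g x) + Im (f x) * Re (g x)).
  by apply/funext => x; rewrite cImM.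
by move=> x; apply: cvgD; apply: cvgM; [exact: f1|exact: g2|exact: f2|exact: g1].
Qed.

Lemma cint_cprim (f : R -> R[i]) (x y : R) : x <= y -> ccts f ->
  exists u, cprim u f /\ cint x y f = u y - u x.
Proof.
by move=> xy cf; have [u [pu _]] := ex_cprim x cf; exists u; rewrite (cprim_cint pu xy).
Qed.

(** The Wronskian vanishes at -L, where both solutions start from the same data A, B. *)
Lemma shoot_wronskian z w : a z * b w - b z * a w = (z - w) * S z w.
Proof.
have [h1 e1 e2] := thP z; have [h2 e3 e4] := thP w.
have [u [pu ->]] := cint_cprim L0' (cctsM (th_ccts z) (th_ccts w)).
have p1 := wronskian_cprim h1 h2.
have := cprim_cint p1 L0'; rewrite -(cprim_cint (cprimZ (z - w) pu) L0').
rewrite e1 e2 e3 e4 (mulrC (cR B)) subrr subr0 => ->; ring.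
Qed.

(** From the Wronskian of the solution with its conjugate, which vanishes at -L because A and B are
    real. *)
Lemma shoot_energy z : Im ((a z)^*%C * b z) =
  - Im z * Rintegral lebesgue_measure `[- L, 0] (fun t => Re ((th z).1 t) ^+ 2 + Im ((th z).1 t) ^+ 2).
Proof.
have [h1 e1 e2] := thP z.
have [_ p1] := wronskian_cprim (csolJ h1) h1.
have [c1 c2] := th_ccts z.
have ce : continuous (fun t => Re ((th z).1 t) ^+ 2 + Im ((th z).1 t) ^+ 2).
  have c3 : continuous (fun t => Re ((th z).1 t) * Re ((th z).1 t) + Im ((th z).1 t) * Im ((th z).1 t)).
    by move=> x; apply: cvgD; apply: cvgM; try exact: c1; exact: c2.
  by move: c3; congr (continuous _); apply/funext => t; rewrite !expr2.
have [u [pu _]] := ex_prim (- L) (cts_loc_int ce).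
rewrite -(pu.2 _ _ L0').
have p2 := primZ (- (2 * Im z)) pu.
have := prim_norm_le (primB p1 p2) (prim_cst 0) L0'.
rewrite e1 e2 !cRJ => h.
move: h => /(_ _)/wrap[].
  by move=> x _; rewrite normr_le0; apply/eqP; rewrite !ReImE; ring.
rewrite subrr normr_le0 => /eqP; rewrite !ReImE /= => h'.
lra.
Qed.

Lemma cayley_den_sqr (u v : R[i]) :
  cabs (cayley_den u v) ^+ 2 = cabs u ^+ 2 + cabs v ^+ 2 - 2 * Im (u^*%C * v).
Proof. by rewrite !cabs_sqr /cayley_den /pt !ReImE/=; ring. Qed.

Lemma cayley_num_sqr (u v : R[i]) :
  cabs (cayley_num u v) ^+ 2 = cabs u ^+ 2 + cabs v ^+ 2 + 2 * Im (u^*%C * v).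
Proof. by rewrite !cabs_sqr /cayley_num /pt !ReImE/=; ring. Qed.

Local Notation E z := (Rintegral (@lebesgue_measure R) `[- L, 0]
  (fun t => Re ((th z).1 t) ^+ 2 + Im ((th z).1 t) ^+ 2)).

Lemma shoot_E_ge0 z : 0 <= E z.
Proof. by apply: Rintegral_ge0 => x _; rewrite addr_ge0 ?sqr_ge0. Qed.

Lemma shoot_den_ge z : 0 <= Im z -> cabs (a z) ^+ 2 + cabs (b z) ^+ 2 <= cabs (D z) ^+ 2.
Proof.
move=> z0; rewrite cayley_den_sqr shoot_energy.
have := mulr_ge0 z0 (shoot_E_ge0 z); lra.
Qed.

Lemma shoot_den_ge_energy z : 0 <= Im z -> 2 * Im z * E z <= cabs (D z) ^+ 2.
Proof.
move=> z0; rewrite cayley_den_sqr shoot_energy.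
have := sqr_ge0 (cabs (a z)); have := sqr_ge0 (cabs (b z)); lra.
Qed.

(** Gronwall run from 0 back to -L: data at 0 cannot be small when those at -L are not, and for Im z
    >= 0 the denominator dominates the data at 0. *)
Lemma shoot_den_lb K : exists c : R, 0 < c /\ forall z, cabs z <= K -> 0 <= Im z -> c <= cabs (D z).
Proof.
have [C [C0 hC]] := csol_bound lq K (- L) 0.
pose n := `|A| + `|B|.
have n0 : 0 < n.
  by case/orP: nz => h; [rewrite ltr_pwDl ?normr_gt0|rewrite ltr_wpDl ?normr_gt0].
have C1 : 0 < C + 1 by lra.
exists (n / (C + 1) / 2); split; first by rewrite !divr_gt0.
move=> z zK z0; have [h1 e1 e2] := thP z.
have := hC z _ _ 0 (- L) zK h1; rewrite L0' !lexx e1 e2 !cabs_cR => /(_ isT isT).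
rewrite -/n => h.
have h2 := shoot_den_ge z0.
have h3 : n <= (C + 1) * (cabs (a z) + cabs (b z)).
  by have := cabs_ge0 (a z); have := cabs_ge0 (b z); lra.
have h4 : cabs (a z) + cabs (b z) <= 2 * cabs (D z).
  have := cabs_ge0 (a z); have := cabs_ge0 (b z); have := cabs_ge0 (D z).
    have := sqr_ge0 (cabs (a z) - cabs (b z)); nra.
rewrite ler_pdivrMr// ler_pdivrMr//; nra.
Qed.

Lemma shoot_den_neq0 z : 0 <= Im z -> D z != 0.
Proof.
move=> z0; have [c [c0 h]] := shoot_den_lb (cabs z).
by apply: contraTneq c0 => e; have := h z (lexx _) z0; rewrite e cabs0 -leNgt.
Qed.

Lemma shoot_cayley_le1 z : 0 <= Im z -> cabs (F z) <= 1.
Proof.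
move=> z0; have d0 := cabs_gt0 (shoot_den_neq0 z0).
rewrite cabsM cabsV ler_pdivrMr// mul1r.
rewrite -(ler_pXn2r (n := 2)) ?nnegrE ?cabs_ge0//.
rewrite cayley_den_sqr cayley_num_sqr shoot_energy.
have := mulr_ge0 z0 (shoot_E_ge0 z); lra.
Qed.

(** An exact difference formula, which serves as analyticity: on the diagonal it exhibits the
    derivative 2i S(w, w) / D(w)^2 of the Cayley transform. *)
Lemma shoot_diff z w : D z != 0 -> D w != 0 ->
  F z - F w = pt 0 2 * (z - w) * S z w / (D z * D w).
Proof.
move=> z0 w0.
rewrite -(mulrA (pt 0 2)) -shoot_wronskian.
have -> : pt 0 2 = 2 * pt 0 1 :> R[i] by apply: complex_ext; rewrite !ReImE/=; ring.
have : D z = b z - pt 0 1 * a z by [].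
have : D w = b w - pt 0 1 * a w by [].
have : N z = b z + pt 0 1 * a z by [].
have : N w = b w + pt 0 1 * a w by [].
move: z0 w0; set Dz := D z; set Dw := D w; set Nz := N z; set Nw := N w.
move=> z0 w0 eNw eNz eDw eDz.
apply: (mulIf z0); apply: (mulIf w0).
have -> : (Nz / Dz - Nw / Dw) * Dz * Dw = Nz * Dw - Nw * Dz by field; rewrite z0 w0.
have -> : 2 * pt 0 1 * (a z * b w - b z * a w) / (Dz * Dw) * Dz * Dw =
  2 * pt 0 1 * (a z * b w - b z * a w) by field; rewrite z0 w0.
rewrite eNw eNz eDw eDz; ring.
Qed.

Lemma cabs_pt0 (y : R) : cabs (pt 0 y) = `|y|.
Proof. by rewrite /cabs /= expr0n/= add0r sqrtr_sqr. Qed.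

Lemma shoot_estimates K : exists C : R, [/\ 0 < C,
  forall z w, cabs z <= K -> cabs w <= K -> cabs (S z w) <= C,
  forall z w y, cabs z <= K -> cabs w <= K -> cabs y <= K ->
     cabs (S z w - S y w) <= C * cabs (z - y),
  forall z w, cabs z <= K -> cabs w <= K -> cabs (D z - D w) <= C * cabs (z - w) &
  forall z, cabs z <= K -> 0 <= Im z -> cabs (D z)^-1 <= C].
Proof.
have [C1 [C10 hC1]] := csol_bound lq K (- L) 0.
have mL : - L <= - L <= 0 by rewrite lexx L0'.
have m0 : (- L <= 0 :> R) && (0 <= 0 :> R) by rewrite L0' lexx.
have [C2 [C20 hC2]] := csol_continuous_dep lq K (`|A| + `|B|) mL.
have [c [c0 hc]] := shoot_den_lb K.
pose n := `|A| + `|B|.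
have n0 : 0 <= n by rewrite addr_ge0.
have bt z (t : R) : cabs z <= K -> - L <= t <= 0 -> cabs ((th z).1 t) <= C1 * n.
  move=> zK tL; have [h1 e1 e2] := thP z.
  have := hC1 z _ _ (- L) t zK h1 mL tL; rewrite e1 e2 !cabs_cR => h.
  by have := cabs_ge0 ((th z).2 t); rewrite -/n in h; lra.
have dt z w (t : R) : cabs z <= K -> cabs w <= K -> - L <= t <= 0 ->
    cabs ((th z).1 t - (th w).1 t) + cabs ((th z).2 t - (th w).2 t) <= C2 * cabs (z - w).
  move=> zK wK tL; have [h1 e1 e2] := thP z; have [h3 e3 e4] := thP w.
  by apply: (hC2 _ _ _ _ _ _ zK wK h1 h3) => //; rewrite ?e1 ?e2 ?e3 ?e4 ?cabs_cR.
have n1 : 0 <= C1 * n by rewrite mulr_ge0.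
pose X1 := C1 * n * (C1 * n) * L.
pose X2 := C2 * (C1 * n) * L.
have X10 : 0 <= X1 by rewrite /X1 !mulr_ge0// ltW.
have X20 : 0 <= X2 by rewrite /X2 !mulr_ge0// ltW.
exists (X1 + X2 + C2 + c^-1 + 1).
have ci : 0 < c^-1 by rewrite invr_gt0.
have le_mono (x y s : R) : 0 <= s -> x <= y * s -> forall y0 : R, y <= y0 -> x <= y0 * s.
  by move=> s0 h y0 yy; apply: (le_trans h); apply: ler_wpM2r.
split; first by lra.
- move=> z w zK wK.
  have [u [pu ->]] := cint_cprim L0' (cctsM (th_ccts z) (th_ccts w)).
  have := cprim_cabs_le pu (primZ (C1 * n * (C1 * n)) (@prim_id R)) L0'.
  have -> : C1 * n * (C1 * n) * id 0 - C1 * n * (C1 * n) * id (- L) = X1 by rewrite /X1 /=; ring.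
  move=> /(_ _)/wrap[].
    move=> x xL; rewrite mulr1 cabsM; apply: ler_pM; rewrite ?cabs_ge0 ?bt//.
  by move=> h; apply: (le_trans h); lra.
- move=> z w y zK wK yK.
  have [u [pu ->]] := cint_cprim L0' (cctsM (th_ccts z) (th_ccts w)).
  have [v [pv ->]] := cint_cprim L0' (cctsM (th_ccts y) (th_ccts w)).
  have := cprim_cabs_le (cprimB pu pv) (primZ (C2 * cabs (z - y) * (C1 * n)) (@prim_id R)) L0'.
  have -> : C2 * cabs (z - y) * (C1 * n) * id 0 - C2 * cabs (z - y) * (C1 * n) * id (- L) =
    X2 * cabs (z - y) by rewrite /X2 /=; ring.
  have -> : u 0 - v 0 - (u (- L) - v (- L)) = u 0 - u (- L) - (v 0 - v (- L)) by ring.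
  move=> /(_ _)/wrap[].
    move=> x xL; rewrite mulr1 -mulrBl cabsM; apply: ler_pM; rewrite ?cabs_ge0 ?bt//.
    by have := dt z y x zK yK xL; have := cabs_ge0 ((th z).2 x - (th y).2 x); lra.
  by move=> h; apply: (le_mono _ _ _ (cabs_ge0 _) h); lra.
- move=> z w zK wK.
  have h := dt z w 0 zK wK m0.
  have h' : cabs (D z - D w) <= C2 * cabs (z - w).
    apply: le_trans h.
    have -> : D z - D w = (b z - b w) - pt 0 1 * (a z - a w) by rewrite /cayley_den; ring.
    apply: (le_trans (cabsB _ _)); rewrite cabsM cabs_pt0 normr1 mul1r; lra.
  by apply: (le_mono _ _ _ (cabs_ge0 _) h'); lra.
- move=> z zK z0; rewrite cabsV.
  have h := hc z zK z0.
  have h' : (cabs (D z))^-1 <= c^-1 by rewrite lef_pV2 ?posrE// (lt_le_trans c0).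
  by apply: (le_trans h'); lra.
Qed.

(** The two expansions required by [cauchy_rectangle_bound]. The constant depends on L, hence on n
    later, which is harmless as it does not enter the conclusion of that bound. *)
Lemma shoot_cayley_smooth K : exists C : R, 0 <= C /\ forall z w,
  cabs z <= K -> cabs w <= K -> 0 <= Im z -> 0 <= Im w ->
  [/\ cabs (F z - F w) <= C * cabs (z - w),
   cabs (pt 0 2 * S w w / (D w * D w)) <= C &
   cabs (F z - F w - pt 0 2 * S w w / (D w * D w) * (z - w)) <= C * cabs (z - w) ^+ 2].
Proof.
have [C [C0 hS hSd hD hDi]] := shoot_estimates K.
have C0' := ltW C0.
exists (2 * C * C * C + 2 * C * C * C * (1 + C * C)); split.
  by rewrite !(addr_ge0, mulr_ge0).
move=> z w zK wK z0 w0.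
have dz := shoot_den_neq0 z0; have dw := shoot_den_neq0 w0.
have Q1 : 0 <= 2 * C * C * C by rewrite !mulr_ge0.
have Q2 : 0 <= 2 * C * C * C * (1 + C * C) by rewrite !(addr_ge0, mulr_ge0).
have m2 (x y r s : R) : 0 <= x -> 0 <= y -> x <= r -> y <= s -> x * y <= r * s.
  by move=> *; apply: ler_pM.
have i z1 z2 z3 : cabs z1 <= C -> cabs z2 <= C -> cabs z3 <= C -> cabs (z1 * (z2 * z3)) <= C * C * C.
  move=> k1 k2 k3; rewrite !cabsM -mulrA.
  by apply: (@m2 _ _ _ _) => //; rewrite ?mulr_ge0 ?cabs_ge0//; apply: (@m2 _ _ _ _); rewrite ?cabs_ge0.
split.
- rewrite shoot_diff// invfM.
  rewrite (_ : pt 0 2 * (z - w) * S z w * ((D z)^-1 * (D w)^-1) =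
    (pt 0 2 * (S z w * ((D z)^-1 * (D w)^-1))) * (z - w)); last by ring.
  rewrite cabsM ler_wpM2r ?cabs_ge0// cabsM cabs_pt0 ger0_norm//.
  have := i _ _ _ (hS z w zK wK) (hDi z zK z0) (hDi w wK w0); lra.
- rewrite invfM -mulrA cabsM cabs_pt0 ger0_norm//.
  have := i _ _ _ (hS w w wK wK) (hDi w wK w0) (hDi w wK w0); lra.
rewrite shoot_diff//.
(* The remainder splits into the variation of S and that of D, each of order z - w, with a common
   factor z - w. *)
have -> : pt 0 2 * (z - w) * S z w / (D z * D w) - pt 0 2 * S w w / (D w * D w) * (z - w) =
   (pt 0 2 * (z - w)) * ((D z)^-1 * ((D w)^-1 * (S z w - S w w)) -
     (S w w * ((D z)^-1 * (D w)^-1)) * ((D w)^-1 * (D z - D w))).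
  by field; rewrite dz dw.
rewrite !cabsM cabs_pt0 ger0_norm// expr2.
have h1 := hSd z w w zK wK wK.
have h2 := hD z w zK wK.
have h3 := i _ _ _ (hS w w wK wK) (hDi z zK z0) (hDi w wK w0).
have h4 := hDi z zK z0; have h5 := hDi w wK w0.
have c0 := cabs_ge0 (z - w).
have g1 : cabs ((D z)^-1 * ((D w)^-1 * (S z w - S w w))) <= C * (C * (C * cabs (z - w))).
  rewrite !cabsM.
  by apply: (@m2 _ _ _ _) => //; rewrite ?mulr_ge0 ?cabs_ge0//; apply: (@m2 _ _ _ _); rewrite ?cabs_ge0.
have g2 : cabs ((S w w * ((D z)^-1 * (D w)^-1)) * ((D w)^-1 * (D z - D w))) <=
   (C * C * C) * (C * (C * cabs (z - w))).
  rewrite cabsM; apply: (@m2 _ _ _ _); rewrite ?mulr_ge0 ?cabs_ge0//.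
  by rewrite cabsM; apply: (@m2 _ _ _ _); rewrite ?mulr_ge0 ?cabs_ge0//.
have g3 := cabsB ((D z)^-1 * ((D w)^-1 * (S z w - S w w)))
  ((S w w * ((D z)^-1 * (D w)^-1)) * ((D w)^-1 * (D z - D w))).
set T := cabs (_ - S w w * _ * _) in g3 *.
have HT : 2 * T <= (2 * C * C * C + 2 * C * C * C * (1 + C * C)) * cabs (z - w).
  apply: (@le_trans _ _ (2 * (C * (C * (C * cabs (z - w))) + (C * C * C) * (C * (C * cabs (z - w)))))).
    by apply: ler_wpM2l => //; lra.
  have := mulr_ge0 Q1 c0; lra.
have := ler_wpM2r c0 HT; lra.
Qed.

End Shooting.

(** * Integrals on half-lines *)

Section HalfLine.
Variable R : realType.
Local Notation leb := (@lebesgue_measure R).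
Implicit Types (f g h : R -> R) (a b x y : R) (D : set R).

Lemma EFin_Rintegral D f : measurable D -> leb.-integrable D (EFin \o f) ->
  (\int[leb]_(x in D) (f x)%:E = (Rintegral leb D f)%:E)%E.
Proof.
move=> mD fD; rewrite /Rintegral fineK.
  by [].
exact: (@integrable_fin_num _ _ _ leb D mD _ fD).
Qed.

(** The integral over D minus F n is bounded by that of |f|, to which monotone convergence
    applies. *)
Lemma Rintegral_exhaustion (F : nat -> set R) D f : (forall n, measurable (F n)) -> measurable D ->
  nondecreasing_seq F -> \bigcup_i F i = D -> leb.-integrable D (EFin \o f) ->
  forall e : R, 0 < e -> exists n0, forall n, (n0 <= n)%N ->
    `|Rintegral leb D f - Rintegral leb (F n) f| <= e.
Proof.
move=> mF mD nF FD fD e e0.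
have FsD n : F n `<=` D by rewrite -FD; exact: bigcup_sup.
have iF n g : leb.-integrable D (EFin \o g) -> leb.-integrable (F n) (EFin \o g).
  by move=> h; exact: (@integrableS _ _ _ leb D (F n) (EFin \o g) mD (mF n) (FsD n) h).
have mDF n : measurable (D `\` F n) by exact: measurableD.
have iDF n g : leb.-integrable D (EFin \o g) -> leb.-integrable (D `\` F n) (EFin \o g).
  move=> h; apply: (@integrableS _ _ _ leb D (D `\` F n) (EFin \o g) mD (mDF n) _ h).
  by move=> x [].
have split n g : leb.-integrable D (EFin \o g) ->
    Rintegral leb D g - Rintegral leb (F n) g = Rintegral leb (D `\` F n) g.
  move=> gD; have {1}<- : F n `|` (D `\` F n) = D by exact: setDUK.
  rewrite Rintegral_setU//; first by rewrite addrC addKr.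
  - exact: mF.
  - exact: mDF.
  - by rewrite setDUK.
  - by rewrite disj_set2E setDIK.
have nD : leb.-integrable D (EFin \o (fun x => `|f x|)) by exact: integrable_norm.
have cv := @ge0_nondecreasing_set_cvg_integral _ (measurableTypeR R) R F (fun x => (`|f x|)%:E) leb nF mF.
have {}cv := cv (fun n => measurable_int _ (iF n _ nD)) (fun n x _ => normr_ge0 (f x)).
rewrite FD in cv.
have fin n : (\int[leb]_(x in F n) (`|f x|)%:E = (Rintegral leb (F n) (fun x => `|f x|))%:E)%E.
  exact: (EFin_Rintegral (f := fun x => `|f x|) (mF n) (iF n _ nD)).
have finD : (\int[leb]_(x in D) (`|f x|)%:E = (Rintegral leb D (fun x => `|f x|))%:E)%E.
  exact: (EFin_Rintegral (f := fun x => `|f x|) mD nD).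
have {cv} := cv; rewrite finD => /fine_cvg cv.
have {}cv : Rintegral leb (F n) (fun x => `|f x|) @[n --> \oo] --> Rintegral leb D (fun x => `|f x|).
  exact: cv.
have [n0 _ hn] := (cvgrPdist_le _ _).1 cv e e0.
exists n0 => n /hn h; rewrite split//.
apply: (le_trans (le_normr_Rintegral _ (iDF n _ fD))); first exact: mDF.
by rewrite -(split n (fun x => `|f x|))//; apply: le_trans h; exact: ler_norm.
Qed.

Lemma bigcup_ray a : \bigcup_i `[a - i%:R, a]%classic = `]-oo, a]%classic :> set R.
Proof.
apply/seteqP; split=> x /=.
  by move=> [n _] /=; rewrite !in_itv/= => /andP[].
rewrite in_itv/= => xa; exists (Num.bound (a - x)) => //=.
rewrite in_itv/= xa andbT.
by have := archi_boundP (x := a - x); rewrite subr_ge0 => /(_ xa); lra.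
Qed.

Lemma bigcup_line : \bigcup_i `[- (i%:R), i%:R]%classic = setT :> set R.
Proof.
apply/seteqP; split=> x //= _; exists (Num.bound `|x|) => //=.
rewrite in_itv/= -ler_norml; apply: ltW; exact: archi_boundP.
Qed.

Lemma nondecreasing_ray a : nondecreasing_seq (fun i : nat => `[a - i%:R, a]%classic : set R).
Proof.
move=> n m nm; rewrite subsetEset => x /=; rewrite !in_itv/= => /andP[h ->]; rewrite andbT.
have : (n%:R : R) <= m%:R by rewrite ler_nat.
lra.
Qed.

Lemma nondecreasing_line : nondecreasing_seq (fun i : nat => `[- (i%:R), i%:R]%classic : set R).
Proof.
move=> n m nm; rewrite subsetEset => x /=; rewrite !in_itv/= => /andP[h1 h2].
have : (n%:R : R) <= m%:R by rewrite ler_nat.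
by move=> h; apply/andP; split; lra.
Qed.

Lemma integrable_exhaustion (F : nat -> set R) D h (C : R) : (forall n, measurable (F n)) ->
  measurable D -> nondecreasing_seq F -> \bigcup_i F i = D -> continuous h ->
  (forall x, 0 <= h x) -> (forall n, leb.-integrable (F n) (EFin \o h)) ->
  (forall n, Rintegral leb (F n) h <= C) -> leb.-integrable D (EFin \o h).
Proof.
move=> mF mD nF FD ch h0 iF hC.
apply/integrableP; split.
  apply/measurable_realfun.measurable_EFinP; apply: (measurable_funS measurableT) => //.
  exact: measurable_realfun.continuous_measurable_fun.
have -> : (\int[leb]_(x in D) `|(EFin \o h) x| = \int[leb]_(x in D) (h x)%:E)%E.
  by apply: eq_integral => x _ /=; rewrite ger0_norm.
apply: (@le_lt_trans _ _ C%:E); last exact: ltry.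
have cv := @ge0_nondecreasing_set_cvg_integral _ (measurableTypeR R) R F (fun x => (h x)%:E) leb nF mF.
have {}cv := cv (fun n => measurable_int _ (iF n)) (fun n x _ => h0 x).
rewrite FD in cv.
rewrite -(cvg_lim _ cv)//.
apply: lime_le; first by apply/cvg_ex; eexists; exact: cv.
apply: nearW => n.
have -> : (\int[leb]_(x in F n) (h x)%:E = (Rintegral leb (F n) h)%:E)%E.
  exact: (EFin_Rintegral (mF n) (iF n)).
by rewrite lee_fin.
Qed.

Lemma integrable_ray h a (C : R) : continuous h -> (forall x, 0 <= h x) ->
  (forall x, x <= a -> Rintegral leb `[x, a] h <= C) ->
  leb.-integrable `]-oo, a] (EFin \o h).
Proof.
move=> ch h0 hC.
apply: (@integrable_exhaustion (fun i => `[a - i%:R, a]%classic) _ _ C) => //.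
- exact: nondecreasing_ray.
- exact: bigcup_ray.
- by move=> n; exact: cts_loc_int.
- by move=> n; apply: hC; have := ler0n R n; lra.
Qed.

Lemma integrable_line h (C : R) : continuous h -> (forall x, 0 <= h x) ->
  (forall n : nat, Rintegral leb `[- n%:R, n%:R] h <= C) -> leb.-integrable setT (EFin \o h).
Proof.
move=> ch h0 hC.
apply: (@integrable_exhaustion (fun i => `[- i%:R, i%:R]%classic) _ _ C) => //.
- exact: nondecreasing_line.
- exact: bigcup_line.
- by move=> n; exact: cts_loc_int.
Qed.

Lemma Rintegral_line0 f : leb.-integrable setT (EFin \o f) ->
  (forall e : R, 0 < e -> exists n0, forall n, (n0 <= n)%N ->
     `|Rintegral leb `[- n%:R, n%:R] f| <= e) ->
  Rintegral leb setT f = 0.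
Proof.
move=> fT hf; apply/eqP; rewrite -normr_le0; apply/ler_addgt0Pr => e e0; rewrite add0r.
have e2 : 0 < e / 2 by rewrite divr_gt0.
have [n1 h1] := hf _ e2.
have [n2 h2] := @Rintegral_exhaustion (fun i : nat => `[- i%:R, i%:R]%classic) setT f
   (fun=> measurable_itv _) measurableT nondecreasing_line bigcup_line fT _ e2.
have k1 := h1 (maxn n1 n2) (leq_maxl _ _).
have k2 := h2 (maxn n1 n2) (leq_maxr _ _).
have -> : Rintegral leb setT f = (Rintegral leb setT f - Rintegral leb `[- (maxn n1 n2)%:R, (maxn n1 n2)%:R] f)
  + Rintegral leb `[- (maxn n1 n2)%:R, (maxn n1 n2)%:R] f by ring.
apply: (le_trans (ler_normD _ _)); lra.
Qed.

Lemma Rintegral_ge0_subset D D' h : measurable D -> measurable D' -> D `<=` D' ->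
  (forall x, 0 <= h x) -> leb.-integrable D' (EFin \o h) ->
  Rintegral leb D h <= Rintegral leb D' h.
Proof.
move=> mD mD' DD' h0 iD'.
have iD : leb.-integrable D (EFin \o h) by exact: integrableS iD'.
rewrite /Rintegral fine_le//; try exact: integrable_fin_num.
apply: ge0_subset_integral => //; first exact: measurable_int iD'.
by move=> x _; rewrite lee_fin.
Qed.

Lemma integrable_square_prod D f g : measurable D -> continuous f -> continuous g ->
  leb.-integrable D (EFin \o (fun x => f x ^+ 2)) ->
  leb.-integrable D (EFin \o (fun x => g x ^+ 2)) ->
  leb.-integrable D (EFin \o (fun x => f x * g x)).
Proof.
move=> mD cf cg if2 ig2.
have i2 := @integrableD _ _ _ leb D mD _ _ if2 ig2.
apply: (@le_integrable _ _ _ leb D mD _ _ _ _ i2).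
  apply/measurable_realfun.measurable_EFinP; apply: (measurable_funS measurableT) => //.
  apply: measurable_realfun.continuous_measurable_fun => x.
  by apply: cvgM; [exact: cf|exact: cg].
move=> x _ /=; rewrite lee_fin [leRHS]ger0_norm ?addr_ge0 ?sqr_ge0// ler_norml.
have := sqr_ge0 (f x - g x); have := sqr_ge0 (f x + g x).
have := sqr_ge0 (f x); have := sqr_ge0 (g x).
by move=> *; apply/andP; split; lra.
Qed.

Lemma ray_chasles f a b : leb.-integrable `]-oo, b] (EFin \o f) -> a <= b ->
  Rintegral leb `]-oo, b] f - Rintegral leb `]-oo, a] f = Rintegral leb `[a, b] f.
Proof.
move=> fb ab.
rewrite Rintegral_itvB// ?bnd_simp//.
rewrite Rintegral_itv_obnd_cbnd//.
by apply: (integrableS _ _ _ fb) => // x /=; rewrite !in_itv/= => /andP[].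
Qed.

Lemma prim_ray f : continuous f -> (forall a, leb.-integrable `]-oo, a] (EFin \o f)) ->
  prim (fun x => Rintegral leb `]-oo, x] f) f.
Proof.
move=> cf fi; split; first exact: cts_loc_int.
by move=> a b ab; rewrite ray_chasles.
Qed.

Lemma Rintegral_ray_decay f a : leb.-integrable `]-oo, a] (EFin \o f) ->
  forall e : R, 0 < e -> exists X : R, X <= a /\ forall x, x <= X ->
    `|Rintegral leb `]-oo, x] f| <= e.
Proof.
move=> fa e e0.
have na : leb.-integrable `]-oo, a] (EFin \o (fun x => `|f x|)) by exact: integrable_norm.
have [n h] := @Rintegral_exhaustion (fun i : nat => `[a - i%:R, a]%classic) `]-oo, a]%classic _
   (fun=> measurable_itv _) (measurable_itv _) (nondecreasing_ray a) (bigcup_ray a) na _ e0.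
have n0 := ler0n R n.
exists (a - n%:R); split; first lra.
move=> x xX.
have xa : x <= a by lra.
have ix : leb.-integrable `]-oo, x] (EFin \o f).
  by apply: (integrableS _ _ _ fa) => // t /=; rewrite !in_itv/= => /le_trans; apply.
have h1 := h n (leqnn _).
rewrite -(@ray_chasles (fun x => `|f x|) (a - n%:R) a na) in h1; last lra.
apply: (le_trans (le_normr_Rintegral _ ix)) => //.
apply: (@le_trans _ _ (Rintegral leb `]-oo, (a - n%:R)] (fun x => `|f x|))).
  apply: Rintegral_ge0_subset => //.
    by move=> t /=; rewrite !in_itv/= => /le_trans; apply.
  by apply: (integrableS _ _ _ na) => // t /=; rewrite !in_itv/= => /le_trans; apply; lra.
move: h1; rewrite opprB addrCA subrr addr0; apply: le_trans; exact: ler_norm.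
Qed.

(** The integral of (s f - g)^2 is a nonnegative quadratic polynomial in s, evaluated at its
    minimum. *)
Lemma cauchy_schwarz_prim f g (U T W : R -> R) a b : a <= b -> continuous f -> continuous g ->
  prim U (fun x => f x ^+ 2) -> prim T (fun x => g x ^+ 2) -> prim W (fun x => f x * g x) ->
  (W b - W a) ^+ 2 <= (U b - U a) * (T b - T a).
Proof.
move=> ab cf cg pU pT pW.
have Q s : 0 <= s ^+ 2 * (U b - U a) - 2 * s * (W b - W a) + (T b - T a).
  have p := primD (primB (primZ (s ^+ 2) pU) (primZ (2 * s) pW)) pT.
  have := prim_le p ab; rewrite -subr_ge0.
  have H x : a <= x <= b -> 0 <= s ^+ 2 * f x ^+ 2 - 2 * s * (f x * g x) + g x ^+ 2.
    by move=> _; have := sqr_ge0 (s * f x - g x); lra.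
  move=> /(_ H); lra.
have U0 : 0 <= U b - U a.
  by rewrite subr_ge0; apply: (prim_le pU ab) => x _; exact: sqr_ge0.
set u := U b - U a in Q U0 *; set w := W b - W a in Q *; set t := T b - T a in Q *.
have [u0|u0] := eqVneq u 0.
  rewrite u0 mul0r in Q *.
  have [->|w0] := eqVneq w 0; first by rewrite expr0n.
  (* With u = 0 the polynomial is affine in s, and this s gives it the value -1. *)
  have := Q ((t + 1) / (2 * w)).
  rewrite mulr0 sub0r.
  have -> : 2 * ((t + 1) / (2 * w)) * w = t + 1 by field.
  lra.
have up : 0 < u by rewrite lt_neqAle eq_sym u0.
have := Q (w / u).
have -> : (w / u) ^+ 2 * u - 2 * (w / u) * w + t = (u * t - w ^+ 2) / u by field.
by rewrite pmulr_lge0 ?invr_gt0// subr_ge0.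
Qed.

End HalfLine.

(** * Approximation of the Weyl solution *)

Section WeylApproximation.
Variable R : realType.
Variable q : R -> R.
Hypothesis lq : loc_int q.
Implicit Types (z w lam M : R[i]).
Local Notation Re := complex.Re.
Local Notation Im := complex.Im.
Local Notation leb := (@lebesgue_measure R).

Variables (la : R) (ur dur : R -> R).
Hypothesis pur : prim ur dur.
Hypothesis pdur : prim dur (fun t => (q t - la) * ur t).
Hypothesis L2u : L2left ur.
Hypothesis ur_nz : forall x, (ur x != 0) || (dur x != 0).

Variables th : nat -> R[i] -> (R -> R[i]) * (R -> R[i]).
Hypothesis thP : forall n z, [/\ csol q z (th n z).1 (th n z).2,
   (th n z).1 (- n.+1%:R) = cR (ur (- n.+1%:R)) & (th n z).2 (- n.+1%:R) = cR (dur (- n.+1%:R))].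

Definition cay (u v : R[i]) := cayley_num u v / cayley_den u v.

Local Notation a n z := ((th n z).1 0).
Local Notation b n z := ((th n z).2 0).
Local Notation F n z := (cay (a n z) (b n z)).
Local Notation D n z := (cayley_den (a n z) (b n z)).
Local Notation a0 := (cR (ur 0)).
Local Notation b0 := (cR (dur 0)).

Let n0 (n : nat) : 0 < n.+1%:R :> R. Proof. by []. Qed.

Lemma real_csol : csol q (cR la) (fun x => cR (ur x)) (fun x => cR (dur x)).
Proof.
apply/csolE; split; first exact: cprim_cR.
apply: cprim_ext (cprim_cR pdur) _ _ => x //.
by apply: complex_ext; rewrite !ReImE /=; ring.
Qed.

Lemma cayley_den_real_neq0 (x y : R) : (x != 0) || (y != 0) -> cayley_den (cR x) (cR y) != 0.
Proof.
move=> h; apply/eqP => e.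
have := congr1 (@complex.Re R) e; have := congr1 (@complex.Im R) e.
rewrite /cayley_den !ReImE /= => h1 h2.
by case/orP: h => /eqP h; apply: h; lra.
Qed.

Lemma cay_sub (u v x y : R[i]) : cayley_den u v != 0 -> cayley_den x y != 0 ->
  cay u v - cay x y = pt 0 2 * (u * y - v * x) / (cayley_den u v * cayley_den x y).
Proof.
move=> h1 h2; rewrite /cay.
have e1 : cayley_num u v = cayley_den u v + pt 0 2 * u.
  by apply: complex_ext; rewrite /cayley_num /cayley_den !ReImE /=; ring.
have e2 : cayley_num x y = cayley_den x y + pt 0 2 * x.
  by apply: complex_ext; rewrite /cayley_num /cayley_den !ReImE /=; ring.
have e3 : pt 0 2 * (u * y - v * x) =
    cayley_num u v * cayley_den x y - cayley_num x y * cayley_den u v.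
  by apply: complex_ext; rewrite /cayley_num /cayley_den !ReImE /=; ring.
by rewrite e3; field; rewrite h1 h2.
Qed.

(** The Wronskian of [ur] and theta_n vanishes at -n-1, so at 0 it is at most |la - z| times the
    integral of |ur theta_n|. By Cauchy-Schwarz this is controlled by the norm of [ur] on the
    half-line, which does not depend on n, and by the energy of theta_n, at most |D|^2 / (2 Im
    z). *)
Lemma resonance_estimate : exists C : R, 0 <= C /\ forall n z, 0 < Im z ->
  cabs (F n z - cay a0 b0) ^+ 2 * Im z <= C * cabs (cR la - z) ^+ 2.
Proof.
have cur := prim_cts pur.
pose U0 := Rintegral leb `]-oo, 0] (fun t => ur t ^+ 2).
have d0 := cayley_den_real_neq0 (ur_nz 0).
have d0p := cabs_gt0 d0.
exists (2 * U0 / cabs (cayley_den a0 b0) ^+ 2); split.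
  apply: divr_ge0; last exact: sqr_ge0.
  by apply: mulr_ge0 => //; apply: Rintegral_ge0 => x _; exact: sqr_ge0.
move=> n z z0.
have L0 : - n.+1%:R <= 0 :> R by rewrite oppr_le0 ltW.
have z0' := ltW z0.
have dz := shoot_den_neq0 lq (n0 n) (thP n) (ur_nz _) z0'.
have [h1 e1 e2] := thP n z.
have pW := wronskian_cprim real_csol h1.
have cth := ccts_cabs (th_ccts (thP n) z).
have cN : continuous (fun x => `|ur x|) by move=> x; apply: cvg_norm; exact: cur.
have cur2 : continuous (fun x => ur x ^+ 2).
  have c : continuous (fun x => ur x * ur x) by move=> x; apply: cvgM; exact: cur.
  by move: c; congr (continuous _); apply/funext => x; rewrite expr2.
have cth2 : continuous (fun x => cabs ((th n z).1 x) ^+ 2).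
  have c : continuous (fun x => cabs ((th n z).1 x) * cabs ((th n z).1 x)).
    by move=> x; apply: cvgM; exact: cth.
  by move: c; congr (continuous _); apply/funext => x; rewrite expr2.
have cw : continuous (fun x => `|ur x| * cabs ((th n z).1 x)).
  by move=> x; apply: cvgM; [exact: cN|exact: cth].
have [U [pU _]] := ex_prim 0 (cts_loc_int cur2).
have [T [pT _]] := ex_prim 0 (cts_loc_int cth2).
have [W [pW2 _]] := ex_prim 0 (cts_loc_int cw).
have pU' : prim U (fun x => `|ur x| ^+ 2).
  by apply: prim_ext pU _ _ => x //; rewrite real_normK ?num_real.
have cs := cauchy_schwarz_prim L0 cN cth pU' pT pW2.
have hW : cabs (a0 * b n z - b0 * a n z) <= cabs (cR la - z) * (W 0 - W (- n.+1%:R)).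
  have := cprim_cabs_le pW (primZ (cabs (cR la - z)) pW2) L0.
  rewrite e1 e2 (mulrC (cR (dur (- n.+1%:R)))) subrr subr0 mulrBr; apply => x _.
  by rewrite cabsM cabsM cabs_cR.
have hU : U 0 - U (- n.+1%:R) <= U0.
  have L2u0 : leb.-integrable `]-oo, 0] (EFin \o (fun t => ur t ^+ 2)) by exact: L2u.
  rewrite (pU.2 _ _ L0); apply: (Rintegral_ge0_subset _ _ _ _ L2u0) => //.
  - by move=> x /=; rewrite !in_itv/= => /andP[].
  - by move=> x; exact: sqr_ge0.
have hU0 : 0 <= U 0 - U (- n.+1%:R).
  by rewrite subr_ge0; apply: (prim_le pU L0) => x _; exact: sqr_ge0.
have hT : 2 * Im z * (T 0 - T (- n.+1%:R)) <= cabs (D n z) ^+ 2.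
  have := shoot_den_ge_energy (n0 n) (thP n) z0'.
  rewrite (pT.2 _ _ L0); congr (_ * _ <= _); apply: eq_Rintegral => x _.
  by rewrite cabs_sqr.
have hT0 : 0 <= T 0 - T (- n.+1%:R).
  by rewrite subr_ge0; apply: (prim_le pT L0) => x _; exact: sqr_ge0.
rewrite cay_sub// cabsM cabsV !cabsM cabs_pt0 ger0_norm//.
have dzp := cabs_gt0 dz.
set w := cabs (a n z * b0 - b n z * a0).
have ew : w = cabs (a0 * b n z - b0 * a n z).
  by rewrite /w -cabsN; congr cabs; ring.
have hw : w ^+ 2 <= cabs (cR la - z) ^+ 2 * (U0 * (T 0 - T (- n.+1%:R))).
  rewrite ew; apply: (@le_trans _ _ ((cabs (cR la - z) * (W 0 - W (- n.+1%:R))) ^+ 2)).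
    by apply: lerXn2r; rewrite ?nnegrE ?cabs_ge0// (le_trans _ hW)// cabs_ge0.
  rewrite exprMn; apply: ler_wpM2l; first exact: sqr_ge0.
  by apply: (le_trans cs); apply: ler_wpM2r.
set d1 := cabs (D n z) in hT dzp *; set d2 := cabs (cayley_den a0 b0) in d0p *.
have U00 : 0 <= U0 by exact: le_trans hU0 hU.
set r := cabs (cR la - z) in hw *.
set t := T 0 - _ in hT hw hT0.
have -> : (2 * w / (d1 * d2)) ^+ 2 * Im z = 4 * Im z * w ^+ 2 / (d1 ^+ 2 * d2 ^+ 2).
  by field; rewrite !gt_eqF.
have -> : 2 * U0 / d2 ^+ 2 * r ^+ 2 = (2 * U0 * r ^+ 2 * d1 ^+ 2) / (d1 ^+ 2 * d2 ^+ 2).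
  by field; rewrite !gt_eqF.
rewrite ler_pM2r ?invr_gt0 ?mulr_gt0 ?exprn_gt0//.
have k1 : 4 * Im z * w ^+ 2 <= 4 * Im z * (r ^+ 2 * (U0 * t)).
  by apply: ler_wpM2l => //; lra.
apply: (le_trans k1).
have -> : 4 * Im z * (r ^+ 2 * (U0 * t)) = 2 * U0 * r ^+ 2 * (2 * Im z * t) by ring.
apply: ler_wpM2l => //; apply: mulr_ge0; last exact: sqr_ge0.
by apply: mulr_ge0.
Qed.

(** A solution scaled to Cayley denominator 1 has data at 0 affine in its Cayley transform, so
    convergence of the transforms is convergence of the scaled solutions. *)
Lemma cay_normalized (u v : R[i]) : cayley_den u v != 0 ->
  let Phi := cay u v in
  u / cayley_den u v = (Phi - 1) / pt 0 2 /\ v / cayley_den u v = (Phi + 1) / 2.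
Proof.
move=> d0 /=.
have e : v = cayley_den u v + pt 0 1 * u by rewrite /cayley_den; ring.
have e2 : cayley_num u v = cayley_den u v + pt 0 2 * u.
  by apply: complex_ext; rewrite /cayley_num /cayley_den !ReImE /=; ring.
have i2 : pt 0 2 != 0 :> R[i] by rewrite eq_complex /= negb_and orbC pnatr_eq0.
have e3 : pt 0 2 = 2 * pt 0 1 :> R[i] by apply: complex_ext; rewrite !ReImE/=; ring.
rewrite /cay e2; split; first by field; rewrite i2 d0.
by rewrite {1}e e3; field; rewrite d0.
Qed.

Lemma csol_comb lam (c d : R[i]) u du v dv : csol q lam u du -> csol q lam v dv ->
  csol q lam (fun x => c * u x + d * v x) (fun x => c * du x + d * dv x).
Proof. by move=> h1 h2; apply: csolD; exact: csolZ. Qed.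

(** Real and imaginary parts need one common subsequence. It is taken inside P, so that a cluster
    point can be forced away from a candidate limit. *)
Lemma subseq_limit (x y : nat -> R) (P : nat -> Prop) (B : R) :
  (forall n, `|x n| <= B) -> (forall n, `|y n| <= B) ->
  (forall m, exists n, (m <= n)%N /\ P n) ->
  exists l1 l2 : R, forall e : R, 0 < e -> forall m, exists n,
    [/\ (m <= n)%N, P n, `|x n - l1| < e & `|y n - l2| < e].
Proof.
move=> xB yB /choice [f hf].
have bnd (s : nat -> R) : (forall n, `|s n| <= B) -> bounded_fun s.
  move=> h; exists B; split; first exact: num_real.
  by move=> t Bt n _; apply: le_trans (h n) (ltW Bt).
have [g mg cg] := bolzano_weierstrass (bnd (x \o f) (fun n => xB _)).
have [h mh ch] := bolzano_weierstrass (bnd (y \o f \o g) (fun n => yB _)).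
have ge (k : nat -> nat) : {mono k : n m / (n <= m)%N} -> forall n, (n <= k n)%N.
  move=> mk; elim=> // n ih; apply: (leq_ltn_trans ih).
  by rewrite ltnNge mk -ltnNge.
exists (limn ((x \o f) \o g)), (limn ((y \o f \o g) \o h)) => e e0 m.
have [n1 _ k1] := (cvgrPdist_lt _ _).1 cg e e0.
have [n2 _ k2] := (cvgrPdist_lt _ _).1 ch e e0.
pose N := maxn m (maxn n1 n2).
exists (f (g (h N))).
have Nh : (N <= h N)%N by exact: ge.
have hg : (h N <= g (h N))%N by exact: ge.
split.
- by apply: (leq_trans _ (hf _).1); rewrite (leq_trans _ hg)// (leq_trans _ Nh)// leq_maxl.
- exact: (hf _).2.
- rewrite distrC; apply: (k1 (h N)) => /=; rewrite (leq_trans _ Nh)// /N.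
  by rewrite leq_max leq_max leqnn orbT.
- rewrite distrC; apply: (k2 N) => /=; rewrite /N.
  by rewrite leq_max leq_max leqnn !orbT.
Qed.

Lemma cL2left_bound (u : R -> R[i]) (C : R) : ccts u ->
  (forall A : R, A <= 0 -> Rintegral leb `[A, 0] (fun t => cabs (u t) ^+ 2) <= C) -> cL2left u.
Proof.
move=> cu hC a.
have cc := ccts_cabs cu.
have c2 : continuous (fun t => cabs (u t) ^+ 2).
  have c : continuous (fun x => cabs (u x) * cabs (u x)) by move=> x; apply: cvgM; exact: cc.
  by move: c; congr (continuous _); apply/funext => x; rewrite expr2.
have -> : (fun t => (Re (u t) ^+ 2 + Im (u t) ^+ 2)%:E) = EFin \o (fun t => cabs (u t) ^+ 2).
  by apply/funext => t /=; rewrite cabs_sqr.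
have [V [pV _]] := ex_prim 0 (cts_loc_int c2).
apply: (@integrable_ray _ _ _ (C + `|V a - V 0|)) => // [x|x xa]; first exact: sqr_ge0.
rewrite -(pV.2 _ _ xa).
have V0 s t : s <= t -> V s <= V t by move=> st; apply: (prim_le pV st) => r _; exact: sqr_ge0.
have [x0|x0] := leP x 0.
  have := hC x x0; rewrite -(pV.2 _ _ x0); have := ler_norm (V a - V 0); lra.
have C0 := hC 0 (lexx _); rewrite Rintegral_point in C0.
have := V0 0 x (ltW x0); have := ler_norm (V a - V 0); lra.
Qed.

Lemma sqr_le_double (X Y Z e : R) : 0 <= X -> 0 <= Y -> 0 <= Z -> Z <= e -> X <= Y + Z ->
  X ^+ 2 <= 2 * Y ^+ 2 + 2 * e ^+ 2.
Proof.
move=> X0 Y0 Z0 Ze XY.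
have : X ^+ 2 <= (Y + e) ^+ 2 by apply: lerXn2r; rewrite ?nnegrE; lra.
have := sqr_ge0 (Y - e); lra.
Qed.

Lemma cayley_inverse (Phi : R[i]) : Phi != 1 ->
  let M := ((Phi + 1) / 2) / ((Phi - 1) / pt 0 2) in
  cay 1 M = Phi /\ (cabs Phi <= 1 -> Im M <= 0).
Proof.
move=> PhiN1 M.
have two : (2 : R[i]) != 0 by rewrite pnatr_eq0.
have i2 : pt 0 2 != 0 :> R[i] by rewrite eq_complex /= negb_and orbC pnatr_eq0.
have p0 : (Phi - 1) / pt 0 2 != 0 by rewrite mulf_neq0 ?subr_eq0 ?invr_neq0.
have n1 : Phi - 1 != 0 by rewrite subr_eq0.
have e2 : pt 0 2 = 2 * pt 0 1 :> R[i] by apply: complex_ext; rewrite !ReImE/=; ring.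
have j0 : pt 0 1 != 0 :> R[i] by rewrite eq_complex /= negb_and orbC oner_eq0.
have d0 : cayley_den ((Phi - 1) / pt 0 2) ((Phi + 1) / 2) = 1.
  by rewrite /cayley_den e2; field.
have N0 : cayley_num ((Phi - 1) / pt 0 2) ((Phi + 1) / 2) = Phi.
  by rewrite /cayley_num e2; field.
have eb : (Phi + 1) / 2 = M * ((Phi - 1) / pt 0 2) by rewrite /M divfK.
split.
  rewrite /cay; set u := (Phi - 1) / pt 0 2 in p0 d0 N0 eb *.
  have : cayley_den 1 M * u = 1 by rewrite -[RHS]d0 /cayley_den eb; ring.
  have : cayley_num 1 M * u = Phi by rewrite -[RHS]N0 /cayley_num eb; ring.
  move=> <- du; have nd : cayley_den 1 M != 0.
    by apply: contra_eq_neq du => ->; rewrite mul0r eq_sym oner_eq0.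
  by apply: (mulIf nd); rewrite divfK// -mulrA (mulrC u) du mulr1.
move=> Phi1.
have := cayley_den_sqr ((Phi - 1) / pt 0 2) ((Phi + 1) / 2).
have := cayley_num_sqr ((Phi - 1) / pt 0 2) ((Phi + 1) / 2).
rewrite d0 N0 (_ : cabs (1 : R[i]) = 1); last by rewrite /cabs /= expr0n/= addr0 expr1n sqrtr1.
rewrite expr1n => k1 k2.
have k3 : cabs Phi ^+ 2 <= 1 by rewrite exprn_ile1 ?cabs_ge0.
have k4 : Im (((Phi - 1) / pt 0 2)^*%C * ((Phi + 1) / 2)) <= 0 by lra.
have pp := cabs_gt0 p0.
have : Im M * cabs ((Phi - 1) / pt 0 2) ^+ 2 =
   Im (((Phi - 1) / pt 0 2)^*%C * ((Phi + 1) / 2)).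
  have gen (m u : R[i]) : Im m * cabs u ^+ 2 = Im (u^*%C * (m * u)).
    by rewrite cabs_sqr !cImM !cReM !cReJ !cImJ; ring.
  by rewrite eb; exact: gen.
by move=> k5; rewrite -(pmulr_lle0 _ (exprn_gt0 2 pp)) k5.
Qed.

(** Re s' exceeds 1/2 on some [-d', 0], so |s|^2 is at least d'^2 / 16 on [-d', -d'/2], of length
    d'/2. The bound serves to exclude the solution vanishing at 0 as a limit of the scaled shooting
    solutions. *)
Lemma energy_lower_bound lam (s ds : R -> R[i]) : csol q lam s ds -> s 0 = 0 -> ds 0 = 1 ->
  exists2 k : R, 0 < k & k <= Rintegral leb `[- 1, 0] (fun t => cabs (s t) ^+ 2).
Proof.
move=> hs s1 s2.
have /csolE[[ps ps'] pds] := hs.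
have [cds _] := cprim_ccts pds.
have csq : continuous (fun x => cabs (s x) ^+ 2).
  have cc : continuous (fun x => cabs (s x)) by apply: ccts_cabs; exact: (cprim_ccts (conj ps ps')).
  have cx : continuous (fun x => cabs (s x) * cabs (s x)) by move=> x; apply: cvgM; exact: cc.
  by move: cx; congr (continuous _); apply/funext => x; rewrite expr2.
have [d d0 hd] := (cts_epsP _ _).1 (cds 0) (1/2) ltac:(lra).
pose d' := Num.min (d / 2) 1.
have d'0 : 0 < d' by rewrite lt_min ltr01 andbT divr_gt0.
have d'1 : d' <= 1 by rewrite ge_min lexx orbT.
have d'd : d' <= d / 2 by rewrite ge_min lexx.
have low x : - d' <= x <= 0 -> Re (s x) <= x / 2.
  move=> /andP[dx x0].
  have := prim_le2 (primZ (1/2) (@prim_id R)) ps x0.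
  rewrite s1 /= => /(_ _)/wrap[]; last by lra.
  move=> r /andP[xr r0]; have := hd r.
  rewrite s2 /= subr0 ler0_norm// => /(_ _)/wrap[]; first by lra.
  by rewrite ltr_norml => /andP[]; lra.
exists (d' ^+ 3 / 32); first by rewrite divr_gt0// exprn_gt0.
have [V [pV _]] := ex_prim 0 (cts_loc_int csq).
rewrite -(pV.2 (- 1) 0); last by rewrite oppr_le0.
have h1 : V (- 1) <= V (- d').
  by apply: (prim_le pV) => [|x _]; [lra|exact: sqr_ge0].
have h2 : V (- (d' / 2)) <= V 0.
  by apply: (prim_le pV) => [|x _]; [lra|exact: sqr_ge0].
have := @prim_le2 _ _ _ _ _ (- d') (- (d' / 2)) (primZ (d' ^+ 2 / 8 / 2) (@prim_id R)) pV ltac:(lra).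
move=> /(_ _)/wrap[].
  move=> x /andP[x1 x2]; rewrite mulr1.
  have := low x ltac:(lra) => hx.
  rewrite cabs_sqr; have := sqr_ge0 (Im (s x)).
  have : 0 <= - x / 2 - d' / 4 by lra.
  have : 0 <= - Re (s x) - d' / 4 by lra.
  nra.
by rewrite /=; lra.
Qed.

Lemma vanishing_energy_absurd (y k C e f E : R) : 0 < y -> 0 < k -> 0 <= C -> 0 < e -> e <= 1 ->
  e <= y * k / 8 -> e <= k / (8 * (C + 1) ^+ 2) -> 1 - e <= f -> 4 * y * E <= 1 - f ^+ 2 ->
  k <= 2 * E + 2 * (C * e) ^+ 2 -> False.
Proof.
move=> y0 k0 C0 e0 e1 ey ek ef hE kE.
have k3 : (C * e) ^+ 2 <= k / 8.
  have h : (C * e) ^+ 2 <= (C + 1) ^+ 2 * e.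
    rewrite exprMn; apply: ler_pM; rewrite ?sqr_ge0//.
      by apply: lerXn2r; rewrite ?nnegrE; lra.
    by rewrite expr2 ler_piMl// ltW.
  have C2 : 0 < (C + 1) ^+ 2 by rewrite exprn_gt0//; lra.
  move: ek; rewrite ler_pdivlMr; last by lra.
  lra.
have k5 : 1 - 2 * e <= f ^+ 2.
  have h : (1 - e) ^+ 2 <= f ^+ 2 by apply: lerXn2r; rewrite ?nnegrE ?subr_ge0//; lra.
  have := sqr_ge0 e; lra.
have k6 : y * E <= y * (k / 16) by lra.
rewrite ler_pM2l// in k6; lra.
Qed.

(* Bolzano-Weierstrass: by the energy identity, a limit point of the normalised
   shooting solutions is square integrable at -oo, hence a Weyl solution. *)
Lemma weyl_cluster z (P : nat -> Prop) : 0 < Im z -> (forall m, exists n, (m <= n)%N /\ P n) ->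
  exists M, [/\ weyl_m q z M, Im M <= 0 &
    forall e : R, 0 < e -> forall m, exists n,
      [/\ (m <= n)%N, P n & cabs (F n z - cay 1 M) < e]].
Proof.
move=> z0 infP; have z0' := ltW z0.
have dz n := shoot_den_neq0 lq (n0 n) (thP n) (ur_nz _) z0'.
have F1 n : cabs (F n z) <= 1 by exact: (shoot_cayley_le1 lq (n0 n) (thP n) (ur_nz _) z0').
have [l1 [l2 hl]] := @subseq_limit (fun n => Re (F n z)) (fun n => Im (F n z)) P 1
  (fun n => le_trans (cabs_Re _) (F1 n)) (fun n => le_trans (cabs_Im _) (F1 n)) infP.
pose Phi := Complex l1 l2.
have hPhi (e : R) : 0 < e -> forall m, exists n, [/\ (m <= n)%N, P n & cabs (F n z - Phi) < e].
  move=> e0 m; have [n [mn Pn h1 h2]] := hl (e / 2) ltac:(by rewrite divr_gt0) m.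
  exists n; split=> //; apply: (le_lt_trans (cabs_ReIm _)).
  rewrite !cReD !cReN !cImD !cImN /=; lra.
have [c [dc [hc c1 c2]]] := csol_ex z 0 1 0 lq.
have [s [ds [hs s1 s2]]] := csol_ex z 0 0 1 lq.
(* The solution with Cayley transform w and Cayley denominator 1. *)
pose sol (w : R[i]) x := (w - 1) / pt 0 2 * c x + (w + 1) / 2 * s x.
pose dsol (w : R[i]) x := (w - 1) / pt 0 2 * dc x + (w + 1) / 2 * ds x.
have hsol w : csol q z (sol w) (dsol w) by exact: csol_comb.
have sol0 w : sol w 0 = (w - 1) / pt 0 2 by rewrite /sol c1 s1 mulr1 mulr0 addr0.
have dsol0 w : dsol w 0 = (w + 1) / 2 by rewrite /dsol c2 s2 mulr1 mulr0 add0r.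
have solF n x : sol (F n z) x = (th n z).1 x / D n z.
  have [h1 _ _] := thP n z.
  have [e1 e2] := cay_normalized (dz n).
  have := csol_unique lq (hsol (F n z)) (csolZ (D n z)^-1 h1) (x0 := 0).
  rewrite sol0 dsol0 !(mulrC (D n z)^-1) e1 e2 => /(_ erefl erefl x) [-> _].
  by rewrite mulrC.
have solc w : ccts (sol w) by have /csolE[h _] := hsol w; exact: cprim_ccts h.
have csq w : continuous (fun x => cabs (sol w x) ^+ 2).
  have cc := ccts_cabs (solc w).
  have cx : continuous (fun x => cabs (sol w x) * cabs (sol w x)) by move=> x; apply: cvgM; exact: cc.
  by move: cx; congr (continuous _); apply/funext => x; rewrite expr2.
pose E w (A : R) := Rintegral leb `[A, 0] (fun t => cabs (sol w t) ^+ 2).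
have E0 w A : 0 <= E w A by apply: Rintegral_ge0 => x _; exact: sqr_ge0.
(* The energy identity of the scaled solution on its whole shooting interval, cut down to [A, 0];
   the right-hand side is at most 1 for every n. *)
have EF n A : - n.+1%:R <= A -> A <= 0 ->
    4 * Im z * E (F n z) A <= 1 - cabs (F n z) ^+ 2.
  move=> nA A0.
  have nn0 : - n.+1%:R <= 0 :> R by lra.
  have [V [pV _]] := ex_prim 0 (cts_loc_int (csq (F n z))).
  have en := shoot_energy (n0 n) (thP n) z.
  have dzp := cabs_gt0 (dz n).
  have dd := cayley_den_sqr (a n z) (b n z); have nd := cayley_num_sqr (a n z) (b n z).
  have eF : cabs (F n z) ^+ 2 = cabs (cayley_num (a n z) (b n z)) ^+ 2 / cabs (D n z) ^+ 2.
    by rewrite cabsM cabsV exprMn exprVn.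
  have eE : E (F n z) (- n.+1%:R) * cabs (D n z) ^+ 2 =
    Rintegral leb `[- n.+1%:R, 0] (fun t => Re ((th n z).1 t) ^+ 2 + Im ((th n z).1 t) ^+ 2).
    rewrite /E -(pV.2 _ _ nn0) mulrBl.
    have pV2 := primZ (cabs (D n z) ^+ 2) pV.
    rewrite !(mulrC _ (cabs (D n z) ^+ 2)) (pV2.2 _ _ nn0).
    apply: eq_Rintegral => x _; rewrite solF cabsM cabsV -cabs_sqr.
    by field; rewrite gt_eqF.
  have EA : E (F n z) A <= E (F n z) (- n.+1%:R).
    rewrite /E -(pV.2 _ _ A0) -(pV.2 _ _ nn0).
    have := @prim_le _ _ _ _ _ pV nA (fun x _ => sqr_ge0 _); lra.
  have : 4 * Im z * E (F n z) (- n.+1%:R) = 1 - cabs (F n z) ^+ 2.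
    rewrite eF.
    have d2 : cabs (D n z) ^+ 2 != 0 by rewrite expf_neq0// gt_eqF.
    apply: (mulIf d2); rewrite mulrBl divfK// mul1r.
    transitivity (4 * Im z * (E (F n z) (- n.+1%:R) * cabs (D n z) ^+ 2)); first by ring.
    rewrite eE nd dd en; ring.
  move=> <-; apply: ler_wpM2l => //; lra.
have Phi1 : cabs Phi <= 1.
  apply/ler_addgt0Pr => e e0; have [n [_ _ h]] := hPhi e e0 0%N.
  have := cabsD (F n z) (Phi - F n z); rewrite addrC subrK (cabs_distC Phi).
  have := F1 n; lra.
have soldiff (A : R) : A <= 0 -> exists C : R, 0 <= C /\ forall w x, A <= x <= 0 ->
    cabs (sol w x - sol Phi x) <= C * cabs (w - Phi).
  move=> A0; have [C [C0 hC]] := csol_bound lq (cabs z) A 0.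
  exists (2 * C); split; first by lra.
  move=> w x xA; have m0 : (A <= 0 :> R) && (0 <= 0 :> R) by rewrite A0 lexx.
  have k1 := hC _ _ _ 0 x (lexx _) hc m0 xA; have k2 := hC _ _ _ 0 x (lexx _) hs m0 xA.
  have one : cabs (1 : R[i]) = 1 by rewrite /cabs /= expr0n/= addr0 expr1n sqrtr1.
  rewrite c1 c2 s1 s2 one cabs0 ?addr0 ?add0r mulr1 in k1 k2.
  have -> : sol w x - sol Phi x = (w - Phi) * (c x / pt 0 2 + s x / 2).
    by rewrite /sol; ring.
  rewrite cabsM mulrC; apply: ler_wpM2r; first exact: cabs_ge0.
  apply: (le_trans (cabsD _ _)); rewrite !cabsM !cabsV cabs_pt0.
  have -> : cabs (2 : R[i]) = 2.
    rewrite (_ : 2 = cR 2 :> R[i]) ?cabs_cR ?ger0_norm//.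
    by apply: complex_ext; rewrite /= ?addr0.
  rewrite (ger0_norm (x := 2))//.
  have := cabs_ge0 (dc x); have := cabs_ge0 (ds x); have := cabs_ge0 (c x); have := cabs_ge0 (s x).
  lra.
have Ecmp (A C e : R) w w' : A <= 0 -> 0 <= e ->
    (forall x, A <= x <= 0 -> cabs (sol w x - sol w' x) <= e) ->
    E w A <= 2 * E w' A + 2 * e ^+ 2 * (- A).
  move=> A0 e0 h.
  have [V [pV _]] := ex_prim 0 (cts_loc_int (csq w)).
  have [V' [pV' _]] := ex_prim 0 (cts_loc_int (csq w')).
  rewrite /E -(pV.2 _ _ A0) -(pV'.2 _ _ A0).
  have := prim_le2 pV (primD (primZ 2 pV') (primZ (2 * e ^+ 2) (@prim_id R))) A0.
  have H x : A <= x <= 0 -> cabs (sol w x) ^+ 2 <= 2 * cabs (sol w' x) ^+ 2 + 2 * e ^+ 2 * 1.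
    move=> /h hx; have := cabsD (sol w' x) (sol w x - sol w' x); rewrite addrC subrK => t.
    rewrite mulr1; exact: (sqr_le_double (cabs_ge0 _) (cabs_ge0 _) (cabs_ge0 _) hx t).
  move=> /(_ H) /=; lra.
have L2sol : cL2left (sol Phi).
  apply: (cL2left_bound (C := (Im z)^-1 + 2)) => // A A0.
  have [C [C0 hC]] := soldiff A A0.
  have K0 : 0 < (C + 1) * (1 - A) by apply: mulr_gt0; lra.
  (* Chosen so that (C e)^2 (- A) <= 1: the bound on the energy over [A, 0] must not depend on A. *)
  pose e := ((C + 1) * (1 - A))^-1.
  have e0 : 0 < e by rewrite invr_gt0.
  have [n [nA _ hn]] := hPhi e e0 (Num.bound (- A)).
  have An : - n.+1%:R <= A.
    have := archi_boundP (x := - A); rewrite oppr_ge0 => /(_ A0).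
    have : ((Num.bound (- A))%:R : R) <= n.+1%:R by rewrite ler_nat (leq_trans nA).
    lra.
  have k1 := EF n A An A0.
  have Ce : C * e <= 1 / (1 - A).
    rewrite /e invfM mulrA ler_pM2r ?invr_gt0; last lra.
    by rewrite ler_pdivrMr; lra.
  have Ce0 : 0 <= C * e by rewrite mulr_ge0// ltW.
  have k2 := @Ecmp A C (C * e) Phi (F n z) A0 Ce0.
  have {}k2 : E Phi A <= 2 * E (F n z) A + 2 * (C * e) ^+ 2 * - A.
    apply: k2 => x xA; rewrite cabs_distC; apply: (le_trans (hC _ x xA)).
    by apply: ler_wpM2l => //; exact: ltW.
  have k3 : E (F n z) A <= (4 * Im z)^-1.
    rewrite -[leRHS]mul1r ler_pdivlMr; last by lra.
    rewrite mulrC; apply: (le_trans k1); have := sqr_ge0 (cabs (F n z)); lra.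
  have k4 : (C * e) ^+ 2 * - A <= 1.
    have hA : 0 < 1 - A by lra.
    apply: (@le_trans _ _ ((1 / (1 - A)) ^+ 2 * - A)).
      apply: ler_wpM2r; first by rewrite oppr_ge0.
      by apply: lerXn2r; rewrite ?nnegrE// divr_ge0// ltW.
    rewrite expr_div_n expr1n mulrAC mul1r ler_pdivrMr ?exprn_gt0// mul1r.
    by nra.
  apply: (le_trans k2); rewrite invfM in k3.
  have : 0 < (Im z)^-1 by rewrite invr_gt0.
  lra.
(* Phi = 1 would make M infinite. The limit would then be s, whose energy on [-1, 0] is positive,
   whereas |F_n| near 1 forces small energies. *)
have PhiN1 : Phi != 1.
  apply/eqP => e1.
  have s0 x : sol Phi x = s x.
    by rewrite /sol e1 subrr mul0r mul0r add0r -[1 + 1]/2%:R divff ?mul1r// pnatr_eq0.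
  have [k k0 hk] := energy_lower_bound hs s1 s2.
  have Es : k <= E Phi (- 1).
    by rewrite /E (_ : (fun t => _) = (fun t => cabs (s t) ^+ 2))//; apply/funext => t; rewrite s0.
  have N10 : -1 <= 0 :> R by rewrite oppr_le0.
  have [C [C0 hC]] := soldiff (- 1) N10.
  pose e := Num.min (Num.min (Im z * k / 8) (k / (8 * (C + 1) ^+ 2))) 1.
  have C1 : 0 < C + 1 by rewrite ltr_wpDl.
  have e0 : 0 < e.
    rewrite !lt_min ltr01 andbT; apply/andP; split; first by rewrite divr_gt0// mulr_gt0.
    by rewrite divr_gt0// mulr_gt0// exprn_gt0.
  have e1' : e <= Im z * k / 8 by rewrite !ge_min lexx.
  have e2' : e <= k / (8 * (C + 1) ^+ 2) by rewrite !ge_min lexx orbT.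
  have e3' : e <= 1 by rewrite !ge_min lexx !orbT.
  have [n [_ _ hn]] := hPhi e e0 0%N.
  have k1 := EF n (- 1) ltac:(rewrite lerN2 ler1n//) N10.
  have Ce0 : 0 <= C * e by rewrite mulr_ge0// ltW.
  have k2 : E Phi (- 1) <= 2 * E (F n z) (- 1) + 2 * (C * e) ^+ 2 * - (- 1).
    apply: (@Ecmp (- 1) C) => //.
    move=> x xA; rewrite cabs_distC; apply: (le_trans (hC _ x xA)).
    by apply: ler_wpM2l => //; exact: ltW.
  have k4 : 1 - e <= cabs (F n z).
    have := cabsD (F n z) (1 - F n z); rewrite addrC subrK (cabs_distC 1).
    rewrite (_ : cabs (1 : R[i]) = 1); last by rewrite /cabs /= expr0n/= addr0 expr1n sqrtr1.
    by rewrite lerBlDr e1 in hn * => t; apply: (le_trans t); rewrite lerD2l ltW.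
  rewrite opprK mulr1 in k2.
  exact: (vanishing_energy_absurd z0 k0 C0 e0 e3' e1' e2' k4 k1 (le_trans Es k2)).
have i2 : pt 0 2 != 0 :> R[i] by rewrite eq_complex /= negb_and orbC pnatr_eq0.
have p0 : (Phi - 1) / pt 0 2 != 0 by rewrite mulf_neq0 ?subr_eq0 ?invr_neq0.
pose M := ((Phi + 1) / 2) / ((Phi - 1) / pt 0 2).
have [cayM ImM] := cayley_inverse PhiN1.
exists M; split.
- exists (sol Phi), (dsol Phi); split; first exact: hsol.
  split; first exact: L2sol.
  split; first by exists 0; rewrite sol0.
  by rewrite sol0 dsol0 /M divfK.
- exact: (ImM Phi1).
by move=> e e0 m; rewrite cayM; exact: hPhi.
Qed.

End WeylApproximation.

(** * Boundary values at a resonance *)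

Section MeasureStep.
Variable R : realType.
Local Notation leb := (@lebesgue_measure R).

Lemma measure_to_zero (F : nat -> set (measurableTypeR R)) (e : R) :
  (forall n, measurable (F n)) -> (leb (F 0%N) < +oo)%E -> nonincreasing_seq F ->
  leb (\bigcap_n F n) = 0%E -> 0 < e ->
  exists n0, forall n, (n0 <= n)%N -> (leb (F n) <= e%:E)%E.
Proof.
move=> mF F0 nF F00 e0.
have mI : measurable (\bigcap_n F n) by apply: bigcap_measurableType.
have cv := @nonincreasing_cvg_mu _ _ _ leb F F0 mF mI nF.
have {}cv : leb \o F @ \oo --> 0%E by rewrite -[X in _ --> X]F00; exact: cv.
have fn n : leb (F n) \is a fin_num.
  rewrite ge0_fin_numE//; apply: le_lt_trans F0.
  by apply: le_measure; rewrite ?inE//; rewrite -subsetEset; exact: nF.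
have [n0 _ h] := (cvgrPdist_le _ _).1 (fine_cvg cv) e e0.
exists n0 => n /h /=; rewrite sub0r normrN => h1.
by rewrite -(fineK (fn n)) lee_fin; apply: le_trans h1; exact: ler_norm.
Qed.

(** An Egorov argument for a limit in n inside a limit in j. The points with h j n > e for
    infinitely many n form [Cs j], and almost every point lies in finitely many of these. Continuity
    of the measure from above, once in j and once in n, makes the exceptional set small, and h <= B
    there. *)
Lemma iterated_limit_small (h : nat -> nat -> R -> R) (a b e B eta : R) (N : set R) (j1 : nat) :
  a <= b -> 0 <= e -> 0 < B -> 0 < eta ->
  (forall j n, continuous (h j n)) -> (forall j n t, 0 <= h j n t <= B) ->
  leb.-negligible N ->
  (forall t, a <= t <= b -> ~ N t -> exists j0, forall j, (j0 <= j)%N ->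
     exists n0, forall n, (n0 <= n)%N -> h j n t <= e) ->
  exists j n, (j1 <= j)%N /\ Rintegral leb `[a, b] (h j n) <= e * (b - a) + eta.
Proof.
move=> ab e0 B0 eta0 ch hB negN hlim.
pose U j m : set (measurableTypeR R) := `[a, b]%classic `&` [set t | e < h j m t].
have mU j m : measurable (U j m).
  apply: measurableI => //.
  have mh := measurable_realfun.continuous_measurable_fun (ch j m).
  have := mh measurableT _ (measurable_itv (Interval (BRight e) (BInfty _ false))).
  rewrite setTI; congr (measurable _); apply/seteqP; split=> t /=; by rewrite in_itv/= andbT.
pose Bs j n : set (measurableTypeR R) := \bigcup_(m in [set m | (n <= m)%N]) U j m.
have mB j n : measurable (Bs j n).
  by apply: bigcup_measurable => m _; exact: mU.
have BI j n : Bs j n `<=` `[a, b]%classic by move=> t [m _ []].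
have fI : (leb `[a, b]%classic < +oo)%E.
  by rewrite /= lebesgue_measure_itv/=; case: ifP => _; rewrite -?EFinD ltry.
have fin (A : set (measurableTypeR R)) : measurable A -> A `<=` `[a, b]%classic -> (leb A < +oo)%E.
  by move=> mA AI; apply: le_lt_trans fI; apply: le_measure; rewrite ?inE.
pose Cs j := \bigcap_n Bs j n.
have mC j : measurable (Cs j) by apply: bigcap_measurableType => n _; exact: mB.
have CI j : Cs j `<=` `[a, b]%classic by move=> t /(_ 0%N Logic.I); exact: BI.
pose Ds j : set (measurableTypeR R) := \bigcup_(i in [set i | (j <= i)%N]) Cs i.
have mD j : measurable (Ds j) by apply: bigcup_measurable => i _; exact: mC.
have DI j : Ds j `<=` `[a, b]%classic by move=> t [i _ /CI].
have D0 : leb (\bigcap_j Ds j) = 0%E.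
  apply: measure_negligible; first by apply: bigcap_measurableType => j _; exact: mD.
  apply: negligibleS negN => t Dt.
  have tI : a <= t <= b by have := DI 0%N t (Dt 0%N Logic.I); rewrite /= in_itv.
  apply: contrapT => Nt; have [j0 hj] := hlim t tI Nt.
  have [j /= jj Ct] := Dt j0 Logic.I.
  have [n0 hn] := hj j jj; have [m /= nm [_ /=]] := Ct n0 Logic.I.
  by rewrite ltNge hn.
(* Half of the admissible measure eta / B for each of the two uses of continuity from above. *)
have eB : 0 < eta / B / 2 by rewrite !divr_gt0.
have nD : nonincreasing_seq Ds.
  by move=> n m nm; rewrite subsetEset => t [i /= mi Ct]; exists i => //=; exact: leq_trans mi.
have [j0 hj0] := measure_to_zero mD (fin _ (mD _) (DI _)) nD D0 eB.
pose j := maxn j0 j1.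
have Dj := hj0 j (leq_maxl _ _).
have Cj : (leb (Cs j) <= (eta / B / 2)%:E)%E.
  apply: le_trans Dj; apply: le_measure; rewrite ?inE//.
  by move=> t Ct; exists j => /=.
pose Es n : set (measurableTypeR R) := Bs j n `\` Cs j.
have mE n : measurable (Es n) by exact: measurableD.
have EI n : Es n `<=` `[a, b]%classic by move=> t [/BI].
have nE : nonincreasing_seq Es.
  move=> n m nm; rewrite subsetEset => t [[k /= mk Ut] nC]; split=> //.
  by exists k => //=; exact: leq_trans mk.
have E0 : leb (\bigcap_n Es n) = 0%E.
  rewrite (_ : \bigcap_n Es n = set0) ?measure0//.
  apply/seteqP; split=> // t Et; have [_] := Et 0%N Logic.I.
  by apply=> n _; have [] := Et n Logic.I.
have [n hn] := measure_to_zero mE (fin _ (mE _) (EI _)) nE E0 eB.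
have Bj : (leb (Bs j n) <= (eta / B)%:E)%E.
  have -> : Bs j n = Cs j `|` Es n.
    by rewrite /Es setDUK// => t /(_ n Logic.I).
  apply: (le_trans (measureU2 _ _ _)) => //.
  have -> : (eta / B)%:E = ((eta / B / 2)%:E + (eta / B / 2)%:E)%E.
    by rewrite -EFinD; congr EFin; field; rewrite gt_eqF.
  by apply: leeD => //; exact: hn.
exists j, n; split; first exact: leq_maxr.
have hI := cts_loc_int (ch j n) a b.
have cI c : leb.-integrable `[a, b] (EFin \o (fun=> c : R)) by exact: loc_int_cst.
have mI : measurable (`[a, b]%classic : set (measurableTypeR R)) by [].
have mIB : measurable (`[a, b]%classic `\` Bs j n : set (measurableTypeR R)) by exact: measurableD.
have sub (A : set (measurableTypeR R)) g : measurable A -> A `<=` `[a, b]%classic ->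
    leb.-integrable `[a, b] (EFin \o g) -> leb.-integrable A (EFin \o g).
  by move=> mA AI; exact: (@integrableS _ _ _ leb _ _ _ mI mA AI).
have bnd (A : set (measurableTypeR R)) c : measurable A -> A `<=` `[a, b]%classic ->
    (forall t, A t -> h j n t <= c) -> Rintegral leb A (h j n) <= c * fine (leb A).
  move=> mA AI hc; rewrite -Rintegral_cst//; apply: le_Rintegral => //; exact: sub.
have IE : `[a, b]%classic = Bs j n `|` (`[a, b]%classic `\` Bs j n) :> set R by rewrite setDUK.
rewrite IE Rintegral_setU//; last 2 first.
- by rewrite -IE.
- by rewrite disj_set2E setDIK.
rewrite addrC; apply: lerD.
  apply: (@le_trans _ _ (e * fine (leb (`[a, b]%classic `\` Bs j n : set (measurableTypeR R))))).
    apply: bnd => //.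
    move=> t [tI nB]; rewrite leNgt; apply/negP => et; apply: nB.
    by exists n => //=; split.
  apply: ler_wpM2l => //.
  have -> : b - a = fine (leb `[a, b]%classic).
    rewrite /= lebesgue_measure_itv/= lte_fin; case: ltP => // ba.
    by rewrite /=; lra.
  have le : (leb (`[a, b]%classic `\` Bs j n : set (measurableTypeR R)) <= leb `[a, b]%classic)%E.
    by apply: le_measure; rewrite ?inE// => t [].
  apply: fine_le => //; rewrite ge0_fin_numE//; exact: le_lt_trans fI.
apply: (@le_trans _ _ (B * fine (leb (Bs j n)))).
  by apply: bnd => // t _; have /andP[] := hB j n t.
rewrite mulrC -ler_pdivlMr//.
have fB : leb (Bs j n) \is a fin_num by rewrite ge0_fin_numE// fin.
by rewrite -lee_fin fineK.
Qed.

End MeasureStep.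

(** * From means over the base to the boundary value *)

Section BoundaryValue.
Variable R : realType.
Variable q : R -> R.
Hypothesis lq : loc_int q.
Implicit Types (z M : R[i]).
Local Notation Re := complex.Re.
Local Notation Im := complex.Im.
Local Notation leb := (@lebesgue_measure R).

Variables (w : R) (ur dur : R -> R).
Hypothesis w0 : 0 < w.
Hypothesis pur : prim ur dur.
Hypothesis pdur : prim dur (fun t => (q t - w ^+ 2) * ur t).
Hypothesis L2u : L2left ur.
Hypothesis ur_nz : forall x, (ur x != 0) || (dur x != 0).

Variables th : nat -> R[i] -> (R -> R[i]) * (R -> R[i]).
Hypothesis thP : forall n z, [/\ csol q z (th n z).1 (th n z).2,
   (th n z).1 (- n.+1%:R) = cR (ur (- n.+1%:R)) & (th n z).2 (- n.+1%:R) = cR (dur (- n.+1%:R))].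

Local Notation a n z := ((th n z).1 0).
Local Notation b n z := ((th n z).2 0).
Local Notation F n z := (cay (a n z) (b n z)).
Local Notation F0 := (cay (cR (ur 0)) (cR (dur 0))).

Lemma cayley_den1_ge1 M : Im M <= 0 -> 1 <= cabs (cayley_den 1 M).
Proof.
move=> M0; apply: le_trans (cabs_Im _).
by rewrite /cayley_den !ReImE /= ler_normr; apply/orP; right; lra.
Qed.

(** On the closed lower half-plane both denominators have modulus at least 1. *)
Lemma cay1_lipschitz M M' : Im M <= 0 -> Im M' <= 0 ->
  cabs (cay 1 M - cay 1 M') <= 2 * cabs (M - M').
Proof.
move=> h h'.
have d := cayley_den1_ge1 h; have d' := cayley_den1_ge1 h'.
have n0 x : 1 <= cabs x -> x != 0.
  by move=> x1; apply: contraTneq x1 => ->; rewrite cabs0 -ltNge.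
rewrite cay_sub ?n0// mul1r mulr1 !cabsM cabsV cabsM cabs_pt0 ger0_norm// (cabs_distC M').
rewrite ler_pdivrMr ?mulr_gt0//; try exact: lt_le_trans d; try exact: lt_le_trans d'.
rewrite ler_peMr ?mulr_ge0 ?cabs_ge0//; nra.
Qed.

(** [weyl_bv] constrains Weyl quotients but provides none. If F_n stayed away from cay 1 M for
    infinitely many n, a cluster point along those n would be the transform of a Weyl quotient,
    which is close to M: a contradiction. *)
Lemma weyl_bv_cayley k M : 0 < k -> weyl_bv q k M -> Im M <= 0 /\
  forall e : R, 0 < e -> exists2 e0 : R, 0 < e0 & forall eps, 0 < eps -> eps < e0 ->
    exists n0, forall n, (n0 <= n)%N -> cabs (F n ((pt k eps) ^+ 2) - cay 1 M) <= e.
Proof.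
move=> k0 hM.
have ImP eps : 0 < eps -> 0 < Im ((pt k eps) ^+ 2).
  by move=> e0; rewrite expr2 cImM /=; have := mulr_gt0 k0 e0; lra.
have clus := weyl_cluster lq ur_nz thP.
have M0 : Im M <= 0.
  apply/ler_addgt0Pr => d d0; rewrite add0r.
  have [e [e0 he]] := hM d d0.
  have e2 : 0 < e / 2 by rewrite divr_gt0.
  have [M' [wM' M'0 _]] := clus _ (fun=> True) (ImP _ e2) (fun m => ex_intro _ m (conj (leqnn m) Logic.I)).
  have := he _ e2 ltac:(lra) M' wM'; have := cabs_Im (M' - M).
  by rewrite cImD cImN ler_norml => /andP[]; lra.
split=> // e e0.
(* The Lipschitz bound costs 2 (e / 4) and the cluster point e / 4, which stays below e. *)
have e4 : 0 < e / 4 by rewrite divr_gt0.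
have [e1 [e10 he]] := hM _ e4; exists e1 => // eps eps0 epse.
apply: contrapT => H.
have inf m : exists n, (m <= n)%N /\ e < cabs (F n ((pt k eps) ^+ 2) - cay 1 M).
  apply: contrapT => H'; apply: H; exists m => n mn; rewrite leNgt; apply/negP => h.
  by apply: H'; exists n.
have [M' [wM' M'0 hM']] := clus _ _ (ImP _ eps0) inf.
have d := he _ eps0 epse M' wM'.
have [n [_ h1 h2]] := hM' (e / 4) e4 0%N.
have := cay1_lipschitz M'0 M0.
have := cabsD (F n (pt k eps ^+ 2) - cay 1 M') (cay 1 M' - cay 1 M).
rewrite subrKA => h3 h4; lra.
Qed.

Lemma cay_real_abs (x y : R) : (x != 0) || (y != 0) -> cabs (cay (cR x) (cR y)) = 1.
Proof.
move=> h; have d0 := cabs_gt0 (cayley_den_real_neq0 h).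
rewrite /cay cabsM cabsV.
have -> : cabs (cayley_num (cR x) (cR y)) = cabs (cayley_den (cR x) (cR y)).
  by rewrite /cabs; congr Num.sqrt; rewrite /cayley_num /cayley_den !ReImE /=; ring.
by rewrite divff// gt_eqF.
Qed.

Lemma box_dist (r x y : R) : 0 <= r -> r < w / 2 -> w - r <= x -> x <= w + r -> 0 <= y -> y <= r ->
  cabs (cR (w ^+ 2) - pt x y ^+ 2) ^+ 2 <= 36 * r ^+ 2 * w ^+ 2.
Proof.
clear -w0 => r0 rw x1 x2 y0 yr.
have -> : cR (w ^+ 2) - pt x y ^+ 2 = (cR w - pt x y) * (cR w + pt x y).
  by rewrite -subr_sqr expr2 cRM -expr2.
have A1 : cabs (cR w - pt x y) <= 2 * r.
  apply: (le_trans (cabs_ReIm _)); rewrite !ReImE /=.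
  have : `|w - x| <= r by rewrite ler_norml; apply/andP; split; lra.
  have : `|0 - y| <= r by rewrite ler_norml; apply/andP; split; lra.
  lra.
have A2 : cabs (cR w + pt x y) <= 3 * w.
  apply: (le_trans (cabs_ReIm _)); rewrite !ReImE /= add0r.
  by rewrite !ger0_norm; lra.
rewrite cabsM exprMn.
have -> : 36 * r ^+ 2 * w ^+ 2 = (2 * r) ^+ 2 * (3 * w) ^+ 2 by ring.
apply: ler_pM; rewrite ?sqr_ge0//; apply: lerXn2r; rewrite ?nnegrE ?cabs_ge0//; lra.
Qed.

Lemma box_im (r x y y0 : R) : r < w / 2 -> 0 <= y0 -> w - r <= x -> y0 <= y ->
  w * y0 <= Im (pt x y ^+ 2).
Proof.
clear -w0 => rw y00 x1 yy; rewrite expr2 cImM /=.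
have w0' := w0; have : (w / 2) * y0 <= x * y by apply: ler_pM; lra.
lra.
Qed.

(* Cauchy: the average over the base is controlled by the other three sides, on
   which [resonance_estimate] applies. *)
Lemma rectangle_average (eta : R) : 0 < eta -> exists2 r0 : R, 0 < r0 /\ r0 <= w / 2 &
  forall r, 0 < r -> r < r0 -> exists2 e0 : R, 0 < e0 & forall eps n, 0 < eps -> eps < e0 ->
  exists V, cprim V (fun x => F n ((pt (clamp (w - r) (w + r) x) eps) ^+ 2) - F0) /\
    cabs (V (w + r) - V (w - r)) <= eta * r.
Proof.
move=> eta0.
have [C [C0 hC]] := resonance_estimate lq pur pdur L2u ur_nz thP.
(* The sides give at most 2 d r (top), 4 d r (vertical parts below height d r, where the bound is 2)
   and 2 d r (vertical parts above): 8 d r in all. *)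
pose d := Num.min (eta / 8) (1/2).
have d0 : 0 < d by rewrite lt_min divr_gt0//= divr_gt0.
have d1 : d < 1 by rewrite gt_min orbC; apply/orP; left; lra.
have de : d <= eta / 8 by rewrite ge_min lexx.
(* At heights above d r, [resonance_estimate] gives C 36 r^2 w^2 / (w d r), which is at most d^2 as
   soon as 36 C w r <= d^3. *)
pose r0 := Num.min (w / 2) (d ^+ 3 / (36 * (C + 1) * w)).
have C1 : 0 < C + 1 by lra.
have Cw : 0 < 36 * (C + 1) * w by rewrite !mulr_gt0.
exists r0.
  split; last by rewrite ge_min lexx.
  by rewrite lt_min divr_gt0//= divr_gt0// exprn_gt0.
move=> r rp; rewrite lt_min => /andP[rw rC].
have dr : 0 < d * r by exact: mulr_gt0.
exists (d * r) => // eps n eps0 epsd.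
have drr : d * r <= r by rewrite ler_piMl// ltW.
have ImP p : w - r <= Re p <= w + r -> eps <= Im p <= r -> 0 < Im (p ^+ 2).
  clear -w0 rp rw eps0; move=> /andP[h1 _] /andP[h2 _]; rewrite expr2 cImM.
  have w0' := w0; have : 0 < Re p * Im p by apply: mulr_gt0; lra.
  lra.
pose ka := 4 * w.
have kap p : w - r <= Re p <= w + r -> eps <= Im p <= r -> cabs p <= ka.
  clear -w0 rp rw eps0; move=> /andP[h1 h2] /andP[h3 h4]; apply: (le_trans (cabs_ReIm _)).
  rewrite !ger0_norm /ka; lra.
have ka0 : 0 <= ka by rewrite /ka; lra.
have [Ks [Ks0 hK]] := shoot_cayley_smooth lq (ltr0Sn R n) (thP n) (ur_nz _) (ka ^+ 2).
pose S z := cint (- n.+1%:R) 0 (fun t => (th n z).1 t * (th n z).1 t).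
pose G z := pt 0 2 * S z / (cayley_den (a n z) (b n z) * cayley_den (a n z) (b n z)).
pose K := Ks * (2 * ka) + (Ks * (2 * ka) ^+ 2 + Ks).
have k2 : 0 <= 2 * ka by lra.
have K0 : 0 <= K.
  have t1 := mulr_ge0 Ks0 k2; have t2 := mulr_ge0 Ks0 (sqr_ge0 (2 * ka)).
  by rewrite /K; lra.
have sq p : w - r <= Re p <= w + r /\ eps <= Im p <= r -> cabs (p ^+ 2) <= ka ^+ 2.
  move=> [h1 h2]; rewrite !expr2 cabsM; apply: ler_pM; rewrite ?cabs_ge0//; exact: kap.
have dsq p p' : w - r <= Re p <= w + r /\ eps <= Im p <= r ->
    w - r <= Re p' <= w + r /\ eps <= Im p' <= r ->
    cabs (p' ^+ 2 - p ^+ 2) <= (2 * ka) * cabs (p' - p).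
  move=> [h1 h2] [h3 h4]; rewrite subr_sqr mulrC cabsM; apply: ler_wpM2r; first exact: cabs_ge0.
  apply: (le_trans (cabsD _ _)); have := kap _ h1 h2; have := kap _ h3 h4; lra.
have res x y : w - r <= x <= w + r -> d * r <= y <= r -> cabs (F n ((pt x y) ^+ 2) - F0) <= d.
  move=> /andP[x1 x2] /andP[y1 y2].
  have z0 : 0 < Im ((pt x y) ^+ 2).
    by apply: ImP => /=; rewrite ?x1 ?x2 ?y2 ?andbT// (le_trans (ltW epsd)).
  have h := hC n _ z0.
  have hz := @box_dist r x y (ltW rp) rw x1 x2 (le_trans (ltW dr) y1) y2.
  have hIm := @box_im r x y (d * r) rw (ltW dr) x1 y1.
  rewrite -(ler_pXn2r (n := 2)) ?nnegrE ?cabs_ge0 ?(ltW d0)//.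
  have wdr : 0 < w * (d * r) by rewrite mulr_gt0.
  rewrite -(ler_pM2r wdr).
  apply: (@le_trans _ _ (C * (36 * r ^+ 2 * w ^+ 2))).
    apply: (@le_trans _ _ (cabs (F n (pt x y ^+ 2) - F0) ^+ 2 * Im (pt x y ^+ 2))).
      by apply: ler_wpM2l; rewrite ?sqr_ge0.
    by apply: (le_trans h); apply: ler_wpM2l.
  move: rC; rewrite ltr_pdivlMr// => rC.
  have -> : d ^+ 2 * (w * (d * r)) = d ^+ 3 * (w * r) by ring.
  have wr : 0 < w * r by rewrite mulr_gt0.
  have : r * (36 * (C + 1) * w) * (w * r) <= d ^+ 3 * (w * r) by rewrite ler_pM2r// ltW.
  apply: le_trans.
  have -> : r * (36 * (C + 1) * w) * (w * r) = (C + 1) * (36 * r ^+ 2 * w ^+ 2) by ring.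
  apply: ler_wpM2r; last by rewrite lerDl.
  by apply: mulr_ge0; last exact: sqr_ge0; apply: mulr_ge0; last exact: sqr_ge0.
have crude x y : w - r <= x <= w + r -> eps <= y <= r -> cabs (F n ((pt x y) ^+ 2) - F0) <= 2.
  move=> hx hy; apply: (le_trans (cabsB _ _)).
  rewrite cay_real_abs ?ur_nz//.
  have z0 : 0 <= Im ((pt x y) ^+ 2) by apply: ltW; exact: ImP.
  have := shoot_cayley_le1 lq (ltr0Sn R n) (thP n) (ur_nz _) z0.
  rewrite -/(cay _ _); lra.
have wr2 : w - r <= w + r by lra.
have := @cauchy_rectangle_bound R (fun p => F n (p ^+ 2) - F0) (fun p => G (p ^+ 2) * (2 * p))
  (w - r) (w + r) eps (d * r) r K d 2 d.
move=> /(_ wr2 (ltW epsd) drr K0).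
have sp p : w - r <= Re p <= w + r /\ eps <= Im p <= r -> 0 <= Im (p ^+ 2).
  by move=> [h1 h2]; apply/ltW/ImP.
move=> /(_ _)/wrap[].
  move=> p p' rp' rp''.
  have [h1 _ _] := hK _ _ (sq _ rp'') (sq _ rp') (sp _ rp'') (sp _ rp').
  have -> : F n (p' ^+ 2) - F0 - (F n (p ^+ 2) - F0) = F n (p' ^+ 2) - F n (p ^+ 2) by ring.
  apply: (le_trans h1); apply: (@le_trans _ _ (Ks * (2 * ka * cabs (p' - p)))).
    by apply: ler_wpM2l => //; exact: dsq.
  rewrite mulrA; apply: ler_wpM2r; first exact: cabs_ge0.
  by rewrite /K lerDl addr_ge0// mulr_ge0// sqr_ge0.
move=> /(_ _)/wrap[].
  move=> p p' rp' rp''.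
  have [_ h2 h3] := hK _ _ (sq _ rp'') (sq _ rp') (sp _ rp'') (sp _ rp').
  have -> : F n (p' ^+ 2) - F0 - (F n (p ^+ 2) - F0) - G (p ^+ 2) * (2 * p) * (p' - p) =
    (F n (p' ^+ 2) - F n (p ^+ 2) - G (p ^+ 2) * (p' ^+ 2 - p ^+ 2)) +
    G (p ^+ 2) * ((p' - p) * (p' - p)) by ring.
  apply: (le_trans (cabsD _ _)).
  have A1 : cabs (G (p ^+ 2) * ((p' - p) * (p' - p))) <= Ks * cabs (p' - p) ^+ 2.
    by rewrite cabsM cabsM -expr2; apply: ler_wpM2r => //; exact: sqr_ge0.
  have A2 : cabs (F n (p' ^+ 2) - F n (p ^+ 2) - G (p ^+ 2) * (p' ^+ 2 - p ^+ 2)) <=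
      Ks * (2 * ka) ^+ 2 * cabs (p' - p) ^+ 2.
    apply: (le_trans h3); rewrite -mulrA -exprMn; apply: ler_wpM2l => //.
    apply: lerXn2r; rewrite ?nnegrE ?cabs_ge0//; last exact: dsq.
    exact: mulr_ge0 k2 (cabs_ge0 _).
  apply: (le_trans (lerD A2 A1)); rewrite -mulrDl; apply: ler_wpM2r; first exact: sqr_ge0.
  by rewrite /K lerDr; exact: mulr_ge0 Ks0 k2.
move=> /(_ _)/wrap[].
  by move=> x xx; apply: res => //; rewrite drr lexx.
have w1 : w - r <= w - r <= w + r by lra.
have w2 : w - r <= w + r <= w + r by lra.
move=> /(_ _)/wrap[].
  by move=> y /andP[y1 y2]; split; apply: crude => //; rewrite y1 (le_trans y2).
move=> /(_ _)/wrap[].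
  by move=> y yy; split; apply: res.
move=> [V [pV hV]]; exists V; split=> //.
apply: (le_trans hV).
have : d * r <= eta / 8 * r by rewrite ler_pM2r.
have : 0 <= d * (d * r) by rewrite mulr_ge0 ?ltW.
nra.
Qed.

(** On the base F_n is close in mean to F0, by Cauchy's theorem, and to Phi, by the boundary values
    at almost every k. Comparing the integrals leaves |Phi - F0| times the length 2 r. *)
Lemma boundary_value_resonance (S : set R) (Phi : R[i]) : leb.-negligible (~` S) ->
  (forall e : R, 0 < e -> exists2 d : R, 0 < d & forall k, S k -> `|k - w| < d ->
     exists M, weyl_bv q k M /\ cabs (cay 1 M - Phi) <= e) ->
  Phi = F0.
Proof.
move=> negS hS.
apply/eqP; rewrite -subr_eq0; apply/eqP/cabs_eq0/eqP.
rewrite eq_le cabs_ge0 andbT; apply/ler_addgt0Pr => e' e'0; rewrite add0r.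
(* Cauchy's theorem contributes e r and the iterated limit 2 e (2 r) + e r; together 6 e r = e' (2
   r). *)
pose e := e' / 3; have e0 : 0 < e by rewrite divr_gt0.
have [d d0 hd] := hS e e0.
have [r0 [r00 r0w] hr] := rectangle_average e0.
pose r := Num.min r0 d / 2.
have r_gt0 : 0 < r by rewrite divr_gt0// lt_min r00.
have mr : Num.min r0 d <= r0 by rewrite ge_min lexx.
have md : Num.min r0 d <= d by rewrite ge_min lexx orbT.
have rr0 : r < r0 by rewrite /r in r_gt0 *; lra.
have rd : r < d by rewrite /r in r_gt0 *; lra.
have [e1 e10 he1] := hr r r_gt0 rr0.
have wr : w - r <= w + r by lra.
(* Heights of the base, tending to 0; j is the outer index of the iterated limit. *)
pose ep (j : nat) : R := j.+1%:R^-1.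
have ep0 j : 0 < ep j by rewrite invr_gt0.
have epc (x : R) : 0 < x -> exists j0, forall j, (j0 <= j)%N -> ep j < x.
  move=> x0; exists (Num.bound x^-1) => j jj.
  rewrite /ep invf_plt ?posrE//; apply: (lt_le_trans (archi_boundP _)).
    by rewrite invr_ge0 ltW.
  by rewrite ler_nat (leq_trans jj).
have [j1 hj1] := epc _ e10.
pose f j n t := F n ((pt (clamp (w - r) (w + r) t) (ep j)) ^+ 2).
have Imp j t : 0 <= Im ((pt (clamp (w - r) (w + r) t) (ep j)) ^+ 2).
  rewrite expr2 cImM /=.
  have /andP[h1 _] := clamp_in t wr.
  have : 0 <= clamp (w - r) (w + r) t * ep j by apply: mulr_ge0; [lra|exact: ltW].
  lra.
have f1 j n t : cabs (f j n t) <= 1.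
  exact: (shoot_cayley_le1 lq (ltr0Sn R n) (thP n) (ur_nz _) (Imp j t)).
pose h j n t := cabs (f j n t - Phi).
have cf j n : ccts (f j n).
  pose ka := (4 * w + ep j).
  have kap t : cabs (pt (clamp (w - r) (w + r) t) (ep j)) <= ka.
    apply: (le_trans (cabs_pt _ _)); have /andP[h1 h2] := clamp_in t wr.
    by rewrite !ger0_norm /ka; [lra|exact: ltW|lra].
  have ka0 : 0 <= ka by apply: le_trans (kap 0); exact: cabs_ge0.
  have sq t : cabs ((pt (clamp (w - r) (w + r) t) (ep j)) ^+ 2) <= ka ^+ 2.
    by rewrite !expr2 cabsM; apply: ler_pM; rewrite ?cabs_ge0.
  have [Ks [Ks0 hK]] := shoot_cayley_smooth lq (ltr0Sn R n) (thP n) (ur_nz _) (ka ^+ 2).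
  apply: (@ccts_lipschitz _ _ (Ks * (2 * ka))) => x y.
  have [k1 _ _] := hK _ _ (sq x) (sq y) (Imp j x) (Imp j y).
  apply: (le_trans k1); rewrite -mulrA; apply: ler_wpM2l => //.
  rewrite subr_sqr mulrC cabsM; apply: ler_pM; rewrite ?cabs_ge0//.
    by apply: (le_trans (cabsD _ _)); have := kap x; have := kap y; lra.
  apply: (le_trans (cabs_ReIm _)); rewrite !ReImE /= subrr normr0 addr0.
  exact: clamp_lip.
have ch j n : continuous (h j n).
  apply: ccts_cabs; split=> x.
    have -> : (fun x => Re (f j n x - Phi)) = (fun x => Re (f j n x) - Re Phi).
      by apply/funext => y; rewrite cReD cReN.
    by apply: cvgB; [exact: (cf j n).1|exact: cvg_cst].
  have -> : (fun x => Im (f j n x - Phi)) = (fun x => Im (f j n x) - Im Phi).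
    by apply/funext => y; rewrite cImD cImN.
  by apply: cvgB; [exact: (cf j n).2|exact: cvg_cst].
pose B := 1 + cabs Phi.
have B0 : 0 < B by rewrite /B; have := cabs_ge0 Phi; lra.
have hB j n t : 0 <= h j n t <= B.
  rewrite cabs_ge0/=; apply: (le_trans (cabsB _ _)); have := f1 j n t; rewrite /B; lra.
have e20 : 0 <= 2 * e by lra.
have er0 : 0 < e * r by exact: mulr_gt0.
have hlim t : w - r <= t <= w + r -> ~ (~` S) t -> exists j0, forall j, (j0 <= j)%N ->
    exists n0, forall n, (n0 <= n)%N -> h j n t <= 2 * e.
  move=> /andP[t1 t2] /contrapT St.
  have tw : `|t - w| < d by rewrite ltr_norml; apply/andP; split; lra.
  have [M [wM hM]] := hd t St tw.
  have t0 : 0 < t by lra.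
  have [_ hc] := weyl_bv_cayley t0 wM.
  have [ee ee0 hee] := hc e e0.
  have [j0 hj0] := epc _ ee0.
  exists j0 => j /hj0 ej; have [n0 hn] := hee _ (ep0 j) ej.
  exists n0 => n /hn k1; rewrite /h /f clamp_id ?t1//.
  have k2 := cabsD (F n (pt t (ep j) ^+ 2) - cay 1 M) (cay 1 M - Phi).
  rewrite subrKA in k2; apply: (le_trans k2).
  by rewrite mulr_natl mulr2n; exact: lerD.
have [j [n [jj hjn]]] := iterated_limit_small j1 wr e20 B0 er0 ch hB negS hlim.
have [V [pV hV]] := he1 (ep j) n (ep0 j) (hj1 j jj).
have [H [pH _]] := ex_prim 0 (cts_loc_int (ch j n)).
rewrite -(pH.2 _ _ wr) in hjn.
have pU := cprimB pV (cprimZ (Phi - F0) (cprim_cR (@prim_id R))).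
have := cprim_cabs_le pU pH wr.
move=> /(_ _)/wrap[].
  move=> x _; rewrite (_ : cR 1 = 1)// mulr1 /h /f.
  by rewrite (_ : _ - F0 - (Phi - F0) = F n (pt (clamp (w - r) (w + r) x) (ep j) ^+ 2) - Phi)//; ring.
set X := V (w + r) - V (w - r) in hV.
have -> : V (w + r) - (Phi - F0) * cR (id (w + r)) - (V (w - r) - (Phi - F0) * cR (id (w - r))) =
   X - (Phi - F0) * cR (2 * r).
  have -> : cR (2 * r) = cR (w + r) - cR (w - r).
    by rewrite -cRN -cRD; congr cR; ring.
  by rewrite /X /=; ring.
move=> k1.
have k2 := cabsB X (X - (Phi - F0) * cR (2 * r)).
rewrite opprB addrCA subrr addr0 cabsM cabs_cR ger0_norm in k2; last by lra.
have k3 : cabs (Phi - F0) * (2 * r) <= 6 * e * r by lra.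
have : cabs (Phi - F0) * (2 * r) <= (3 * e) * (2 * r) by lra.
rewrite ler_pM2r; last by lra.
by rewrite /e; lra.
Qed.

End BoundaryValue.

(** * The resonant solution *)

Section LimitsAlong.
Variable R : realType.
Variables (S : set R) (w : R).
Hypothesis accS : forall d : R, 0 < d -> exists k, S k /\ `|k - w| < d.
Implicit Types (f g : R -> R[i]) (l : R[i]).

(** A limit at w along S, where w itself may lie outside S. *)
Definition lim_along f l : Prop := forall e : R, 0 < e -> exists2 d : R, 0 < d &
  forall k, S k -> `|k - w| < d -> cabs (f k - l) < e.

Lemma lim_along_ext f g l : lim_along f l -> (forall k, S k -> f k = g k) -> lim_along g l.
Proof.
move=> hf fg e e0; have [d d0 hd] := hf e e0.
by exists d => // k Sk kw; rewrite -fg//; exact: hd.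
Qed.

Lemma lim_along_ext_near f g l : lim_along f l ->
  (exists2 d : R, 0 < d & forall k, S k -> `|k - w| < d -> f k = g k) -> lim_along g l.
Proof.
move=> hf [d' d'0 fg] e e0; have [d d0 hd] := hf e e0.
exists (Num.min d d'); first by rewrite lt_min d0.
by move=> k Sk; rewrite lt_min => /andP[k1 k2]; rewrite -fg//; exact: hd.
Qed.

Lemma lim_along_neq0 f l : lim_along f l -> l != 0 ->
  exists2 d : R, 0 < d & forall k, S k -> `|k - w| < d -> f k != 0.
Proof.
move=> hf l0; have [d d0 hd] := hf _ (cabs_gt0 l0).
exists d => // k Sk kw; apply: contraTneq (hd k Sk kw) => ->.
by rewrite sub0r cabsN ltxx.
Qed.

Lemma cont_alongE f : cont_along S f w -> lim_along f (f w).
Proof. by move=> h e e0; have [d [d0 hd]] := h e e0; exists d. Qed.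

Lemma lim_along_cst l : lim_along (fun=> l) l.
Proof. by move=> e e0; exists 1 => // k _ _; rewrite subrr cabs0. Qed.

Lemma lim_alongD f g l l' : lim_along f l -> lim_along g l' ->
  lim_along (fun k => f k + g k) (l + l').
Proof.
move=> hf hg e e0; have e2 : 0 < e / 2 by rewrite divr_gt0.
have [d d0 hd] := hf _ e2; have [d' d'0 hd'] := hg _ e2.
exists (Num.min d d'); first by rewrite lt_min d0.
move=> k Sk; rewrite lt_min => /andP[k1 k2].
have -> : f k + g k - (l + l') = (f k - l) + (g k - l') by ring.
apply: (le_lt_trans (cabsD _ _)); have := hd k Sk k1; have := hd' k Sk k2; lra.
Qed.

Lemma lim_alongM f g l l' : lim_along f l -> lim_along g l' ->
  lim_along (fun k => f k * g k) (l * l').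
Proof.
move=> hf hg e e0.
pose B := 1 + cabs l + cabs l'.
have l0 := cabs_ge0 l; have l'0 := cabs_ge0 l'.
have B0 : 0 < B by rewrite /B; lra.
pose e1 := Num.min 1 (e / (3 * B)).
have e10 : 0 < e1 by rewrite lt_min ltr01 divr_gt0// mulr_gt0.
have [d d0 hd] := hf _ e10; have [d' d'0 hd'] := hg _ e10.
exists (Num.min d d'); first by rewrite lt_min d0.
move=> k Sk; rewrite lt_min => /andP[/(hd k Sk) h1 /(hd' k Sk) h2].
have -> : f k * g k - l * l' = (f k - l) * (g k - l') + ((f k - l) * l' + l * (g k - l')) by ring.
have e11 : e1 <= 1 by rewrite ge_min lexx.
have e12 : e1 <= e / (3 * B) by rewrite ge_min lexx orbT.
apply: (le_lt_trans (cabsD _ _)); have := cabsD ((f k - l) * l') (l * (g k - l')).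
rewrite !cabsM; move: h1 h2.
have := cabs_ge0 (f k - l); have := cabs_ge0 (g k - l').
set x := cabs (f k - l); set y := cabs (g k - l'); set T := cabs (_ + _) => y0 x0 h1 h2 hT.
have k1 : x * y <= e1 * 1 by apply: ler_pM; lra.
have k2 : x * cabs l' <= e1 * cabs l' by apply: ler_wpM2r => //; exact: ltW.
have k3 : cabs l * y <= cabs l * e1 by apply: ler_wpM2l => //; exact: ltW.
have k4 : e1 * B <= e / 3.
  apply: (@le_trans _ _ (e / (3 * B) * B)); first by apply: ler_wpM2r => //; exact: ltW.
  by rewrite le_eqVlt; apply/orP; left; apply/eqP; field; rewrite gt_eqF.
rewrite /B in k4; lra.
Qed.

Lemma lim_alongN f l : lim_along f l -> lim_along (fun k => - f k) (- l).
Proof.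
move=> hf; rewrite -mulN1r; apply: lim_along_ext (lim_alongM (lim_along_cst (-1)) hf) _.
by move=> k _; rewrite mulN1r.
Qed.

Lemma lim_alongJ f l : lim_along f l -> lim_along (fun k => (f k)^*%C) l^*%C.
Proof.
move=> hf e e0; have [d d0 hd] := hf e e0; exists d => // k Sk kw.
by rewrite -rmorphB cabsJ; exact: hd.
Qed.

Lemma lim_alongV f l : l != 0 -> lim_along f l -> lim_along (fun k => (f k)^-1) l^-1.
Proof.
move=> l0 hf e e0; have lp := cabs_gt0 l0.
pose e1 := Num.min (cabs l / 2) (e * cabs l ^+ 2 / 4).
have e10 : 0 < e1 by rewrite lt_min divr_gt0//= divr_gt0// mulr_gt0// exprn_gt0.
have [d d0 hd] := hf _ e10; exists d => // k Sk kw.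
have h := hd k Sk kw.
have e11 : e1 <= cabs l / 2 by rewrite ge_min lexx.
have e12 : e1 <= e * cabs l ^+ 2 / 4 by rewrite ge_min lexx orbT.
have fl : cabs l / 2 <= cabs (f k).
  have := cabsD (f k) (l - f k); rewrite addrC subrK cabs_distC; lra.
have f0 : f k != 0.
  by apply: contraTneq fl => ->; rewrite cabs0 -ltNge divr_gt0.
have -> : (f k)^-1 - l^-1 = (l - f k) / (f k * l) by field; rewrite l0.
rewrite cabsM cabsV cabsM cabs_distC.
rewrite ltr_pdivrMr ?mulr_gt0 ?cabs_gt0//.
apply: (lt_le_trans h); apply: (le_trans e12).
have : cabs l / 2 * cabs l <= cabs (f k) * cabs l by apply: ler_wpM2r => //; exact: ltW.
have ee := ltW e0; move=> /(ler_wpM2l ee) k1; rewrite expr2.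
have : 0 <= e * (cabs l * cabs l) by rewrite !mulr_ge0// ltW.
lra.
Qed.

Lemma lim_along_unique f l l' : lim_along f l -> lim_along f l' -> l = l'.
Proof.
move=> h h'; apply/eqP; rewrite -subr_eq0; apply/eqP/cabs_eq0/eqP.
rewrite eq_le cabs_ge0 andbT; apply/ler_addgt0Pr => e e0; rewrite add0r.
have e2 : 0 < e / 2 by rewrite divr_gt0.
have [d d0 hd] := h _ e2; have [d' d'0 hd'] := h' _ e2.
have [|k [Sk]] := accS (d := Num.min d d'); first by rewrite lt_min d0.
rewrite lt_min => /andP[/(hd k Sk) h1 /(hd' k Sk) h2].
have -> : l - l' = (f k - l') - (f k - l) by ring.
apply: (le_trans (cabsB _ _)); lra.
Qed.

Lemma lim_along_le f g l l' : lim_along f l -> lim_along g l' ->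
  (exists2 d : R, 0 < d & forall k, S k -> `|k - w| < d -> cabs (f k) <= cabs (g k)) -> cabs l <= cabs l'.
Proof.
move=> h h' [d0 d00 fg]; apply/ler_addgt0Pr => e e0.
have e2 : 0 < e / 2 by rewrite divr_gt0.
have [d d1 hd] := h _ e2; have [d' d'0 hd'] := h' _ e2.
have [|k [Sk]] := accS (d := Num.min d0 (Num.min d d')); first by rewrite !lt_min d00 d1.
rewrite !lt_min => /and3P[/(fg k Sk) h0 /(hd k Sk) h1 /(hd' k Sk) h2].
have := cabsD (f k) (l - f k); rewrite addrC subrK (cabs_distC l).
have := cabsD l' (g k - l'); rewrite addrC subrK; lra.
Qed.

End LimitsAlong.

Lemma negligible_dense (R : realType) (S : set R) (w d : R) :
  (@lebesgue_measure R).-negligible (~` S) -> 0 < d -> exists k, S k /\ `|k - w| < d.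
Proof.
move=> negS d0; apply: contrapT => H.
have sub : `]w - d, w + d[%classic `<=` ~` S.
  move=> k /=; rewrite in_itv/= => /andP[k1 k2] Sk; apply: H; exists k; split=> //.
  by rewrite ltr_norml; apply/andP; split; lra.
have n1 := @negligibleS _ (measurableTypeR R) _ (@lebesgue_measure R) _ _ sub negS.
have mI : measurable (`]w - d, w + d[%classic : set (measurableTypeR R)) by exact: measurable_itv.
have m0 : (@lebesgue_measure R) `]w - d, w + d[%classic = 0%E.
  exact: (proj1 (@negligibleP _ (measurableTypeR R) _ (@lebesgue_measure R) _ mI) n1).
move: m0; rewrite lebesgue_measure_itv/= lte_fin ifT; last by lra.
by rewrite -EFinD => -[]; lra.
Qed.

(** * The Wronskian of a Jost solution *)

Section JostLimit.
Variable R : realType.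
Variable q : R -> R.
Hypothesis lq : loc_int q.
Local Notation Re := complex.Re.
Local Notation Im := complex.Im.

(** Primitives determine densities only almost everywhere; continuity makes the identity
    pointwise. *)
Lemma prim_zero (u f : R -> R) : prim u f -> continuous f -> (forall x, u x = 0) ->
  forall x, f x = 0.
Proof.
move=> pu cf u0 x.
have h1 := prim_is_derive pu (cf x).
have e : u = cst 0 by apply/funext.
rewrite e in h1.
have h2 : is_derive x 1 (cst (0 : R)) (0 : R) by exact: is_derive_cst.
by rewrite -(@derive_val _ _ _ _ _ _ _ h1) (@derive_val _ _ _ _ _ _ _ h2).
Qed.

Lemma csol_nonzero lam (u du : R -> R[i]) x0 : csol q lam u du -> du x0 != 0 -> exists x, u x != 0.
Proof.
move=> /csolE[[h1 h2] h3] d0; apply: contrapT => H.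
have u0 x : u x = 0 by apply/eqP/negPn/negP => ux; apply: H; exists x.
have [c1 c2] := cprim_ccts h3.
move/eqP: d0; apply; apply: complex_ext => /=.
  by apply: (prim_zero h1 c1) => x; rewrite u0.
by apply: (prim_zero h2 c2) => x; rewrite u0.
Qed.

Lemma eq_wronskian_zero lam (u du v dv : R -> R[i]) (x y : R) :
  csol q lam u du -> csol q lam v dv ->
  u x * dv x - du x * v x = u y * dv y - du y * v y.
Proof.
move=> h1 h2; have [p1 p2] := wronskian_cprim h1 h2.
have zz : forall t, (lam - lam) * (u t * v t) = 0 by move=> t; rewrite subrr mul0r.
apply: complex_ext.
  have := prim_unique (a := y) (v := fun=> Re (u y * dv y - du y * v y))
   (prim_ext p1 (fun=> erefl) (fun t => congr1 (@complex.Re R) (zz t))) (prim_cst _).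
  by move=> /(_ erefl x).
have := prim_unique (a := y) (v := fun=> Im (u y * dv y - du y * v y))
   (prim_ext p2 (fun=> erefl) (fun t => congr1 (@complex.Im R) (zz t))) (prim_cst _).
by move=> /(_ erefl x).
Qed.

Lemma cvg0_eps (f : R -> R) : f x @[x --> +oo] --> (0 : R) ->
  forall e : R, 0 < e -> exists X : R, forall x, X < x -> `|f x| < e.
Proof.
move=> /cvgrPdist_lt h e e0; have [X [_ hX]] := h e e0.
by exists X => x /hX /=; rewrite sub0r normrN.
Qed.

(** The Wronskian is constant in x, hence equal to its limit at +oo, which is that of exp(ikx) and
    its conjugate. *)
Lemma jost_wronskian (psi dpsi : R -> R -> R[i]) k : jost q psi dpsi k ->
  psi 0 k * (dpsi 0 k)^*%C - dpsi 0 k * (psi 0 k)^*%C = pt 0 (- 2 * k).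
Proof.
move=> [hs [/cvg0_eps c1 /cvg0_eps c2]].
have hsJ := csolJ hs; rewrite cRJ in hsJ.
apply/eqP; rewrite -subr_eq0; apply/eqP/cabs_eq0/eqP.
rewrite eq_le cabs_ge0 andbT; apply/ler_addgt0Pr => e e0; rewrite add0r.
(* Each of the two products differs from its free counterpart by three terms, of total size at most
   e1 (2 + |k|) = e1 B / 2. *)
pose B := 4 + 2 * `|k|; have B0 : 0 < B by rewrite /B; have := normr_ge0 k; lra.
pose e1 := Num.min 1 (e / (2 * B)).
have e10 : 0 < e1 by rewrite lt_min ltr01 divr_gt0// mulr_gt0.
have e11 : e1 <= 1 by rewrite ge_min lexx.
have e12 : e1 <= e / (2 * B) by rewrite ge_min lexx orbT.
have [X1 h1] := c1 e1 e10; have [X2 h2] := c2 e1 e10.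
pose x := Num.max X1 X2 + 1.
have m1 : X1 <= Num.max X1 X2 by rewrite le_max lexx.
have m2 : X2 <= Num.max X1 X2 by rewrite le_max lexx orbT.
have xX1 : X1 < x by rewrite /x; lra.
have xX2 : X2 < x by rewrite /x; lra.
rewrite (eq_wronskian_zero 0 x hs hsJ).
move: (h1 x xX1) (h2 x xX2); rewrite !ger0_norm ?cabs_ge0//.
set E := Complex (cos (k * x)) (sin (k * x)).
set dE := Complex (- k * sin (k * x)) (k * cos (k * x)).
have cE : cabs E = 1.
  by rewrite /cabs /E/= cos2Dsin2 sqrtr1.
have cdE : cabs dE = `|k|.
  rewrite /cabs /dE /= !exprMn sqrrN -mulrDr addrC cos2Dsin2 mulr1.
  by rewrite sqrtr_sqr.
have -> : pt 0 (- 2 * k) = E * dE^*%C - dE * E^*%C.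
  have h := cos2Dsin2 (k * x).
  apply: complex_ext; rewrite /E /dE !ReImE /=; first by ring.
  transitivity (- 2 * k * (cos (k * x) ^+ 2 + sin (k * x) ^+ 2)); [by rewrite h mulr1 | ring].
move=> k1 k2.
have -> : psi x k * (dpsi x k)^*%C - dpsi x k * (psi x k)^*%C - (E * dE^*%C - dE * E^*%C) =
  ((psi x k - E) * (dpsi x k - dE)^*%C + (psi x k - E) * dE^*%C + E * (dpsi x k - dE)^*%C)
  - ((dpsi x k - dE) * (psi x k - E)^*%C + dE * (psi x k - E)^*%C + (dpsi x k - dE) * E^*%C).
  by rewrite !rmorphB; ring.
set P := psi x k - E in k1 *; set Q := dpsi x k - dE in k2 *.
apply: (le_trans (cabsB _ _)).
have t1 : cabs (P * Q^*%C + P * dE^*%C + E * Q^*%C) <= e1 * B / 2.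
  apply: (le_trans (cabsD _ _)); have := cabsD (P * Q^*%C) (P * dE^*%C).
  rewrite !cabsM !cabsJ cE cdE.
  have := cabs_ge0 P; have := cabs_ge0 Q; have := normr_ge0 k.
  move: k1 k2; set p := cabs P; set r := cabs Q; set K := `|k|; set T := cabs (_ + _).
  move=> p1 r1 K0 r0 p0.
  have : p * r <= e1 * 1 by apply: ler_pM; lra.
  have : p * K <= e1 * K by apply: ler_wpM2r; lra.
  rewrite /B -/K; lra.
have t2 : cabs (Q * P^*%C + dE * P^*%C + Q * E^*%C) <= e1 * B / 2.
  apply: (le_trans (cabsD _ _)); have := cabsD (Q * P^*%C) (dE * P^*%C).
  rewrite !cabsM !cabsJ cE cdE.
  have := cabs_ge0 P; have := cabs_ge0 Q; have := normr_ge0 k.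
  move: k1 k2; set p := cabs P; set r := cabs Q; set K := `|k|; set T := cabs (_ + _).
  move=> p1 r1 K0 r0 p0.
  have : r * p <= 1 * e1 by apply: ler_pM; lra.
  have : K * p <= K * e1 by apply: ler_wpM2l; lra.
  rewrite /B -/K; lra.
have : e1 * B <= e / 2.
  apply: (@le_trans _ _ (e / (2 * B) * B)); first by apply: ler_wpM2r => //; exact: ltW.
  by rewrite le_eqVlt; apply/orP; left; apply/eqP; field; rewrite gt_eqF.
lra.
Qed.

End JostLimit.

(** * Identification of phi with the resonant solution *)

Section ResonantSolution.
Variable R : realType.
Variable q : R -> R.
Hypothesis lq : loc_int q.
Local Notation Re := complex.Re.
Local Notation Im := complex.Im.
Local Notation leb := (@lebesgue_measure R).

Lemma csol_real_parts (la : R) (u du : R -> R[i]) : csol q (cR la) u du ->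
  (prim (fun x => Re (u x)) (fun x => Re (du x)) /\
   prim (fun x => Re (du x)) (fun t => (q t - la) * Re (u t))) /\
  (prim (fun x => Im (u x)) (fun x => Im (du x)) /\
   prim (fun x => Im (du x)) (fun t => (q t - la) * Im (u t))).
Proof.
move=> /csolE[[h1 h2] [h3 h4]]; split; split=> //.
  by apply: prim_ext h3 _ _ => // x; rewrite !ReImE /=; ring.
by apply: prim_ext h4 _ _ => // x; rewrite !ReImE /=; ring.
Qed.

(** Since q and w^2 are real, the real and imaginary parts of a complex resonant solution both solve
    the equation and are square integrable at -oo, and one of them is nonzero. *)
Lemma real_resonant_solution (w : R) : resonance q w -> exists ur dur : R -> R,
  [/\ prim ur dur /\ prim dur (fun t => (q t - w ^+ 2) * ur t), L2left ur,
      forall x, (ur x != 0) || (dur x != 0), exists x, ur x != 0 &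
      forall v dv, prim v dv -> prim dv (fun t => (q t - w ^+ 2) * v t) -> L2left v ->
        exists c : R, forall x, v x = c * ur x].
Proof.
move=> [u0 [du0 [h0 [L0 [[x0 nz0] un]]]]].
have [hR hI] := csol_real_parts h0.
have [c1 c2] : ccts u0 by have /csolE[h _] := h0; exact: cprim_ccts h.
have sqr_cts (f : R -> R) : continuous f -> continuous (fun x => f x ^+ 2).
  by move=> cf x; apply: cvgM; exact: cf.
have dom (f h : R -> R) : continuous f -> (forall x, f x ^+ 2 <= h x) ->
    (forall a : R, leb.-integrable `]-oo, a] (fun t => (h t)%:E)) -> L2left f.
  move=> cf fh ih a.
  apply: (@le_integrable _ (measurableTypeR R) _ leb _ _ _ _ _ _ (ih a)) => //.
    apply/measurable_realfun.measurable_EFinP; apply: measurable_funTS.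
    by apply: measurable_realfun.continuous_measurable_fun; exact: sqr_cts.
  move=> x _; rewrite /= lee_fin !ger0_norm ?sqr_ge0//.
  by apply: le_trans (fh x); exact: sqr_ge0.
have [ur [dur [[p1 p2] L2u [x nzx]]]] : exists ur dur : R -> R,
  [/\ prim ur dur /\ prim dur (fun t => (q t - w ^+ 2) * ur t), L2left ur & exists x, ur x != 0].
  case: (eqVneq (Re (u0 x0)) 0) => r0.
    exists (fun x => Im (u0 x)), (fun x => Im (du0 x)); split=> //.
      by apply: (dom _ _ c2 _ L0) => x; rewrite lerDr sqr_ge0.
    exists x0; apply: contraNneq nz0 => i0.
    by apply/eqP/complex_ext.
  by exists (fun x => Re (u0 x)), (fun x => Re (du0 x)); split=> //;
     [by apply: (dom _ _ c1 _ L0) => x; rewrite lerDl sqr_ge0|exists x0].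
have lift (v dv : R -> R) : prim v dv -> prim dv (fun t => (q t - w ^+ 2) * v t) -> L2left v ->
    exists c : R[i], forall x, cR (v x) = c * u0 x.
  move=> h1 h2 h3; apply: (un _ (fun x => cR (dv x))); first exact: real_csol.
  move=> a; rewrite (_ : (fun t => _) = (fun t => (v t ^+ 2)%:E)); first exact: h3.
  by apply/funext => y; rewrite /= expr0n /= addr0.
have [c' hc'] := lift _ _ p1 p2 L2u.
have c'0 : c' != 0.
  apply: contraNneq nzx => e; have := hc' x; rewrite e mul0r => /(congr1 (@complex.Re R)) /= ->.
  by [].
exists ur, dur; split=> //; last first.
  move=> v dv h1 h2 h3; have [c hc] := lift _ _ h1 h2 h3.
  exists (Re (c / c')) => y.
  have : cR (v y) = (c / c') * cR (ur y) by rewrite hc hc' mulrA divfK.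
  by move=> /(congr1 (@complex.Re R)); rewrite !ReImE /= mulr0 subr0.
  by exists x.
move=> y; rewrite -negb_and; apply/negP => /andP[/eqP e1 /eqP e2].
have e3 : cR (ur y) = 0 by rewrite e1.
have e4 : cR (dur y) = 0 by rewrite e2.
have [e5 _] := csol_zero lq (real_csol p1 p2) e3 e4 x.
by move/eqP: nzx; apply; have := congr1 (@complex.Re R) e5.
Qed.

Lemma csol_lim_along (S : set R) (c d : R[i]) (sol : R[i] -> (R -> R[i]) * (R -> R[i])) (w x : R) :
  (forall z, [/\ csol q z (sol z).1 (sol z).2, (sol z).1 0 = c & (sol z).2 0 = d]) ->
  lim_along S w (fun k => (sol (cR (k ^+ 2))).1 x) ((sol (cR (w ^+ 2))).1 x).
Proof.
move=> solP; pose X := `|x|; have X0 : 0 <= X by exact: normr_ge0.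
have [C [C0 hC]] := csol_continuous_dep lq ((`|w| + 1) ^+ 2) (cabs c + cabs d)
   (A := - X) (B := X) (x0 := 0) ltac:(apply/andP; split; lra).
have xX : - X <= x <= X by rewrite -ler_norml.
move=> e e0; have W0 : 0 < 2 * `|w| + 1 by have := normr_ge0 w; lra.
have V0 : 0 < (C + 1) * (2 * `|w| + 1) by rewrite mulr_gt0//; lra.
exists (Num.min 1 (e / ((C + 1) * (2 * `|w| + 1)))); first by rewrite lt_min ltr01 divr_gt0.
move=> k _; rewrite lt_min => /andP[k1 k2].
have [h1 e1 e2] := solP (cR (k ^+ 2)); have [h3 e3 e4] := solP (cR (w ^+ 2)).
have kb : `|k| <= `|w| + 1.
  by have := ler_normD (k - w) w; rewrite subrK; lra.
have b1 : cabs (cR (k ^+ 2)) <= (`|w| + 1) ^+ 2.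
  by rewrite cabs_cR normrX ler_pXn2r ?nnegrE//; have := normr_ge0 w; lra.
have b2 : cabs (cR (w ^+ 2)) <= (`|w| + 1) ^+ 2.
  by rewrite cabs_cR normrX ler_pXn2r ?nnegrE//; have := normr_ge0 w; lra.
have b3 : cabs ((sol (cR (k ^+ 2))).1 0) + cabs ((sol (cR (k ^+ 2))).2 0) <= cabs c + cabs d.
  by rewrite e1 e2.
have := hC _ _ _ _ _ _ b1 b2 h1 h3 (etrans e1 (esym e3)) (etrans e2 (esym e4)) b3 x xX.
have -> : cR (k ^+ 2) - cR (w ^+ 2) = cR ((k - w) * (k + w)).
  by apply: complex_ext; rewrite !ReImE /=; ring.
rewrite cabs_cR normrM => h.
have kw : `|k + w| <= 2 * `|w| + 1 by have := ler_normD k w; lra.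
have t1 : `|k - w| * `|k + w| <= `|k - w| * (2 * `|w| + 1) by exact: ler_wpM2l.
have t2 := ler_wpM2l C0 t1.
have t3 : (C + 1) * (2 * `|w| + 1) * `|k - w| < e by rewrite mulrC -ltr_pdivlMr.
have t4 : 0 <= `|k - w| * (2 * `|w| + 1) by rewrite mulr_ge0//; exact: ltW.
have := cabs_ge0 ((sol (cR (k ^+ 2))).2 x - (sol (cR (w ^+ 2))).2 x).
lra.
Qed.

Variables (psi dpsi : R -> R -> R[i]) (Rc : R -> R[i]).
Local Notation S := (good q psi dpsi Rc).
Hypothesis negS : leb.-negligible (~` S).
Variable w : R.
Hypothesis w0 : 0 < w.
Hypothesis contpsi : forall x, cont_along S (psi x) w.
Hypothesis contR : cont_along S Rc w.

Let accS (d : R) : 0 < d -> exists k, S k /\ `|k - w| < d.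
Proof. exact: negligible_dense. Qed.

Local Notation lim := (lim_along S w).

(** psi'(0, k) carries no continuity assumption. It is obtained by solving psi(x1, k) = psi(0, k)
    c(x1) + psi'(0, k) s(x1) at a point x1 where s does not vanish. The Wronskian passes to the
    limit although w may lie outside [good]. *)
Lemma jost_limit : exists X dX : R -> R[i], [/\ csol q (cR (w ^+ 2)) X dX,
  forall x, X x = psi x w, lim (dpsi 0) (dX 0) &
  X 0 * (dX 0)^*%C - dX 0 * (X 0)^*%C = pt 0 (- 2 * w)].
Proof.
have [c hc] := ex_shoot lq 0 1 0; have [s hs] := ex_shoot lq 0 0 1.
have [c1 c2 c3] := hc (cR (w ^+ 2)); have [s1 s2 s3] := hs (cR (w ^+ 2)).
have rep x k : S k -> psi x k = psi 0 k * (c (cR (k ^+ 2))).1 x + dpsi 0 k * (s (cR (k ^+ 2))).1 x.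
  move=> [[hpsi _] _].
  have [c1' c2' c3'] := hc (cR (k ^+ 2)); have [s1' s2' s3'] := hs (cR (k ^+ 2)).
  have h := csolD (csolZ (psi 0 k) c1') (csolZ (dpsi 0 k) s1').
  apply: (proj1 (csol_unique lq (x0 := 0) hpsi h _ _ x)).
    by rewrite c2' s2' mulr0 mulr1 addr0.
  by rewrite c3' s3' mulr0 mulr1 add0r.
have [x1 sx1] : exists x, (s (cR (w ^+ 2))).1 x != 0.
  by apply: (csol_nonzero (x0 := 0) s1); rewrite s3 oner_neq0.
have limc x := csol_lim_along S w x hc.
have lims x := csol_lim_along S w x hs.
have limpsi x : lim (psi x) (psi x w) by exact: cont_alongE.
pose d := (psi x1 w - psi 0 w * (c (cR (w ^+ 2))).1 x1) / (s (cR (w ^+ 2))).1 x1.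
have limd : lim (dpsi 0) d.
  have l1 := lim_alongM (lim_alongD (limpsi x1) (lim_alongN (lim_alongM (limpsi 0) (limc x1))))
                        (lim_alongV sx1 (lims x1)).
  apply: lim_along_ext_near l1 _.
  have [d1 d10 hd1] := lim_along_neq0 (lims x1) sx1.
  exists d1 => // k Sk kw; rewrite (rep x1 k Sk); have nz := hd1 k Sk kw.
  by field.
exists (fun x => psi 0 w * (c (cR (w ^+ 2))).1 x + d * (s (cR (w ^+ 2))).1 x),
       (fun x => psi 0 w * (c (cR (w ^+ 2))).2 x + d * (s (cR (w ^+ 2))).2 x).
split.
- by apply: csolD; apply: csolZ.
- move=> x; apply: (lim_along_unique accS _ (limpsi x)).
  apply: lim_along_ext (lim_alongD (lim_alongM (limpsi 0) (limc x)) (lim_alongM limd (lims x))) _.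
  by move=> k Sk; rewrite -rep.
- by rewrite c3 s3 mulr0 mulr1 add0r.
rewrite c2 s2 c3 s3 !mulr0 !mulr1 addr0 add0r.
have l1 := lim_alongD (lim_alongM (limpsi 0) (lim_alongJ limd))
   (lim_alongN (lim_alongM limd (lim_alongJ (limpsi 0)))).
apply: (lim_along_unique accS l1).
move=> e e0; exists (e / 2); first by rewrite divr_gt0.
move=> k [jk _] kw; rewrite (jost_wronskian jk).
have -> : pt 0 (- 2 * k) - pt 0 (- 2 * w) = cR 2 * pt 0 (w - k).
  by apply: complex_ext; rewrite !ReImE /=; ring.
rewrite cabsM cabs_cR cabs_pt0 distrC ger0_norm//; lra.
Qed.

Lemma wronskian_combination (r p d : R[i]) : r * p + p^*%C = 0 -> r * d + d^*%C = 0 ->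
  p * d^*%C - d * p^*%C = 0.
Proof.
move=> /eqP; rewrite addrC addr_eq0 => /eqP -> /eqP; rewrite addrC addr_eq0 => /eqP ->; ring.
Qed.

Lemma cay_homogeneous (m p r : R[i]) : p != 0 -> r = m * p -> cay p r = cay 1 m.
Proof.
move=> p0 ->; rewrite /cay /cayley_num /cayley_den.
rewrite mulr1 -!mulrDl -mulrBl.
by rewrite -mulf_div divff// mulr1.
Qed.

Lemma pt0_neq0 (y : R) : y != 0 -> pt 0 y != 0 :> R[i].
Proof. by apply: contraNneq => /(congr1 (@complex.Im R)) /= ->. Qed.

(** The relation defining R says that R psi + conj psi has logarithmic derivative M at 0. It does
    not vanish there, as otherwise its derivative would vanish too, and then also the Wronskian of
    psi and conj psi. *)
Lemma refl_cayley k : 0 < k -> S k ->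
  exists M, [/\ weyl_bv q k M, Rc k * psi 0 k + (psi 0 k)^*%C != 0 &
   Rc k * dpsi 0 k + (dpsi 0 k)^*%C = M * (Rc k * psi 0 k + (psi 0 k)^*%C)].
Proof.
move=> k0 [jk [M [hM /= [D0 hD]]]]; exists M.
have e : Rc k * dpsi 0 k + (dpsi 0 k)^*%C = M * (Rc k * psi 0 k + (psi 0 k)^*%C).
  apply/eqP; rewrite -subr_eq0; apply/eqP.
  transitivity (Rc k * (dpsi 0 k - M * psi 0 k) + ((dpsi 0 k)^*%C - M * (psi 0 k)^*%C)); first by ring.
  by rewrite hD addNr.
split=> //.
apply/eqP => p0; move: e; rewrite p0 mulr0 => e.
have := wronskian_combination p0 e; rewrite (jost_wronskian jk) => /eqP.
apply/negP; apply: pt0_neq0; rewrite mulf_neq0 ?oppr_eq0 ?pnatr_eq0// gt_eqF//.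
Qed.

Variables ur dur : R -> R.
Hypothesis pur : prim ur dur.
Hypothesis pdur : prim dur (fun t => (q t - w ^+ 2) * ur t).
Hypothesis L2u : L2left ur.
Hypothesis ur_nz : forall x, (ur x != 0) || (dur x != 0).

Lemma jost_combination_cayley : exists X dX : R -> R[i], [/\ csol q (cR (w ^+ 2)) X dX,
  forall x, X x = psi x w,
  X 0 * (dX 0)^*%C - dX 0 * (X 0)^*%C != 0,
  cayley_den (Rc w * X 0 + (X 0)^*%C) (Rc w * dX 0 + (dX 0)^*%C) != 0 &
  cay (Rc w * X 0 + (X 0)^*%C) (Rc w * dX 0 + (dX 0)^*%C) = cay (cR (ur 0)) (cR (dur 0))].
Proof.
have [X [dX [sX eX limd W]]] := jost_limit; exists X, dX.
have Wn : X 0 * (dX 0)^*%C - dX 0 * (X 0)^*%C != 0.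
  by rewrite W; apply: pt0_neq0; rewrite mulf_neq0 ?oppr_eq0 ?pnatr_eq0// gt_eqF.
pose P k := Rc k * psi 0 k + (psi 0 k)^*%C.
pose Q k := Rc k * dpsi 0 k + (dpsi 0 k)^*%C.
have limR : lim Rc (Rc w) by exact: cont_alongE.
have limp : lim (psi 0) (X 0) by rewrite eX; exact: cont_alongE.
have limP := lim_alongD (lim_alongM limR limp) (lim_alongJ limp).
have limQ := lim_alongD (lim_alongM limR limd) (lim_alongJ limd).
have limi (z : R[i]) : lim (fun=> z) z by exact: lim_along_cst.
have limden := lim_alongD limQ (lim_alongN (lim_alongM (limi (pt 0 1)) limP)).
have limnum := lim_alongD limQ (lim_alongM (limi (pt 0 1)) limP).
pose th n := projT1 (cid (ex_shoot lq (- n.+1%:R) (cR (ur (- n.+1%:R))) (cR (dur (- n.+1%:R))))).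
have thP n z : [/\ csol q z (th n z).1 (th n z).2,
   (th n z).1 (- n.+1%:R) = cR (ur (- n.+1%:R)) & (th n z).2 (- n.+1%:R) = cR (dur (- n.+1%:R))].
  by rewrite /th; case: (cid _) => f /= hf; exact: hf.
have kpos k : `|k - w| < w -> 0 < k by rewrite ltr_norml => /andP[]; lra.
have ImM k M : 0 < k -> weyl_bv q k M -> Im M <= 0.
  by move=> k0 hM; have [] := weyl_bv_cayley lq ur_nz thP k0 hM.
(* For k near w in [good] the numerator is dominated by the denominator, as Im M <= 0. If the limit
   denominator vanished, so would the numerator, hence both data of R psi + conj psi, against the
   Wronskian of psi and conj psi. *)
have den0 : cayley_den (Rc w * X 0 + (X 0)^*%C) (Rc w * dX 0 + (dX 0)^*%C) != 0.
  apply/eqP => d0.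
  have num0 : cayley_num (Rc w * X 0 + (X 0)^*%C) (Rc w * dX 0 + (dX 0)^*%C) = 0.
    apply: cabs_eq0; apply/eqP; rewrite eq_le cabs_ge0 andbT.
    have := lim_along_le accS limnum limden; rewrite -/(cayley_den _ _) -/(cayley_num _ _) d0 cabs0.
    apply; exists w => // k Sk /kpos k0.
    have [M [hM P0 eQ]] := refl_cayley k0 Sk.
    change (cabs (cayley_num (P k) (Q k)) <= cabs (cayley_den (P k) (Q k))).
    rewrite -(ler_pXn2r (n := 2)) ?nnegrE ?cabs_ge0// cayley_den_sqr cayley_num_sqr.
    suff : Im ((P k)^*%C * Q k) <= 0 by lra.
    have -> : Im ((P k)^*%C * Q k) = Im M * cabs (P k) ^+ 2.
      by rewrite /Q eQ -/(P k) cabs_sqr !ReImE; ring.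
    by rewrite mulr_le0_ge0 ?sqr_ge0//; exact: ImM hM.
  move: d0 num0; rewrite /cayley_den /cayley_num.
  set p := _ * X 0 + _; set r := _ * dX 0 + _ => d0 n0.
  have r0 : r = 0.
    apply: (mulfI (_ : 2 != 0 :> R[i])); first by rewrite pnatr_eq0.
    by rewrite mulr0 -[RHS](addr0 0) -{1}d0 -n0; ring.
  have p0 : p = 0.
    apply: (mulfI (_ : pt 0 1 != 0 :> R[i])); first by apply: pt0_neq0; rewrite oner_eq0.
    by rewrite mulr0 -n0 r0 add0r.
  by move/eqP: Wn; apply; exact: wronskian_combination p0 r0.
split=> //.
have limcay := lim_alongM limnum (lim_alongV den0 limden).
apply: (boundary_value_resonance lq w0 pur pdur L2u ur_nz thP negS).
move=> e e0; have [d d0 hd] := limcay e e0.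
exists (Num.min d w); first by rewrite lt_min d0.
move=> k Sk; rewrite lt_min => /andP[k1 /kpos k0].
have [M [hM P0 eQ]] := refl_cayley k0 Sk; exists M; split=> //; apply: ltW.
by rewrite -(cay_homogeneous P0 eQ); exact: hd.
Qed.

Lemma phi_fun_multiple : (exists x, ur x != 0) ->
  exists2 kappa : R, kappa != 0 & forall x, phi_fun psi Rc w x = kappa * ur x.
Proof.
move=> [x0 nzx0].
have [X [dX [sX eX Wn den0 ecay]]] := jost_combination_cayley.
set r := Rc w in den0 ecay *.
set p := r * X 0 + _ in den0 ecay; set t := r * dX 0 + _ in den0 ecay.
set a := cR (ur 0) in ecay; set b := cR (dur 0) in ecay.
have den1 : cayley_den a b != 0 by exact: cayley_den_real_neq0.
have pbta : p * b = t * a.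
  move: ecay den0 den1; rewrite /cay => /eqP + d0 d1; rewrite eqr_div// => /eqP e.
  apply: (mulfI (_ : 2 * pt 0 1 != 0 :> R[i])).
    by rewrite mulf_neq0 ?pnatr_eq0// pt0_neq0// oner_eq0.
  move/eqP: e; rewrite -subr_eq0 /cayley_num /cayley_den => /eqP e.
  by apply/eqP; rewrite -subr_eq0 -e; apply/eqP; ring.
have [c c0 [ep et]] : exists2 c : R[i], c != 0 & p = c * a /\ t = c * b.
  have pt0 : (p != 0) || (t != 0).
    rewrite -negb_and; apply: contra den0 => /andP[/eqP -> /eqP ->].
    by rewrite /cayley_den mulr0 subrr.
  case: (eqVneq a 0) => a0.
    have b0 : b != 0 by apply: contraNneq den1 => ->; rewrite a0 /cayley_den mulr0 subrr.
    have p0 : p = 0 by apply: (mulIf b0); rewrite mul0r pbta a0 mulr0.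
    exists (t / b); last by rewrite a0 p0 mulr0 divfK.
    by rewrite mulf_neq0 ?invr_eq0//; move: pt0; rewrite p0 eqxx.
  exists (p / a); last by rewrite divfK// mulrAC pbta mulfK.
  rewrite mulf_neq0 ?invr_eq0//; apply: contraTneq pt0 => p0.
  have : t * a = 0 by rewrite -pbta p0 mul0r.
  by move/eqP; rewrite mulf_eq0 (negPf a0) orbF p0 eqxx /= negbK.
have sXJ := csolJ sX; rewrite cRJ in sXJ.
have schi := csolD (csolZ r sX) sXJ.
have echi x : r * X x + (X x)^*%C = c * cR (ur x).
  exact: (proj1 (csol_unique lq (x0 := 0) schi (csolZ c (real_csol pur pdur)) ep et x)).
(* R psi + conj psi is a multiple of a real solution, so its Wronskian with its conjugate is 0; that
   Wronskian is also (|R|^2 - 1) times the one of psi and conj psi. *)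
have rr : r * r^*%C = 1.
  have W0 : p * t^*%C - t * p^*%C = 0.
    have aJ : a^*%C = a by exact: cRJ.
    have bJ : b^*%C = b by exact: cRJ.
    have JM (u v : R[i]) : (u * v)^*%C = u^*%C * v^*%C by exact: rmorphM.
    by rewrite ep et !JM aJ bJ; ring.
  apply/eqP; rewrite -subr_eq0; apply/eqP; apply: (mulIf Wn); rewrite mul0r -W0 /p /t.
  by rewrite !rmorphD !rmorphM /= !conjcK; ring.
pose s := sqrtc r.
have s2 : s * s = r by rewrite -expr2 sqr_sqrtc.
have ss : s * s^*%C = 1.
  have : cabs s ^+ 2 = 1.
    have h : cabs r ^+ 2 = 1.
      by have := congr1 (@complex.Re R) rr; rewrite cabs_sqr !ReImE /=; lra.
    have : (cabs s ^+ 2 - 1) * (cabs s ^+ 2 + 1) = 0.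
      by have := h; rewrite -s2 cabsM exprMn => h'; rewrite mulrDr mulr1 mulrBl h'; ring.
    move/eqP; rewrite mulf_eq0 => /orP[/eqP|]; first lra.
    by rewrite gt_eqF// ltr_wpDl// sqr_ge0.
  by rewrite cabs_sqr => h; apply: complex_ext; rewrite !ReImE /=; lra.
(* As |s| = 1, the sum s psi + conj (s psi) is conj s times s^2 psi + conj psi, and s^2 = R. *)
have ephi x : cR (phi_fun psi Rc w x) = s^*%C * c * cR (ur x).
  rewrite -mulrA -echi -s2.
  transitivity (s * X x + (s * X x)^*%C).
    by rewrite /phi_fun -/r -/s -eX; apply: complex_ext; rewrite !ReImE /=; ring.
  transitivity (s * s^*%C * (s * X x) + s^*%C * (X x)^*%C); last by ring.
  by rewrite ss mul1r rmorphM.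
have phiE x : phi_fun psi Rc w x = Re (s^*%C * c) * ur x.
  by have := congr1 (@complex.Re R) (ephi x); rewrite [in RHS]cReM /= mulr0 subr0.
exists (Re (s^*%C * c)) => //.
apply: contraNneq nzx0 => k0.
have := ephi x0; rewrite phiE k0 mul0r => /esym/eqP.
rewrite !mulf_eq0 (negPf c0) orbF => /orP[/eqP sJ0|/eqP /(congr1 (@complex.Re R)) /= ->//].
by move/eqP: ss; rewrite sJ0 mulr0 eq_sym oner_eq0.
Qed.

End ResonantSolution.

Lemma phi_fun_resonant (R : realType) (q : R -> R) (psi dpsi : R -> R -> R[i]) (Rc : R -> R[i]) (w : R) :
  loc_int q -> (@lebesgue_measure R).-negligible (~` good q psi dpsi Rc) -> 0 < w ->
  (forall x, cont_along (good q psi dpsi Rc) (psi x) w) -> cont_along (good q psi dpsi Rc) Rc w ->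
  resonance q w ->
  let phi := phi_fun psi Rc w in exists dphi : R -> R,
  [/\ prim phi dphi, prim dphi (fun t => (q t - w ^+ 2) * phi t), L2left phi,
      exists x, phi x != 0 &
      forall v dv, prim v dv -> prim dv (fun t => (q t - w ^+ 2) * v t) -> L2left v ->
        exists c : R, forall x, v x = c * phi x].
Proof.
move=> lq negS w0 cpsi cR0 /(real_resonant_solution lq) [ur [dur [[p1 p2] L2u nz [x0 nzx0] un]]] phi.
have [kappa k0 phiE] := phi_fun_multiple lq negS w0 cpsi cR0 p1 p2 L2u nz (ex_intro _ x0 nzx0).
exists (fun x => kappa * dur x); split.
- by apply: prim_ext (primZ kappa p1) _ _ => x //; rewrite /phi phiE.
- by apply: prim_ext (primZ kappa p2) _ _ => x //; rewrite /phi phiE; ring.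
- move=> a; rewrite (_ : (fun t => _) = (fun t => (kappa ^+ 2)%:E * (ur t ^+ 2)%:E)%E).
    by apply: integrableZl => //; exact: L2u.
  by apply/funext => x; rewrite -EFinM /phi phiE exprMn.
- by exists x0; rewrite /phi phiE mulf_neq0.
move=> v dv h1 h2 h3; have [c hc] := un v dv h1 h2 h3.
by exists (c / kappa) => x; rewrite /phi phiE mulrA divfK.
Qed.

(** * Wronskians at -oo *)

Lemma integrable_ray_extend (R : realType) (h : R -> R) (X : R) : continuous h ->
  (forall x, 0 <= h x) -> (@lebesgue_measure R).-integrable `]-oo, X] (EFin \o h) ->
  forall a, (@lebesgue_measure R).-integrable `]-oo, a] (EFin \o h).
Proof.
move=> ch h0 ih a; have lh := cts_loc_int ch; pose m := Num.max X a.
have Xm : X <= m by rewrite le_max lexx.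
have am : a <= m by rewrite le_max lexx orbT.
pose leb := @lebesgue_measure R.
apply: (@integrable_ray _ _ _ (Rintegral leb `]-oo, X] h + Rintegral leb `[X, m] h)) => // x xa.
have sub (D D' : set R) : measurable D -> measurable D' -> D `<=` D' ->
    leb.-integrable D' (EFin \o h) -> Rintegral leb D h <= Rintegral leb D' h.
  by move=> mD mD' DD' iD'; exact: Rintegral_ge0_subset.
have nn D : 0 <= Rintegral leb D h by apply: Rintegral_ge0.
apply: (@le_trans _ _ (Rintegral leb `[x, m] h)).
  apply: sub => //; try exact: measurable_itv.
  by move=> y /=; rewrite !in_itv/= => /andP[-> /le_trans]; exact.
case: (leP x X) => xX.
  rewrite (Rintegral_chasles lh xX Xm) lerD2r; apply: sub => //; try exact: measurable_itv.
  by move=> y /=; rewrite !in_itv/= => /andP[].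
apply: (@le_trans _ _ (Rintegral leb `[X, m] h)); last by rewrite lerDr.
apply: sub => //; try exact: measurable_itv.
by move=> y /=; rewrite !in_itv/= => /andP[xy ->]; rewrite (le_trans (ltW xX)).
Qed.

Section RealSolutions.
Variable R : realType.
Variable q : R -> R.
Hypothesis lq : loc_int q.
Local Notation leb := (@lebesgue_measure R).
Implicit Types (f df g dg v dv : R -> R).

Definition rsol la f df := prim f df /\ prim df (fun t => (q t - la) * f t).

Lemma rsol_cts la f df : rsol la f df -> continuous f /\ continuous df.
Proof. by move=> [h1 h2]; split; [exact: prim_cts h1|exact: prim_cts h2]. Qed.

Lemma rsolZ la c f df : rsol la f df -> rsol la (fun x => c * f x) (fun x => c * df x).
Proof.
move=> [h1 h2]; split; first exact: primZ.
by apply: prim_ext (primZ c h2) _ _ => x //; ring.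
Qed.

Lemma wronskian_prim la mu f df g dg : rsol la f df -> rsol mu g dg ->
  prim (fun x => f x * dg x - df x * g x) (fun x => (la - mu) * (f x * g x)).
Proof.
move=> [f1 f2] [g1 g2].
by apply: prim_ext (primB (primM f1 g2) (primM f2 g1)) _ _ => x //; ring.
Qed.

Lemma wronskian_cst la f df g dg x y : rsol la f df -> rsol la g dg ->
  f x * dg x - df x * g x = f y * dg y - df y * g y.
Proof.
move=> h1 h2; have := wronskian_prim h1 h2 => p.
have p' : prim (fun x => f x * dg x - df x * g x) (fun=> 0).
  by apply: prim_ext p _ _ => t //; rewrite subrr mul0r.
exact: (prim_unique (a := y) p' (prim_cst _) erefl x).
Qed.

Lemma rsol_zero la f df (x0 : R) : rsol la f df -> f x0 = 0 -> df x0 = 0 -> forall x, f x = 0.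
Proof.
move=> [h1 h2] e1 e2 x.
have [] := csol_zero lq (x0 := x0) (real_csol h1 h2) _ _ x; [by rewrite e1|by rewrite e2|].
by move=> /(congr1 (@complex.Re R)).
Qed.

(** The data (- f', f) / (f^2 + f'^2) at 0 give Wronskian 1, even if one of f(0), f'(0) is 0. *)
Lemma ex_second_solution la f df : rsol la f df -> (exists x, f x != 0) ->
  exists v dv, rsol la v dv /\ forall x, f x * dv x - df x * v x = 1.
Proof.
move=> hf [x1 nz].
have n0 : 0 < f 0 ^+ 2 + df 0 ^+ 2.
  rewrite lt_neqAle addr_ge0 ?sqr_ge0// andbT eq_sym paddr_eq0 ?sqr_ge0// !sqrf_eq0.
  apply/negP => /andP[/eqP e1 /eqP e2].
  by move/eqP: nz; apply; exact: (rsol_zero hf e1 e2).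
pose n := f 0 ^+ 2 + df 0 ^+ 2.
have [u [du [hu e1 e2]]] := csol_ex (cR la) 0 (cR (- df 0 / n)) (cR (f 0 / n)) lq.
have [hv _] := csol_real_parts hu.
exists (fun x => complex.Re (u x)), (fun x => complex.Re (du x)); split=> // x.
rewrite (wronskian_cst x 0 hf hv) e1 e2 /=.
by rewrite /n; field; rewrite gt_eqF.
Qed.

(** The Wronskian is a primitive of (la - mu) f g, which is integrable at -oo; l is its limit
    there. *)
Lemma wronskian_lim la mu f df g dg : rsol la f df -> rsol mu g dg -> L2left f -> L2left g ->
  exists l, forall x, f x * dg x - df x * g x =
     l + (la - mu) * Rintegral leb `]-oo, x] (fun s => f s * g s).
Proof.
move=> hf hg Lf Lg.
have [cf _] := rsol_cts hf; have [cg _] := rsol_cts hg.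
have cfg : continuous (fun s => f s * g s) by move=> x; apply: cvgM; [exact: cf|exact: cg].
have ifg a : leb.-integrable `]-oo, a] (EFin \o (fun s => f s * g s)).
  by apply: integrable_square_prod.
have p1 := wronskian_prim hf hg.
have p2 := primZ (la - mu) (prim_ray cfg ifg).
set c := f 0 * dg 0 - df 0 * g 0 - (la - mu) * Rintegral leb `]-oo, 0] (fun s => f s * g s).
exists c => x.
have p3 : prim (fun x => c + (la - mu) * Rintegral leb `]-oo, x] (fun s => f s * g s))
   (fun x => (la - mu) * (f x * g x)).
  by apply: prim_ext (primD (prim_cst c) p2) _ _ => t //; rewrite add0r.
apply: (prim_unique (a := 0) p1 p3); rewrite /c; ring.
Qed.

(* If l != 0, then W(g,v) stays bounded by Gronwall, and the second solution
   v = (g - f W(g,v)) / W(f,g) is square integrable at -oo as well. *)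
Lemma wronskian_lim0 la mu f df g dg l : rsol la f df -> rsol mu g dg -> L2left f -> L2left g ->
  (exists x, f x != 0) ->
  (forall v dv, rsol la v dv -> L2left v -> exists c, forall x, v x = c * f x) ->
  (forall x, f x * dg x - df x * g x =
     l + (la - mu) * Rintegral leb `]-oo, x] (fun s => f s * g s)) -> l = 0.
Proof.
move=> hf hg Lf Lg nzf un hl; apply/eqP/negP => /negP l0.
have [cf cdf] := rsol_cts hf; have [cg cdg] := rsol_cts hg.
have ifg a : leb.-integrable `]-oo, a] (EFin \o (fun s => f s * g s)).
  by apply: integrable_square_prod.
pose B x := f x * dg x - df x * g x.
have al : 0 < `|l| by rewrite normr_gt0.
have [X hX] : exists X : R, forall x, x <= X -> `|l| / 2 <= `|B x|.
  have k0 : 0 < `|l| / 2 / (`|la - mu| + 1).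
    by rewrite !divr_gt0// ltr_wpDl// normr_ge0.
  have [X [_ hX]] := Rintegral_ray_decay (ifg 0) k0; exists X => x /hX h.
  rewrite /B hl; set I := Rintegral _ _ _ in h *.
  have h1 : `|(la - mu) * I| <= `|l| / 2.
    rewrite normrM; apply: (@le_trans _ _ ((`|la - mu| + 1) * `|I|)).
      by apply: ler_wpM2r; [exact: normr_ge0|lra].
    by rewrite mulrC -ler_pdivlMr// ltr_wpDl// normr_ge0.
  have := ler_normB (l + (la - mu) * I) ((la - mu) * I); rewrite addrK; lra.
have [v [dv [hv W1]]] := ex_second_solution hf nzf.
have [cv cdv] := rsol_cts hv.
pose A x := g x * dv x - dg x * v x.
have vB x : v x * B x = g x - f x * A x.
  rewrite -[g x in RHS]mulr1 -(W1 x) /A /B; ring.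
have pA := wronskian_prim hg hv.
pose K := `|mu - la| * (2 / `|l|).
have K0 : 0 <= K by rewrite /K mulr_ge0 ?normr_ge0// divr_ge0// normr_ge0.
pose p x := K * (f x ^+ 2 + g x ^+ 2).
have csq (h : R -> R) : continuous h -> continuous (fun x => h x ^+ 2).
  by move=> ch x; apply: cvgM; exact: ch.
have cfg : continuous (fun x => f x ^+ 2 + g x ^+ 2).
  by move=> x; apply: cvgD; exact: csq.
have cp : continuous p by move=> x; apply: cvgM; [exact: cvg_cst|exact: cfg].
have p0 x : 0 <= p x by rewrite /p mulr_ge0// addr_ge0// sqr_ge0.
pose h x := 1 + `|A x|.
have cA : continuous A by exact: prim_cts pA.
have ch : continuous h by move=> x; apply: cvgD; [exact: cvg_cst|apply: cvg_norm; exact: cA].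
have vbound x : x <= X -> `|v x| <= 2 / `|l| * (`|g x| + `|f x| * `|A x|).
  move=> /hX hB.
  have : `|v x| * (`|l| / 2) <= `|g x| + `|f x| * `|A x|.
    apply: (@le_trans _ _ (`|v x| * `|B x|)); first exact: ler_wpM2l.
    by rewrite -normrM vB -normrM; exact: ler_normB.
  rewrite -ler_pdivlMr ?divr_gt0// => k; apply: (le_trans k).
  by rewrite invf_div mulrC.
(* The derivative of A = W(g, v) is bounded by p (1 + |A|), where p is integrable at -oo; Gronwall
   then bounds A on the whole ray. *)
have Abound x : x <= X -> `|(mu - la) * (g x * v x)| <= p x * h x.
  move=> xX; rewrite normrM /p /K -2!mulrA; apply: ler_wpM2l => //.
  rewrite normrM.
  have k1 := ler_wpM2l (normr_ge0 (g x)) (vbound x xX).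
  apply: (le_trans k1); rewrite mulrCA; apply: ler_wpM2l; first by rewrite divr_ge0.
  rewrite -(real_normK (num_real (f x))) -(real_normK (num_real (g x))) /h.
  have := normr_ge0 (A x); have := normr_ge0 (f x); have := normr_ge0 (g x).
  set a := `|A x|; set b := `|f x|; set c := `|g x| => c0 b0 a0.
  have : 0 <= a * (b - c) ^+ 2 by rewrite mulr_ge0// sqr_ge0.
  have : 0 <= a * (b ^+ 2 + c ^+ 2) by rewrite mulr_ge0// addr_ge0// sqr_ge0.
  have := sqr_ge0 b; have -> : c * (c + b * a) = c ^+ 2 + a * (b * c) by ring.
  have -> : a * (b - c) ^+ 2 = a * (b ^+ 2 + c ^+ 2) - 2 * (a * (b * c)) by ring.
  lra.
have [P [pP _]] := ex_prim 0 (cts_loc_int cp).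
have cph : continuous (fun x => p x * h x) by move=> x; apply: cvgM; [exact: cp|exact: ch].
have [T [pT _]] := ex_prim 0 (cts_loc_int cph).
have ifgs : leb.-integrable `]-oo, X] (EFin \o p).
  rewrite (_ : EFin \o p = (fun x => K%:E * ((f x ^+ 2)%:E + (g x ^+ 2)%:E))%E); last first.
    by apply/funext => x; rewrite /= -EFinD -EFinM.
  apply: integrableZl => //.
  exact: (@integrableD _ (measurableTypeR R) _ leb _ (measurable_itv _) _ _ (Lf X) (Lg X)).
pose Cp := Rintegral leb `]-oo, X] p.
have hbound x : x <= X -> h x <= h X * expR Cp.
  move=> xX.
  have k1 : h x <= h X * expR (P X - P x).
    apply: (gronwall_left pP pT) => // y /andP[xy yX].
    have := prim_norm_le pA pT yX (fun z hz => Abound z (proj2 (andP hz))).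
    have := ler_normB (A X) (A X - A y); rewrite subKr /h; lra.
  apply: (le_trans k1); apply: ler_wpM2l; first by rewrite /h addr_ge0.
  rewrite ler_expR (pP.2 _ _ xX).
  apply: Rintegral_ge0_subset => //.
  by move=> y /=; rewrite !in_itv/= => /andP[].
have [c hc] : exists c, forall x, v x = c * f x.
  apply: (un v dv hv); apply: (@integrable_ray_extend _ _ X); [exact: csq|by move=> x; exact: sqr_ge0|].
  pose C := h X * expR Cp.
  pose C2 := 2 * (2 / `|l|) ^+ 2 * (1 + C ^+ 2).
  have C20 : 0 <= C2 by rewrite /C2; apply: mulr_ge0; [apply: mulr_ge0; rewrite ?sqr_ge0|rewrite addr_ge0// sqr_ge0].
  apply: (@le_integrable _ (measurableTypeR R) _ leb _ _ _ (fun x => C2%:E * ((f x ^+ 2)%:E + (g x ^+ 2)%:E))%E).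
  - exact: measurable_itv.
  - apply/measurable_realfun.measurable_EFinP; apply: measurable_funTS.
    by apply: measurable_realfun.continuous_measurable_fun; exact: csq.
  - move=> x /=; rewrite in_itv/= => xX; rewrite -?EFinD -?EFinM ?abse_EFin lee_fin.
    rewrite !ger0_norm ?sqr_ge0//; last first.
      by apply: mulr_ge0; [exact: C20|rewrite addr_ge0// sqr_ge0].
    have := hbound x xX; rewrite -/C => hC.
    have h0 : `|v x| <= 2 / `|l| * (`|g x| + `|f x| * C).
      apply: (le_trans (vbound x xX)); apply: ler_wpM2l; first by rewrite divr_ge0.
      rewrite lerD2l; apply: ler_wpM2l => //; rewrite /h in hC; lra.
    have h1 : `|v x| ^+ 2 <= (2 / `|l| * (`|g x| + `|f x| * C)) ^+ 2.
      by rewrite ler_pXn2r// nnegrE//; exact: le_trans h0.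
    rewrite real_normK ?num_real// in h1; apply: (le_trans h1).
    rewrite exprMn /C2 -(real_normK (num_real (f x))) -(real_normK (num_real (g x))).
    set t0 := (2 / `|l|) ^+ 2; set u := `|g x|; set t := `|f x|.
    have -> : 2 * t0 * (1 + C ^+ 2) * (t ^+ 2 + u ^+ 2) = t0 * (2 * (1 + C ^+ 2) * (t ^+ 2 + u ^+ 2)) by ring.
    apply: ler_wpM2l; first exact: sqr_ge0.
    have := sqr_ge0 (u - t * C); have := sqr_ge0 (u * C); have := sqr_ge0 t.
    have -> : 2 * (1 + C ^+ 2) * (t ^+ 2 + u ^+ 2) =
      (u + t * C) ^+ 2 + ((u - t * C) ^+ 2 + 2 * (u * C) ^+ 2 + 2 * t ^+ 2) by ring.
    lra.
  apply: integrableZl => //.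
  exact: (@integrableD _ (measurableTypeR R) _ leb _ (measurable_itv _) _ _ (Lf X) (Lg X)).
(* With v = c f also v' = c f', so W(f, v) = 0, whereas it equals 1. *)
have dvc x : dv x - c * df x = 0.
  have pz := primB hv.1 (primZ c hf.1).
  apply: (prim_zero pz).
    by move=> y; apply: cvgB; [exact: cdv|apply: cvgM; [exact: cvg_cst|exact: cdf]].
  by move=> y; rewrite hc subrr.
have := W1 0; rewrite hc; have /eqP := dvc 0; rewrite subr_eq0 => /eqP ->.
move=> /eqP; rewrite (_ : _ - _ = 0); last by ring.
by rewrite eq_sym oner_eq0.
Qed.

End RealSolutions.

(** * Differentiation of matrices *)

Section MatrixPrim.
Variable R : realType.

Definition mprim m n (M M' : R -> 'M[R]_(m, n)) : Prop :=
  forall i j, prim (fun x => M x i j) (fun x => M' x i j).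

Lemma mprim_ext m n (M M' P P' : R -> 'M[R]_(m, n)) : mprim M M' ->
  (forall x, M x = P x) -> (forall x, M' x = P' x) -> mprim P P'.
Proof. by move=> h e e' i j; apply: prim_ext (h i j) _ _ => x; rewrite ?e ?e'. Qed.

Lemma mprimM m n p (M M' : R -> 'M[R]_(m, n)) (P P' : R -> 'M[R]_(n, p)) :
  mprim M M' -> mprim P P' -> mprim (fun x => M x *m P x) (fun x => M' x *m P x + M x *m P' x).
Proof.
move=> hM hP i j.
apply: prim_ext (prim_sum (index_enum _) predT (fun k => primM (hM i k) (hP k j))) _ _ => x.
  by rewrite mxE.
by rewrite !mxE big_split.
Qed.

Lemma mprimD m n (M M' P P' : R -> 'M[R]_(m, n)) : mprim M M' -> mprim P P' ->
  mprim (fun x => M x + P x) (fun x => M' x + P' x).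
Proof. by move=> hM hP i j; apply: prim_ext (primD (hM i j) (hP i j)) _ _ => x; rewrite !mxE. Qed.

Lemma mprimN m n (M M' : R -> 'M[R]_(m, n)) : mprim M M' -> mprim (fun x => - M x) (fun x => - M' x).
Proof. by move=> hM i j; apply: prim_ext (primN (hM i j)) _ _ => x; rewrite !mxE. Qed.

Lemma mprim_cst m n (M : 'M[R]_(m, n)) : mprim (fun=> M) (fun=> 0).
Proof. by move=> i j; apply: prim_ext (prim_cst (M i j)) _ _ => x //; rewrite mxE. Qed.

Lemma mprimT m n (M M' : R -> 'M[R]_(m, n)) : mprim M M' -> mprim (fun x => (M x)^T) (fun x => (M' x)^T).
Proof. by move=> hM i j; apply: prim_ext (hM j i) _ _ => x; rewrite mxE. Qed.

Lemma mprimZ m n (c c' : R -> R) (M M' : R -> 'M[R]_(m, n)) : prim c c' -> mprim M M' ->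
  mprim (fun x => c x *: M x) (fun x => c' x *: M x + c x *: M' x).
Proof. by move=> hc hM i j; apply: prim_ext (primM hc (hM i j)) _ _ => x; rewrite !mxE. Qed.

Lemma prim_prod (I : finType) (r : seq I) (u f : I -> R -> R) : uniq r ->
  (forall i, prim (u i) (f i)) ->
  prim (fun x => \prod_(i <- r) u i x)
       (fun x => \sum_(i <- r) \prod_(k <- r) (if k == i then f k x else u k x)).
Proof.
move=> + hu; elim: r => [_|a r IH /= /andP[ar ur]].
  by apply: prim_ext (prim_cst 1) _ _ => x; rewrite big_nil.
apply: prim_ext (primM (hu a) (IH ur)) _ _ => x; rewrite ?big_cons//.
rewrite eqxx; congr (_ * _ + _).
  by apply: eq_big_seq => k kr; rewrite ifF//; apply/negbTE; apply: contraNneq ar => <-.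
rewrite big_distrr/=; apply: eq_big_seq => i ir; rewrite big_cons ifF//.
by apply/negbTE; apply: contraNneq ar => ->.
Qed.

(** Jacobi's formula. The Leibniz sum is differentiated row by row; each term is the determinant
    with row i replaced by its derivative, expanded along that row. *)
Lemma prim_det n (M M' : R -> 'M[R]_n) : mprim M M' ->
  prim (fun x => \det (M x)) (fun x => \tr (M' x *m \adj (M x))).
Proof.
move=> hM.
have hp (s : {perm 'I_n}) := primZ ((-1) ^+ s) (prim_prod (index_enum_uniq _) (fun i => hM i (s i))).
apply: prim_ext (prim_sum (index_enum _) predT hp) _ _ => x; first by [].
under eq_bigr do rewrite big_distrr /=.
rewrite exchange_big/= /mxtrace; apply: eq_bigr => i _.
pose Mi := \matrix_(k, l) (if k == i then M' x k l else M x k l).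
transitivity (\det Mi).
  apply: eq_bigr => s _; congr (_ * _); apply: eq_bigr => k _; by rewrite mxE.
rewrite (expand_det_row _ i) mxE; apply: eq_bigr => j _.
rewrite !mxE eqxx; congr (_ * _); rewrite /cofactor; congr (_ * \det _).
by apply/matrixP => k l; rewrite !mxE ifF// eq_sym (negPf (neq_lift _ _)).
Qed.

(** A continuous density gives classical differentiability, which the rule for 1 / u requires. *)
Definition C1f (u : R -> R) := exists2 f, prim u f & continuous f.

Lemma C1f_ext u w : C1f u -> (forall x, u x = w x) -> C1f w.
Proof. by move=> [f hf cf] e; exists f => //; apply: prim_ext hf e _. Qed.

Lemma C1fM u w : C1f u -> C1f w -> C1f (fun x => u x * w x).
Proof.
move=> [f hf cf] [g hg cg]; exists (fun x => f x * w x + u x * g x); first exact: primM.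
by move=> x; apply: cvgD; apply: cvgM;
  [exact: cf|exact: prim_cts hg x|exact: prim_cts hf x|exact: cg].
Qed.

Lemma cts_sum (I : finType) (u : I -> R -> R) : (forall i, continuous (u i)) ->
  continuous (fun x => \sum_i u i x).
Proof.
move=> h; elim: (index_enum I) => [|a r IH].
  by under eq_fun do rewrite big_nil; move=> x; exact: cvg_cst.
by under eq_fun do rewrite big_cons; move=> x; apply: cvgD; [exact: h|exact: IH].
Qed.

(** Entries of the adjugate are signed minors, hence primitives by [prim_det], hence continuous. *)
Lemma cts_det_derivative n (M M' : R -> 'M[R]_n) : mprim M M' ->
  (forall i j, continuous (fun x => M' x i j)) -> continuous (fun x => \tr (M' x *m \adj (M x))).
Proof.
move=> hM cM.
have cadj i j : continuous (fun x => \adj (M x) i j).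
  have hm : mprim (fun x => row' j (col' i (M x))) (fun x => row' j (col' i (M' x))).
    by move=> k l; apply: prim_ext (hM (lift j k) (lift i l)) _ _ => x; rewrite !mxE.
  apply: (@prim_cts _ _ (fun x => (-1) ^+ (j + i) * \tr (row' j (col' i (M' x)) *m \adj (row' j (col' i (M x)))))).
  by apply: prim_ext (primZ ((-1) ^+ (j + i)) (prim_det hm)) _ _ => x //; rewrite !mxE.
apply: cts_sum => i.
rewrite (_ : (fun x => _) = (fun x => \sum_j M' x i j * \adj (M x) j i)); last first.
  by apply/funext => x; rewrite mxE.
by apply: cts_sum => j x; apply: cvgM; [exact: cM|exact: cadj].
Qed.

Lemma C1f_det n (M M' : R -> 'M[R]_n) : mprim M M' -> (forall i j, continuous (fun x => M' x i j)) ->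
  C1f (fun x => \det (M x)).
Proof. by move=> hM cM; eexists; [exact: prim_det hM|exact: cts_det_derivative]. Qed.

Lemma C1f_inv u : C1f u -> (forall x, u x != 0) -> C1f (fun x => (u x)^-1).
Proof.
move=> [f hf cf] u0.
have cu := prim_cts hf.
have cd : continuous (fun x => - (u x) ^- 2 * f x).
  move=> x; apply: cvgM; last exact: cf.
  apply: cvgN; apply: cvgV; first by rewrite expf_neq0.
  by apply: cvgM; exact: cu.
exists (fun x => - (u x) ^- 2 * f x) => //.
apply: prim_FTC => // y; have hd := prim_is_derive hf (cf y).
by have := is_deriveV (u0 y) hd.
Qed.

(** Cramer's formula shows that the inverse has some continuous density A'. Its value follows by
    differentiating the product of the inverse with M, which is constant; continuity makes the
    resulting identity hold at every point. *)
Lemma mprim_invmx n (M M' : R -> 'M[R]_n) : mprim M M' -> (forall i j, continuous (fun x => M' x i j)) ->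
  (forall x, M x \in unitmx) ->
  mprim (fun x => invmx (M x)) (fun x => - (invmx (M x) *m M' x *m invmx (M x))).
Proof.
move=> hM cM uM.
have d0 x : \det (M x) != 0 by rewrite -unitfE -unitmxE.
have hA i j : C1f (fun x => invmx (M x) i j).
  have hm : mprim (fun x => row' j (col' i (M x))) (fun x => row' j (col' i (M' x))).
    by move=> k l; apply: prim_ext (hM (lift j k) (lift i l)) _ _ => x; rewrite !mxE.
  have cm k l : continuous (fun x => row' j (col' i (M' x)) k l).
    rewrite (_ : (fun x => _) = (fun x => M' x (lift j k) (lift i l))); first exact: cM.
    by apply/funext => x; rewrite !mxE.
  have h1 := C1fM (C1f_inv (C1f_det hM cM) d0) (C1f_det hm cm).
  have hc : C1f (fun=> (-1) ^+ (j + i) : R).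
    by exists (fun=> 0); [exact: prim_cst|move=> x; exact: cvg_cst].
  apply: C1f_ext (C1fM h1 hc) _ => x.
  by rewrite /invmx uM !mxE /cofactor -mulrA; congr (_ * _); rewrite mulrC.
have /choice [F hF] : forall ij : 'I_n * 'I_n, exists f,
    prim (fun x => invmx (M x) ij.1 ij.2) f /\ continuous f.
  by move=> [i j]; have [f h1 h2] := hA i j; exists f.
pose A' x := \matrix_(i, j) F (i, j) x.
have pA : mprim (fun x => invmx (M x)) A'.
  by move=> i j; apply: prim_ext (proj1 (hF (i, j))) _ _ => x //; rewrite mxE.
have pAM := mprimM pA hM.
have cA i j : continuous (fun x => invmx (M x) i j) by exact: prim_cts (pA i j).
have cMM i j : continuous (fun x => M x i j) by exact: prim_cts (hM i j).
have zero x : A' x *m M x + invmx (M x) *m M' x = 0.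
  apply/matrixP => i j; rewrite [RHS]mxE.
  have p0 : prim (fun=> 0) (fun x => (A' x *m M x + invmx (M x) *m M' x) i j).
    apply: prim_ext (primB (pAM i j) (prim_cst ((1%:M : 'M[R]_n) i j))) _ _ => y.
      by rewrite mulVmx// subrr.
    by rewrite subr0.
  apply: (prim_zero p0) => //.
  rewrite (_ : (fun x => _) = (fun x => \sum_k (F (i, k) x * M x k j + invmx (M x) i k * M' x k j))).
    by apply: cts_sum => k y; apply: cvgD; apply: cvgM;
       [exact: (proj2 (hF _))|exact: cMM|exact: cA|exact: cM].
  apply/funext => y; rewrite !mxE -big_split/=; apply: eq_bigr => k _; by rewrite mxE.
apply: mprim_ext pA _ _ => // x.
by rewrite -[LHS](mulmxK (uM x)); have /eqP := zero x; rewrite addr_eq0 => /eqP ->; rewrite mulNmx.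
Qed.

End MatrixPrim.

(** * The Darboux transformation *)

Section FiniteFamilies.
Variables (R : realType) (I : finType).

Lemma fin_lower_bound (f : I -> R) : (forall i, 0 < f i) -> exists2 c, 0 < c & forall i, c <= f i.
Proof.
move=> f0; exists (1 + \sum_i (f i)^-1)^-1.
  by rewrite invr_gt0 ltr_pwDl// sumr_ge0// => i _; rewrite invr_ge0 ltW.
move=> i; rewrite -[leRHS]invrK lef_pV2 ?posrE ?invr_gt0//.
  rewrite (bigD1 i)//= addrCA lerDl addr_ge0// sumr_ge0// => j _; rewrite invr_ge0 ltW//.
by rewrite ltr_pwDl// sumr_ge0// => j _; rewrite invr_ge0 ltW.
Qed.

Lemma fin_upper_bound (f : I -> R) : exists2 c, 0 < c & forall i, f i <= c.
Proof.
exists (1 + \sum_i `|f i|); first by rewrite ltr_pwDl// sumr_ge0.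
move=> i; rewrite (bigD1 i)//= addrCA; apply: (le_trans (ler_norm _)).
by rewrite lerDl addr_ge0// sumr_ge0.
Qed.

Lemma fin_eventually_left (P : I -> R -> Prop) : (forall i, exists X, forall x, x <= X -> P i x) ->
  exists X, forall x, x <= X -> forall i, P i x.
Proof.
move=> /choice [X hX]; have [c _ hc] := fin_upper_bound (fun i => - X i).
by exists (- c) => x xc i; apply: hX; have := hc i; lra.
Qed.

Lemma fin_eventually_right (P : I -> R -> Prop) : (forall i, exists X, forall x, X <= x -> P i x) ->
  exists X, forall x, X <= x -> forall i, P i x.
Proof.
move=> /choice [X hX]; have [c _ hc] := fin_upper_bound X.
by exists c => x xc i; apply: hX; have := hc i; lra.
Qed.

End FiniteFamilies.

Section Darboux.
Variables (R : realType) (q : R -> R).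
Local Notation leb := (@lebesgue_measure R).
Variables (N : nat) (la : 'I_N -> R) (v dv : 'I_N -> R -> R).
Hypothesis hv : forall n, rsol q (la n) (v n) (dv n).
Hypothesis Lv : forall n, L2left (v n).

Definition gram x : 'M[R]_N :=
  \matrix_(m, n) Rintegral leb `]-oo, x] (fun s => v m s * v n s).

Hypothesis hW : forall m n x, v m x * dv n x - dv m x * v n x = (la m - la n) * gram x m n.

Local Notation G := gram.
Definition Vx x : 'rV[R]_N := \row_n v n x.
Definition dVx x : 'rV[R]_N := \row_n dv n x.
Definition Bx x : 'M[R]_N := 1%:M + G x.
Definition Ax x : 'M[R]_N := invmx (Bx x).
(** When [v] carries the weights alpha_n, this row is - y. *)
Definition Wx x : 'rV[R]_N := Vx x *m Ax x.
Definition Px x : 'rV[R]_N := dVx x *m Ax x.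
(** The logarithmic derivative of det B, by [log_det_derive]; its own derivative is 2 sigma -
    tau^2. *)
Definition taux x : R := (Wx x *m (Vx x)^T) 0 0.
Definition sigmax x : R := (Px x *m (Vx x)^T) 0 0.
Local Notation V := Vx. Local Notation dV := dVx. Local Notation B := Bx.
Local Notation A := Ax. Local Notation W := Wx. Local Notation P := Px.
Local Notation tau := taux. Local Notation sigma := sigmax.
Local Notation L := (diag_mx (\row_n la n)).

Let cv n : continuous (v n). Proof. exact: (proj1 (rsol_cts (hv n))). Qed.
Let cvv m n : continuous (fun s => v m s * v n s).
Proof. by move=> x; apply: cvgM; exact: cv. Qed.
Let ivv m n a : leb.-integrable `]-oo, a] (EFin \o (fun s => v m s * v n s)).
Proof. by apply: integrable_square_prod => //; [exact: Lv|exact: Lv]. Qed.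

Lemma mprim_V : mprim V dV.
Proof. by move=> i n; apply: prim_ext (proj1 (hv n)) _ _ => x; rewrite mxE. Qed.

Lemma mprim_dV : mprim dV (fun x => q x *: V x - V x *m L).
Proof.
move=> i n; apply: prim_ext (proj2 (hv n)) _ _ => x; first by rewrite mxE.
rewrite [in RHS]mxE [in X in _ = _ + X]mxE mul_mx_diag !mxE; ring.
Qed.

Lemma mprim_gram : mprim G (fun x => (V x)^T *m V x).
Proof.
move=> m n; apply: prim_ext (prim_ray (@cvv m n) (ivv m n)) _ _ => x; rewrite !mxE//.
by rewrite big_ord1 !mxE.
Qed.

Lemma gram_sym x : (G x)^T = G x.
Proof. by apply/matrixP => m n; rewrite !mxE; apply: eq_Rintegral => s _; rewrite mulrC. Qed.

Lemma gram_decay (e : R) : 0 < e -> exists X, forall x, x <= X -> forall m n, `|G x m n| <= e.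
Proof.
move=> e0.
have [X hX] : exists X, forall x, x <= X -> forall mn : 'I_N * 'I_N, `|G x mn.1 mn.2| <= e.
  apply: fin_eventually_left => -[m n].
  have [X [_ hX]] := Rintegral_ray_decay (ivv m n 0) e0.
  by exists X => x /hX; rewrite mxE.
by exists X => x /hX h m n; exact: (h (m, n)).
Qed.

Lemma gram_quad_prim (c : 'rV[R]_N) :
  prim (fun x => (c *m G x *m c^T) 0 0) (fun x => ((V x *m c^T) 0 0) ^+ 2).
Proof.
have h := mprimM (mprimM (mprim_cst c) mprim_gram) (mprim_cst c^T).
apply: prim_ext (h 0 0) _ _ => // x.
rewrite mul0mx add0r mulmx0 addr0 mulmxA -mulmxA -(trmxK (V x)) -trmx_mul trmxK mxE big_ord1.
by move: (c *m (V x)^T) => u; rewrite !mxE expr2.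
Qed.

(** The quadratic form has the derivative (V c^T)^2 >= 0 in x and tends to 0 at -oo. *)
Lemma gram_psd x (c : 'rV[R]_N) : 0 <= (c *m G x *m c^T) 0 0.
Proof.
apply/ler_addgt0Pr => e e0.
pose K := 1 + \sum_n \sum_m `|c 0 m * c 0 n|.
have K0 : 0 < K by rewrite ltr_pwDl// sumr_ge0// => n _; rewrite sumr_ge0.
have [X hX] := gram_decay (divr_gt0 e0 K0).
pose y := Num.min X x.
have yX : y <= X by rewrite ge_min lexx.
have yx : y <= x by rewrite ge_min lexx orbT.
have h1 := prim_le (gram_quad_prim c) yx (fun t _ => sqr_ge0 _).
suff : `|(c *m G y *m c^T) 0 0| <= e by rewrite ler_norml => /andP[]; lra.
rewrite mxE; under eq_bigr do rewrite mxE big_distrl/=.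
apply: (le_trans (ler_norm_sum _ _ _)).
apply: (@le_trans _ _ (\sum_n \sum_m `|c 0 m * c 0 n| * (e / K))).
  apply: ler_sum => n _; apply: (le_trans (ler_norm_sum _ _ _)); apply: ler_sum => m _.
  rewrite [c^T n 0]mxE mulrAC normrM; apply: ler_wpM2l => //; exact: hX.
under eq_bigr do rewrite -mulr_suml.
rewrite -mulr_suml mulrCA ger_pMr// ler_pdivrMr// mul1r /K; lra.
Qed.

Lemma unitmx_add_psd (M : 'M[R]_N) : (forall c : 'rV[R]_N, 0 <= (c *m M *m c^T) 0 0) ->
  1%:M + M \in unitmx.
Proof.
move=> psd; rewrite unitmxE unitfE; apply/negP => /det0P [c c0 hc].
have : (c *m (1%:M + M) *m c^T) 0 0 = 0 by rewrite hc mul0mx mxE.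
rewrite mulmxDr mulmx1 mulmxDl mxE => h.
have := psd c; have : 0 < (c *m c^T) 0 0; last by lra.
have [i ci] : exists i, c 0 i != 0.
  apply: contrapT => H; move/eqP: c0; apply; apply/rowP => i; rewrite mxE.
  by apply/eqP/negPn/negP => ci; apply: H; exists i.
rewrite mxE (bigD1 i)//= mxE ltr_pwDl//.
  by rewrite -expr2 lt_neqAle eq_sym sqrf_eq0 ci sqr_ge0.
by apply: sumr_ge0 => j _; rewrite mxE -expr2 sqr_ge0.
Qed.

Lemma unit_B x : B x \in unitmx.
Proof. by apply: unitmx_add_psd => c; exact: gram_psd. Qed.

Lemma A_sym x : (A x)^T = A x.
Proof. by rewrite /Ax trmx_inv /Bx linearD/= trmx1 gram_sym. Qed.

Lemma mprim_B : mprim B (fun x => (V x)^T *m V x).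
Proof.
by apply: mprim_ext (mprimD (mprim_cst 1%:M) mprim_gram) _ _ => x //; rewrite add0r.
Qed.

Let cB' i j : continuous (fun x => ((V x)^T *m V x) i j).
Proof.
rewrite (_ : (fun x => _) = (fun x => v i x * v j x)); first exact: cvv.
by apply/funext => x; rewrite !mxE big_ord1 !mxE.
Qed.

Lemma W_tr x : (W x)^T = A x *m (V x)^T.
Proof. by rewrite /Wx trmx_mul A_sym. Qed.

Lemma P_tr x : (P x)^T = A x *m (dV x)^T.
Proof. by rewrite /Px trmx_mul A_sym. Qed.

Lemma mprim_A : mprim A (fun x => - ((W x)^T *m W x)).
Proof.
apply: mprim_ext (mprim_invmx mprim_B cB' unit_B) _ _ => x //.
by rewrite W_tr /Wx !mulmxA.
Qed.

Lemma V_W x : V x *m (W x)^T = (tau x)%:M.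
Proof.
have -> : V x *m (W x)^T = (W x *m (V x)^T)^T by rewrite [RHS]trmx_mul trmxK.
by rewrite [W x *m _]mx11_scalar tr_scalar_mx.
Qed.

Lemma dV_W x : dV x *m (W x)^T = (sigma x)%:M.
Proof. by rewrite [LHS]mx11_scalar /sigmax W_tr mulmxA. Qed.

Lemma V_P x : V x *m (P x)^T = (sigma x)%:M.
Proof. by rewrite P_tr mulmxA -[_ *m A x]trmxK W_tr -trmx_mul -W_tr -[RHS]tr_scalar_mx -dV_W trmx_mul trmxK. Qed.

Lemma W_dV x : W x *m (dV x)^T = (sigma x)%:M.
Proof. by rewrite -[W x]trmxK -trmx_mul dV_W tr_scalar_mx. Qed.

Lemma mprim_W : mprim W (fun x => P x - tau x *: W x).
Proof.
apply: mprim_ext (mprimM mprim_V mprim_A) _ _ => x //.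
by rewrite mulmxN mulmxA V_W mul_scalar_mx.
Qed.

Lemma mprim_P : mprim P (fun x => q x *: W x - V x *m L *m A x - sigma x *: W x).
Proof.
apply: mprim_ext (mprimM mprim_dV mprim_A) _ _ => x //.
by rewrite mulmxN mulmxA dV_W mul_scalar_mx mulmxBl -scalemxAl.
Qed.

Lemma prim_tau : prim tau (fun x => 2 * sigma x - tau x ^+ 2).
Proof.
apply: prim_ext (mprimM mprim_W (mprimT mprim_V) 0 0) _ _ => x //.
rewrite mulmxBl -scalemxAl W_dV [P x *m _]mx11_scalar [W x *m _]mx11_scalar.
rewrite -/(sigmax x) -/(taux x) !mxE eqxx !mulr1n; ring.
Qed.

(** The Wronskian relation [hW] computes the commutator of L with G, hence with B = 1 + G;
    multiplying by A on both sides turns it into one with A. *)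
Lemma A_commutator x : A x *m L - L *m A x = (W x)^T *m P x - (P x)^T *m W x.
Proof.
have hLG : L *m G x - G x *m L = (V x)^T *m dV x - (dV x)^T *m V x.
  rewrite mul_diag_mx mul_mx_diag; apply/matrixP => m n.
  have := hW m n x; rewrite !mxE !big_ord1 !mxE => ->; ring.
have hLB : L *m B x - B x *m L = (V x)^T *m dV x - (dV x)^T *m V x.
  by rewrite -hLG /Bx mulmxDr mulmxDl mulmx1 mul1mx opprD addrACA subrr add0r.
transitivity (A x *m (L *m B x - B x *m L) *m A x).
  rewrite mulmxBr mulmxBl !mulmxA -(mulmxA _ (B x) (A x)) mulmxV ?unit_B// mulmx1.
  by rewrite mulVmx ?unit_B// mul1mx.
by rewrite hLB mulmxBr mulmxBl W_tr P_tr /Wx /Px !mulmxA.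
Qed.

(** The only term not yet expressed by W and P is V L A. Multiplying [A_commutator] by V on the left
    replaces it by W L and multiples of P and W; the P terms then cancel and the potential changes
    by - 2 tau'. *)
Lemma mprim_dW : mprim (fun x => P x - tau x *: W x)
  (fun x => (q x - 2 * (2 * sigma x - tau x ^+ 2)) *: W x - W x *m L).
Proof.
apply: mprim_ext (mprimD mprim_P (mprimN (mprimZ prim_tau mprim_W))) _ _ => x //.
have h : V x *m L *m A x = W x *m L - (tau x *: P x - sigma x *: W x).
  have := congr1 (fun M => V x *m M) (A_commutator x).
  rewrite !mulmxBr (mulmxA _ (A x) L) (mulmxA _ L (A x)) (mulmxA _ (W x)^T (P x)).
  rewrite (mulmxA _ (P x)^T (W x)) V_W V_P !mul_scalar_mx -/(Wx x) => <-.
  by rewrite subKr.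
rewrite h; apply/rowP => i; rewrite !mxE; ring.
Qed.

(* det (1 + t G) does not vanish for t in [0, 1] and equals 1 at t = 0. *)
Lemma det_B_gt0 x : 0 < \det (B x).
Proof.
pose M t := 1%:M + t *: G x.
have pM : mprim M (fun=> G x).
  apply: mprim_ext (mprimD (mprim_cst 1%:M) (mprimZ (@prim_id R) (mprim_cst (G x)))) _ _ => t //.
  by rewrite add0r scale1r scaler0 addr0.
have cd : continuous (fun t => \det (M t)) by exact: prim_cts (prim_det pM).
rewrite ltNge; apply/negP => d1.
have d0 : \det (M 0) = 1 by rewrite /M scale0r addr0 det1.
have M1 : \det (M 1) = \det (B x) by rewrite /M scale1r.
have [] := @IVT R (fun t => \det (M t)) 0 1 0 ler01.
- exact: continuous_subspaceT.
- by rewrite d0 M1 ge_min le_max d1 ler01 orbT.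
move=> t; rewrite in_itv/= => /andP[t0 t1] dt.
have : M t \in unitmx.
  apply: unitmx_add_psd => c; rewrite -scalemxAr -scalemxAl mxE; apply: mulr_ge0 => //.
  exact: gram_psd.
by rewrite unitmxE dt unitr0.
Qed.

(** Jacobi's formula with adj B = det B * A, and the trace of V^T V A is V A V^T by cyclicity. *)
Lemma log_det_derive (x : R) : is_derive x 1 (fun t : R => ln (\det (B t))) (tau x).
Proof.
have hd : is_derive x 1 (fun x => \det (B x)) (\tr ((V x)^T *m V x *m \adj (B x))).
  by apply: (prim_is_derive (prim_det mprim_B)); exact: cts_det_derivative mprim_B cB' x.
have hl := is_derive1_ln (det_B_gt0 x).
have e : (\det (B x))^-1 * \tr ((V x)^T *m V x *m \adj (B x)) = tau x.
  have d0 : \det (B x) != 0 by rewrite gt_eqF// det_B_gt0.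
  have eA : \adj (B x) = \det (B x) *: A x.
    by rewrite /Ax /invmx unit_B scalerA divff// scale1r.
  rewrite eA -scalemxAr linearZ/= mulKf// -mulmxA mxtrace_mulC -/(Wx x).
  by rewrite [_ *m _]mx11_scalar mxtrace_scalar.
have := is_derive1_comp hl hd.
by rewrite e.
Qed.

Lemma log_det_derivable :
  let F := fun x => ln (\det (B x)) in
  (forall x, derivable F x 1 /\ derivable (derive1 F) x 1) /\
  (forall x, derive1 (derive1 F) x = 2 * sigma x - tau x ^+ 2).
Proof.
move=> F.
have csig : continuous sigma.
  rewrite /sigmax; have := prim_cts (mprimM mprim_P (mprimT mprim_V) 0 0); exact.
have ctau : continuous tau by exact: prim_cts prim_tau.
have c2 : continuous (fun x => 2 * sigma x - tau x ^+ 2).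
  move=> x; apply: cvgB; [apply: cvgM; [exact: cvg_cst|exact: csig]|].
  by apply: cvgM; exact: ctau.
have dF : derive1 F = tau.
  apply/funext => x; rewrite derive1E.
  exact: (@derive_val _ _ _ _ _ _ _ (log_det_derive x)).
have d2 (x : R) : is_derive x 1 tau (2 * sigma x - tau x ^+ 2).
  exact: (prim_is_derive prim_tau (c2 x)).
split=> x; last by rewrite dF derive1E (@derive_val _ _ _ _ _ _ _ (d2 x)).
by rewrite dF; split; [exact: (@ex_derive _ _ _ _ _ _ _ (log_det_derive x))|exact: (@ex_derive _ _ _ _ _ _ _ (d2 x))].
Qed.

Lemma A_quad x : A x = A x *m B x *m (A x)^T.
Proof. by rewrite A_sym /Ax mulVmx ?unit_B// mul1mx. Qed.

Lemma A_diag x n : A x n n = \sum_k (A x n k) ^+ 2 + (row n (A x) *m G x *m (row n (A x))^T) 0 0.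
Proof.
have e : A x n n = (row n (A x) *m B x *m (row n (A x))^T) 0 0.
  rewrite [in LHS]A_quad -row_mul mxE [RHS]mxE; apply: eq_bigr => k _.
  by rewrite [row n _ 0 k]mxE; congr (_ * _); rewrite !mxE.
rewrite {1}e /Bx mulmxDr mulmx1 mulmxDl mxE; congr (_ + _).
by rewrite mxE; apply: eq_bigr => k _; rewrite !mxE expr2.
Qed.

(** By [A_diag] the row n of A has squared norm at most A_nn. In particular A_nn^2 <= A_nn, so A_nn
    <= 1, which then bounds the whole row. *)
Lemma A_bounds x n m : `|A x n m| <= 1.
Proof.
have h := A_diag x n; have := gram_psd x (row n (A x)).
have hs k : A x n k ^+ 2 <= \sum_k (A x n k) ^+ 2.
  by rewrite [leRHS](bigD1 k)//= lerDl sumr_ge0// => j _; exact: sqr_ge0.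
move=> g0; have := hs n; have := hs m; set S := \sum_k _ in h hs *.
move=> h1 h2; have a1 : A x n n <= 1.
  rewrite leNgt; apply/negP => a; have : A x n n * 1 < A x n n * A x n n by rewrite ltr_pM2l//; lra.
  move=> h3; rewrite expr2 in h2; lra.
have : `|A x n m| ^+ 2 <= 1 by rewrite real_normK ?num_real//; lra.
by rewrite -[leRHS](expr1n _ 2) ler_pXn2r ?nnegrE.
Qed.

Lemma A_diag_ge0 x n : 0 <= A x n n.
Proof.
rewrite A_diag addr_ge0 ?gram_psd// sumr_ge0// => k _; exact: sqr_ge0.
Qed.

Lemma prim_A m n : prim (fun x => A x m n) (fun x => - (W x 0 m * W x 0 n)).
Proof. by apply: prim_ext (mprim_A m n) _ _ => x //; rewrite !mxE big_ord1 !mxE. Qed.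

(** A - 1 = - A G, where A is bounded and G tends to 0 at -oo. *)
Lemma A_at_left (e : R) : 0 < e -> exists X, forall x, x <= X -> forall m n, `|A x m n - (m == n)%:R| <= e.
Proof.
move=> e0; have N0 : 0 < N%:R + 1 :> R by rewrite ltr_wpDl.
have [X hX] := gram_decay (divr_gt0 e0 N0); exists X => x /hX h m n.
have e1 : A x - 1%:M = - (A x *m G x).
  rewrite -[1%:M](mulVmx (unit_B x)) -/(Ax x) -{1}(mulmx1 (A x)) -mulmxBr /Bx opprD addrA subrr sub0r.
  by rewrite mulmxN.
have -> : A x m n - (m == n)%:R = (A x - 1%:M) m n by rewrite [RHS]mxE [in RHS]mxE [X in _ = _ - X]mxE.
rewrite e1 mxE normrN mxE; apply: (le_trans (ler_norm_sum _ _ _)).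
apply: (@le_trans _ _ (\sum_(k < N) (e / (N%:R + 1)))).
  apply: ler_sum => k _; rewrite normrM -[leRHS]mul1r; apply: ler_pM => //.
  exact: A_bounds.
have -> : \sum_(k < N) (e / (N%:R + 1)) = e * (N%:R / (N%:R + 1)).
  by rewrite sumr_const card_ord -[LHS]mulr_natr mulrAC mulrA.
by rewrite ger_pMr// ler_pdivrMr// mul1r; lra.
Qed.

Lemma W_L2 n : L2 (fun x => - W x 0 n).
Proof.
have cW : continuous (fun x => W x 0 n) by exact: prim_cts (mprim_W 0 n).
apply: (@integrable_line _ _ 1) => //.
- by move=> x; apply: cvgM; apply: cvgN; exact: cW.
- by move=> x; exact: sqr_ge0.
move=> k; have kk : - k%:R <= k%:R :> R by have : 0 <= k%:R :> R by []; lra.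
have -> : (fun x => (- W x 0 n) ^+ 2) = (fun x => - - (W x 0 n * W x 0 n)).
  by apply/funext => x; rewrite opprK sqrrN expr2.
rewrite -((primN (prim_A n n)).2 _ _ kk).
have := A_bounds (- k%:R) n n; have := A_diag_ge0 k%:R n; rewrite ler_norml => a /andP[_ b]; lra.
Qed.

(** If W_n vanished identically, column n of A would be constant, hence equal to its limit at -oo,
    the unit column. Then G_nn = 0 identically, and v_n = 0. *)
Lemma W_nonzero n : (exists x, v n x != 0) -> exists x, W x 0 n != 0.
Proof.
move=> [x0 nz]; apply: contrapT => H.
have W0 x : W x 0 n = 0 by apply/eqP/negPn/negP => h; apply: H; exists x.
have Ac x m : A x m n = (m == n)%:R.
  have Acst y z : A y m n = A z m n.
    have p0 : prim (fun x => A x m n) (fun=> 0).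
      by apply: prim_ext (prim_A m n) _ _ => t //; rewrite W0 mulr0 oppr0.
    exact: (prim_unique (a := z) p0 (prim_cst (A z m n)) erefl y).
  apply/eqP; rewrite -subr_eq0 -normr_le0; apply/ler_addgt0Pr => e e0; rewrite add0r.
  by have [X hX] := A_at_left e0; rewrite (Acst x X); exact: hX.
have G0 x : G x n n = 0.
  have := congr1 (fun M : 'M[R]_N => M n n) (mulmxV (unit_B x)); rewrite mxE [in RHS]mxE eqxx -/(Ax x).
  under eq_bigr do rewrite Ac.
  rewrite (bigD1 n)//= eqxx mulr1 big1; last by move=> k /negPf ->; rewrite mulr0.
  rewrite addr0 /Bx mxE [X in X + _]mxE eqxx /= => /eqP; rewrite -subr_eq0 addrAC subrr add0r.
  by move/eqP.
have p : prim (fun x => G x n n) (fun x => v n x * v n x).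
  by apply: prim_ext (mprim_gram n n) _ _ => x //; rewrite !mxE big_ord1 !mxE.
have := prim_zero p (@cvv n n) G0 x0 => /eqP; rewrite mulf_eq0 orbb; exact/negP.
Qed.

End Darboux.

(** * Oscillatory integrals *)

(** A linear substitute for Cauchy-Schwarz, with a parameter e to be tuned against the energy on the
    window. *)
Lemma young_le (R : realType) (x e : R) : 0 < e -> `|x| <= e * 1 + e^-1 * x ^+ 2.
Proof.
move=> e0; rewrite -(ler_pM2l e0) mulrDr (mulVKf (lt0r_neq0 e0)).
rewrite -(real_normK (num_real x)); set y := `|x|.
have := sqr_ge0 (e - y / 2); have := sqr_ge0 y; nra.
Qed.

Section Oscillation.
Variable R : realType.
Local Notation Re := complex.Re.
Local Notation Im := complex.Im.
Implicit Types (t s : R).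

Definition cexp t s : R[i] := Complex (cos (t * s)) (sin (t * s)).

Lemma cabs_cexp t s : cabs (cexp t s) = 1.
Proof. by rewrite /cabs /= cos2Dsin2 sqrtr1. Qed.

Lemma cexpD t t' s : cexp (t + t') s = cexp t s * cexp t' s.
Proof.
apply: complex_ext; rewrite !ReImE /= mulrDl ?cosD ?sinD//; ring.
Qed.

Lemma cexpN t s : cexp (- t) s = (cexp t s)^*%C.
Proof. by apply: complex_ext; rewrite !ReImE /= mulNr ?cosN ?sinN. Qed.

Lemma cprim_cexp t : cprim (cexp t) (fun s => pt 0 t * cexp t s).
Proof.
have h : prim (fun s => t * s) (fun=> t).
  by apply: prim_ext (primZ t (@prim_id R)) _ _ => s //; rewrite mulr1.
split.
  apply: prim_ext (prim_comp (phi := cos) (dphi := fun y => - sin y) _ _ h) _ _ => //.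
  - by move=> x; apply: cvgN; exact: continuous_sin.
  - by move=> s; rewrite !ReImE /=; ring.
apply: prim_ext (prim_comp (phi := sin) (dphi := cos) _ _ h) _ _ => //.
- exact: continuous_cos.
- by move=> s; rewrite !ReImE /=; ring.
Qed.

(** The case t = 0 is the non-oscillating one; including it lets one formula cover all pairs of
    frequencies. *)
Definition cexp_prim t s : R[i] := if t == 0 then cR s else (pt 0 t)^-1 * cexp t s.

Lemma cprim_cexp_prim t : cprim (cexp_prim t) (cexp t).
Proof.
case: (eqVneq t 0) => [->|t0].
  apply: cprim_ext (cprim_cR (@prim_id R)) _ _ => s; first by rewrite /cexp_prim eqxx.
  by rewrite /cexp mul0r cos0 sin0.
apply: cprim_ext (cprimZ (pt 0 t)^-1 (cprim_cexp t)) _ _ => s.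
  by rewrite /cexp_prim (negPf t0).
by rewrite mulrA mulVf ?mul1r// pt0_neq0.
Qed.

Lemma cexp_prim_le t a b : t != 0 -> cabs (cexp_prim t b - cexp_prim t a) <= 2 / `|t|.
Proof.
move=> t0; rewrite /cexp_prim (negPf t0) -mulrBr cabsM cabsV cabs_pt0 mulrC ler_pM2r.
  by apply: (le_trans (cabsB _ _)); rewrite !cabs_cexp.
by rewrite invr_gt0 normr_gt0.
Qed.

Lemma cprim_sum (I : Type) (r : seq I) (P : pred I) (u f : I -> R -> R[i]) :
  (forall i, cprim (u i) (f i)) ->
  cprim (fun x => \sum_(i <- r | P i) u i x) (fun x => \sum_(i <- r | P i) f i x).
Proof.
move=> h; elim: r => [|a r IH].
  by apply: cprim_ext (cprim_cst 0) _ _ => x; rewrite big_nil.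
case: (boolP (P a)) => Pa.
  by apply: cprim_ext (cprimD (h a) IH) _ _ => x; rewrite big_cons Pa.
by apply: cprim_ext IH _ _ => x; rewrite big_cons (negPf Pa).
Qed.

Lemma cabs_sum (I : Type) (r : seq I) (P : pred I) (z : I -> R[i]) :
  cabs (\sum_(i <- r | P i) z i) <= \sum_(i <- r | P i) cabs (z i).
Proof.
elim/big_ind2: _ => // [|x y x' y' h h']; first by rewrite cabs0.
by apply: (le_trans (cabsD _ _)); exact: lerD.
Qed.

Variables (N : nat) (k : 'I_N -> R) (z : 'I_N -> R[i]) (g Ga : R -> R) (a b K eta : R).
Hypothesis k0 : forall m, 0 < k m.
Hypothesis kinj : forall j m, j != m -> k j - k m != 0.
Hypothesis ab : a <= b.
Hypothesis cg : continuous g.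
Hypothesis pGa : prim Ga (fun s => g s ^+ 2).
Hypothesis K0 : 0 <= K.
Hypothesis hK : forall j m, j != m -> (k m)^-1 / `|k j - k m| <= K.
Hypothesis hK' : forall j m, (k m)^-1 / (k j + k m) <= K.
Let T := \sum_m cabs (z m).
Hypothesis happ : forall s, a <= s <= b ->
  `|g s - \sum_m (k m)^-1 * Im (z m * (cexp (k m) s)^*%C)| <= eta * T.

(* Integrate g against e^{i k_j s}: only the term m = j does not oscillate. *)
Lemma oscillation_bound j (e : R) : 0 < e ->
  cabs (z j) * (b - a) / (2 * k j) <=
    e * (b - a) + (Ga b - Ga a) / e + 2 * K * T + eta * T * (b - a).
Proof.
move=> e0.
(* 1 / (2 i k_m), from Im w = (w - conj w) / (2 i) and the factor 1 / k_m of the approximation. *)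
pose c m : R[i] := (cR (k m) * pt 0 2)^-1.
pose Pm m s : R[i] := c m * (z m * cexp_prim (k j - k m) s - (z m)^*%C * cexp_prim (k j + k m) s).
pose Qm m s : R[i] := c m * (z m * cexp (k j - k m) s - (z m)^*%C * cexp (k j + k m) s).
have pP m : cprim (Pm m) (Qm m).
  by apply: cprimZ; apply: cprimB; apply: cprimZ; exact: cprim_cexp_prim.
have QE s : \sum_m Qm m s = cexp (k j) s * cR (\sum_m (k m)^-1 * Im (z m * (cexp (k m) s)^*%C)).
  rewrite (big_morph _ (@cRD R) (erefl : cR 0 = 0)) big_distrr /=; apply: eq_bigr => m _.
  rewrite /Qm !cexpD cexpN; pose w := z m * (cexp (k m) s)^*%C; rewrite -/w.
  have cE : c m * pt 0 2 = cR (k m)^-1.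
    have k1 : cR (k m) != 0.
      by apply/eqP => /(congr1 (@complex.Re R)) /= e1; have := k0 m; rewrite e1 ltxx.
    have k2 : pt 0 2 != 0 :> R[i] by apply: pt0_neq0; rewrite pnatr_eq0.
    apply: (mulfI k1); rewrite -cRM mulfV ?gt_eqF// /c mulrCA mulVf//.
    by rewrite mulf_neq0.
  have eW : w - w^*%C = pt 0 2 * cR (Im w) by apply: complex_ext; rewrite !ReImE /=; ring.
  have eJ : w^*%C = (z m)^*%C * cexp (k m) s by apply: complex_ext; rewrite /w !ReImE; ring.
  rewrite cRM -cE; transitivity (cexp (k j) s * (c m * (w - w^*%C))); last by rewrite eW; ring.
  by rewrite eJ /w; ring.
have cgE : ccts (fun s => cR (g s) * cexp (k j) s).
  have [c1 c2] := cprim_ccts (cprim_cexp (k j)).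
  split=> s.
    rewrite (_ : (fun x => _) = (fun x => g x * Re (cexp (k j) x))).
      by apply: cvgM; [exact: cg|exact: c1].
    by apply/funext => x; rewrite cReM /=; ring.
  rewrite (_ : (fun x => _) = (fun x => g x * Im (cexp (k j) x))).
    by apply: cvgM; [exact: cg|exact: c2].
  by apply/funext => x; rewrite cImM /=; ring.
have [J [pJ _]] := ex_cprim a cgE.
have bJ : cabs (J b - J a) <= e * (b - a) + (Ga b - Ga a) / e.
  have p1 := primD (primZ e (@prim_id R)) (primZ e^-1 pGa).
  have := cprim_cabs_le pJ p1 ab; move=> /(_ _)/wrap[]; last first.
    move=> h; apply: (le_trans h); rewrite le_eqVlt; apply/orP; left; apply/eqP; ring.
  move=> x _; rewrite cabsM cabs_cexp cabs_cR mulr1 /=.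
  exact: young_le.
have bD : cabs ((J b - \sum_m Pm m b) - (J a - \sum_m Pm m a)) <= eta * T * (b - a).
  have p1 := cprimB pJ (cprim_sum (index_enum _) predT pP).
  have := cprim_cabs_le p1 (primZ (eta * T) (@prim_id R)) ab; move=> /(_ _)/wrap[].
    move=> s sab; rewrite QE mulrC -mulrBr -cRN -cRD cabsM cabs_cexp mul1r cabs_cR mulr1.
    exact: happ.
  by rewrite -mulrBr.
pose cm m := (2 * k m)^-1.
have cabsc m : cabs (c m) = cm m.
  by rewrite /c cabsV cabsM cabs_cR cabs_pt0 !ger0_norm ?ltW// mulrC.
(* Beyond the main term c_j z_j (b - a) everything oscillates: each m contributes at most K |z_m|
   from the frequency k_j - k_m and K |z_m| from k_j + k_m. *)
have rest : cabs (\sum_m (Pm m b - Pm m a) - c j * z j * cR (b - a)) <= 2 * K * T.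
  pose De t := cexp_prim t b - cexp_prim t a.
  pose r1 m := if m == j then 0 else c m * z m * De (k j - k m).
  pose r2 m := c m * (z m)^*%C * De (k j + k m).
  have -> : \sum_m (Pm m b - Pm m a) - c j * z j * cR (b - a) = \sum_m (r1 m - r2 m).
    rewrite (bigD1 j)//= [RHS](bigD1 j)//= addrAC; congr (_ + _).
      by rewrite /r1 /r2 eqxx /Pm /De subrr /cexp_prim eqxx cRD cRN; ring.
    by apply: eq_bigr => m mj; rewrite /r1 /r2 (negPf mj) /Pm /De; ring.
  apply: (le_trans (cabs_sum _ _ _)); rewrite /T big_distrr /=; apply: ler_sum => m _.
  apply: (le_trans (cabsB _ _)).
  have h1 : cabs (r1 m) <= K * cabs (z m).
    rewrite /r1; case: (eqVneq m j) => mj; first by rewrite cabs0 mulr_ge0 ?cabs_ge0.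
    have jm : j != m by rewrite eq_sym.
    rewrite !cabsM cabsc /cm; apply: (@le_trans _ _ ((2 * k m)^-1 * cabs (z m) * (2 / `|k j - k m|))).
      apply: ler_wpM2l; last by apply: cexp_prim_le; exact: kinj.
      by rewrite mulr_ge0 ?cabs_ge0// invr_ge0 mulr_ge0// ltW.
    have -> : (2 * k m)^-1 * cabs (z m) * (2 / `|k j - k m|) = (k m)^-1 / `|k j - k m| * cabs (z m).
      by field; rewrite normr_eq0 kinj// gt_eqF.
    by apply: ler_wpM2r; [exact: cabs_ge0|exact: hK].
  have h2 : cabs (r2 m) <= K * cabs (z m).
    have kk : 0 < k j + k m by rewrite addr_gt0.
    rewrite !cabsM cabsJ cabsc /cm; apply: (@le_trans _ _ ((2 * k m)^-1 * cabs (z m) * (2 / `|k j + k m|))).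
      apply: ler_wpM2l; last by apply: cexp_prim_le; rewrite gt_eqF.
      by rewrite mulr_ge0 ?cabs_ge0// invr_ge0 mulr_ge0// ltW.
    rewrite gtr0_norm//.
    have -> : (2 * k m)^-1 * cabs (z m) * (2 / (k j + k m)) = (k m)^-1 / (k j + k m) * cabs (z m).
      by field; rewrite !gt_eqF.
    by apply: ler_wpM2r; [exact: cabs_ge0|exact: hK'].
  lra.
have e1 : c j * z j * cR (b - a) = (J b - J a) - ((J b - \sum_m Pm m b) - (J a - \sum_m Pm m a))
   - (\sum_m (Pm m b - Pm m a) - c j * z j * cR (b - a)).
  rewrite sumrB; ring.
have := cabsB ((J b - J a) - ((J b - \sum_m Pm m b) - (J a - \sum_m Pm m a)))
   (\sum_m (Pm m b - Pm m a) - c j * z j * cR (b - a)).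
have := cabsB (J b - J a) ((J b - \sum_m Pm m b) - (J a - \sum_m Pm m a)).
rewrite -e1 !cabsM cabsc cabs_cR ger0_norm ?subr_ge0// /cm.
have -> : cabs (z j) * (b - a) / (2 * k j) = (2 * k j)^-1 * cabs (z j) * (b - a) by rewrite mulrC mulrA.
lra.
Qed.

End Oscillation.

(** * Comparison with free waves at a nearby frequency *)

Section JostApproximation.
Variable R : realType.
Local Notation Re := complex.Re.
Local Notation Im := complex.Im.
Variables (q : R -> R) (psi dpsi : R -> R -> R[i]) (k w : R) (v dv : R -> R).
Hypothesis k0 : 0 < k.
Hypothesis jk : jost q psi dpsi k.
Hypothesis hv : rsol q (w ^+ 2) v dv.
Local Notation ps x := (psi x k).
Local Notation dps x := (dpsi x k).
Let a x : R[i] := cR (v x) * dps x - cR (dv x) * ps x.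

(** The amplitude a is the Wronskian W(v, psi). As W(psi, conj psi) = - 2 i k is not 0, psi and conj
    psi form a basis at energy k^2, and the real data of v are recovered from a. *)
Lemma jost_amplitude x : k * v x = Im (a x * (ps x)^*%C) /\ k * dv x = Im (a x * (dps x)^*%C).
Proof.
have [hs _] := jk; have hJ := csolJ hs; rewrite cRJ in hJ.
have := eq_wronskian_zero x 0 hs hJ; rewrite (jost_wronskian jk) => hW.
have := congr1 (@complex.Im R) hW; rewrite !ReImE /= => h.
have hk : Re (ps x) * Im (dps x) - Im (ps x) * Re (dps x) = k by lra.
split.
  transitivity ((Re (ps x) * Im (dps x) - Im (ps x) * Re (dps x)) * v x); first by rewrite hk.
  by rewrite /a /=; ring.
transitivity ((Re (ps x) * Im (dps x) - Im (ps x) * Re (dps x)) * dv x); first by rewrite hk.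
by rewrite /a /=; ring.
Qed.

(** Variation of constants: a' = (w^2 - k^2) v psi, so a varies slowly when k is near w. The witness
    is the amplitude a(X) frozen at the right end. Errors are relative to |z|, since nothing bounds
    v at +oo. *)
Lemma jost_approximation (eta l : R) : 0 < eta -> eta <= 1 -> 0 <= l ->
  4 * `|w ^+ 2 - k ^+ 2| / k * l <= 1 ->
  4 * `|w ^+ 2 - k ^+ 2| / k * l * expR 1 <= eta ->
  exists X0, forall X, X0 <= X - l -> exists z : R[i],
    [/\ `|v X| <= 2 * cabs z / k, `|dv X| <= (1 + k) * cabs z / k &
     forall s, X - l <= s <= X ->
      `|v s - k^-1 * Im (z * (cexp k s)^*%C)| <= k^-1 * (3 * eta * cabs z)].
Proof.
(* The factor 4 is 2 * 2, from |v| <= 2 |a| / k and |psi| <= 2 on the window; thus |a'| <= kap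
   |a|. *)
move=> eta0 eta1 l0 h1 h2; pose kap := 4 * `|w ^+ 2 - k ^+ 2| / k.
have kap0 : 0 <= kap by rewrite /kap divr_ge0 ?mulr_ge0// ltW.
have [hs [/cvg0_eps c1 /cvg0_eps c2]] := jk.
have [X1 hX1] := c1 _ eta0; have [X2 hX2] := c2 _ eta0.
exists (Num.max X1 X2 + 1) => X hX.
have m1 : X1 <= Num.max X1 X2 by rewrite le_max lexx.
have m2 : X2 <= Num.max X1 X2 by rewrite le_max lexx orbT.
have b1 s : X - l <= s -> cabs (ps s - cexp k s) <= eta.
  move=> xs; have := hX1 s; rewrite ger0_norm ?cabs_ge0// => h; apply: ltW; apply: h; lra.
have b2 s : X - l <= s -> cabs (dps s - pt 0 k * cexp k s) <= eta.
  move=> xs; have := hX2 s; rewrite ger0_norm ?cabs_ge0// => h; apply: ltW.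
  have -> : pt 0 k * cexp k s = Complex (- k * sin (k * s)) (k * cos (k * s)).
    by apply: complex_ext; rewrite !ReImE /=; ring.
  apply: h; lra.
have p1 s : X - l <= s -> cabs (ps s) <= 2.
  move=> /b1 h; have := cabsD (ps s - cexp k s) (cexp k s); rewrite subrK cabs_cexp; lra.
have p2 s : X - l <= s -> cabs (dps s) <= 1 + k.
  move=> /b2 h; have := cabsD (dps s - pt 0 k * cexp k s) (pt 0 k * cexp k s).
  rewrite subrK cabsM cabs_cexp cabs_pt0 gtr0_norm//; lra.
have amp s := jost_amplitude s.
have vb s : X - l <= s -> `|v s| <= 2 * cabs (a s) / k.
  move=> xs; rewrite ler_pdivlMr// -[k in leLHS]gtr0_norm// -normrM mulrC (proj1 (amp s)).
  apply: (le_trans (cabs_Im _)); rewrite cabsM cabsJ mulrC.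
  by apply: ler_wpM2r; [exact: cabs_ge0|exact: p1].
have dvb s : X - l <= s -> `|dv s| <= (1 + k) * cabs (a s) / k.
  move=> xs; rewrite ler_pdivlMr// -[k in leLHS]gtr0_norm// -normrM mulrC (proj2 (amp s)).
  apply: (le_trans (cabs_Im _)); rewrite cabsM cabsJ mulrC.
  by apply: ler_wpM2r; [exact: cabs_ge0|exact: p2].
have pa : cprim a (fun x => (cR (w ^+ 2) - cR (k ^+ 2)) * (cR (v x) * ps x)).
  exact: wronskian_cprim (real_csol hv.1 hv.2) hs.
have lX : X - l <= X by lra.
have ca : continuous (fun s => cabs (a s)) by apply: ccts_cabs; exact: cprim_ccts pa.
have ckca : continuous (fun s => kap * cabs (a s)).
  by move=> s; apply: cvgM; [exact: cvg_cst|exact: ca].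
have [Wp [pW _]] := ex_prim 0 (cts_loc_int ckca).
have da s : X - l <= s -> cabs ((cR (w ^+ 2) - cR (k ^+ 2)) * (cR (v s) * ps s)) <= kap * cabs (a s).
  move=> xs; rewrite -cRN -cRD !cabsM !cabs_cR /kap.
  have := ler_pM (normr_ge0 (v s)) (cabs_ge0 _) (vb s xs) (p1 s xs).
  move=> /(ler_wpM2l (normr_ge0 (w ^+ 2 - k ^+ 2))) h; apply: (le_trans h).
  by rewrite le_eqVlt; apply/orP; left; apply/eqP; field; rewrite gt_eqF.
have grow s : X - l <= s -> s <= X -> cabs (a s) <= cabs (a X) * expR 1.
  move=> xs sX.
  have pk : prim (fun t => kap * t) (fun=> kap).
    by apply: prim_ext (primZ kap (@prim_id R)) _ _ => t //; rewrite mulr1.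
  have g1 : cabs (a s) <= cabs (a X) * expR (kap * X - kap * s).
    apply: (gronwall_left pk pW sX) => // t /andP[st tX].
    have := cprim_cabs_le pa pW tX; move=> /(_ _)/wrap[].
      by move=> y /andP[ty yX]; apply: da; lra.
    have := cabsD (a t - a X) (a X); rewrite subrK cabs_distC; lra.
  apply: (le_trans g1); apply: ler_wpM2l; first exact: cabs_ge0.
  rewrite ler_expR -mulrBr; apply: le_trans h1; apply: ler_wpM2l => //; lra.
exists (a X); split; [exact: vb|exact: dvb|].
move=> s /andP[xs sX].
have dist : cabs (a s - a X) <= eta * cabs (a X).
  rewrite cabs_distC.
  have := cprim_cabs_le pa (primZ (kap * (cabs (a X) * expR 1)) (@prim_id R)) sX; move=> /(_ _)/wrap[].
    move=> y /andP[sy yX]; have xy : X - l <= y by lra.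
    rewrite mulr1; apply: (le_trans (da y xy)); apply: ler_wpM2l => //; exact: grow.
  move=> h; apply: (le_trans h); rewrite /= -mulrBr.
  apply: (@le_trans _ _ (kap * (cabs (a X) * expR 1) * l)).
    apply: ler_wpM2l; last by lra.
    by apply: mulr_ge0 => //; apply: mulr_ge0; [exact: cabs_ge0|exact: expR_ge0].
  have -> : kap * (cabs (a X) * expR 1) * l = (kap * l * expR 1) * cabs (a X) by ring.
  by apply: ler_wpM2r => //; exact: cabs_ge0.
have -> : v s = k^-1 * Im (a s * (ps s)^*%C) by rewrite -(proj1 (amp s)) mulKf// gt_eqF.
rewrite -mulrBr normrM gtr0_norm ?invr_gt0//; apply: ler_wpM2l; first by rewrite invr_ge0 ltW.
rewrite -cImN -cImD; apply: (le_trans (cabs_Im _)).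
have -> : a s * (ps s)^*%C - a X * (cexp k s)^*%C =
   (a s - a X) * (ps s)^*%C + a X * (ps s - cexp k s)^*%C by rewrite rmorphB; ring.
apply: (le_trans (cabsD _ _)); rewrite !cabsM !cabsJ.
have t1 : cabs (a s - a X) * cabs (ps s) <= eta * cabs (a X) * 2.
  by apply: ler_pM; rewrite ?cabs_ge0//; exact: p1.
have t2 : cabs (a X) * cabs (ps s - cexp k s) <= cabs (a X) * eta.
  by apply: ler_wpM2l; [exact: cabs_ge0|exact: b1].
lra.
Qed.

End JostApproximation.

(** * Orthogonality *)

Section Orthogonality.
Variables (R : realType) (q : R -> R).
Local Notation leb := (@lebesgue_measure R).
Local Notation Re := complex.Re.
Local Notation Im := complex.Im.
Variables (N : nat) (om : 'I_N -> R) (v dv : 'I_N -> R -> R).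
Hypothesis om0 : forall n, 0 < om n.
Hypothesis om_inj : injective om.
Hypothesis hv : forall n, rsol q (om n ^+ 2) (v n) (dv n).
Hypothesis Lv : forall n, L2left (v n).
Hypothesis hW : forall m n x,
  v m x * dv n x - dv m x * v n x = (om m ^+ 2 - om n ^+ 2) * gram v x m n.
Variables (psi dpsi : R -> R -> R[i]).
Hypothesis dense_jost : forall n d, 0 < d -> exists k, jost q psi dpsi k /\ `|k - om n| < d.

Local Notation G := (gram v). Local Notation A := (Ax v). Local Notation B := (Bx v).

Lemma row_quad (M S P : 'M[R]_N) n : (row n M *m S *m (row n P)^T) 0 0 = (M *m S *m P^T) n n.
Proof.
rewrite -row_mul mxE [RHS]mxE; apply: eq_bigr => k _.
by rewrite [row n _ 0 k]mxE; congr (_ * _); rewrite !mxE.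
Qed.

Lemma A_psd x (c : 'rV[R]_N) : 0 <= (c *m A x *m c^T) 0 0.
Proof.
have -> : c *m A x *m c^T = (c *m A x) *m B x *m (c *m A x)^T.
  by rewrite trmx_mul [in LHS](A_quad hv Lv) !mulmxA.
rewrite /Bx mulmxDr mulmx1 mulmxDl mxE addr_ge0 ?(gram_psd hv Lv)//.
by rewrite mxE sumr_ge0// => k _; rewrite [X in _ * X]mxE -expr2 sqr_ge0.
Qed.

(* With D = B y - B x, the matrix A x - A y - A y D A y = (A y D) A x (A y D)^T is
   positive semidefinite. *)
Lemma resolvent_increment x y n :
  (row n (A y) *m G y *m (row n (A y))^T) 0 0 - (row n (A y) *m G x *m (row n (A y))^T) 0 0
  <= A x n n - A y n n.
Proof.
pose D := B y - B x.
have eD : D = G y - G x by rewrite /D /Bx opprD addrACA subrr add0r.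
have e1 : A y *m D *m A x = A x - A y.
  rewrite /D mulmxBr mulmxBl /Ax mulVmx ?(unit_B hv Lv)// mul1mx.
  by rewrite -mulmxA mulmxV ?(unit_B hv Lv)// mulmx1.
have e2 : A x *m D *m A y = A x - A y.
  rewrite /D mulmxBr mulmxBl /Ax mulVmx ?(unit_B hv Lv)// mul1mx.
  by rewrite -mulmxA mulmxV ?(unit_B hv Lv)// mulmx1.
have DT : D^T = D by rewrite eD linearB /= !gram_sym.
have e3 : (A y *m D) *m A x *m (A y *m D)^T = A x - A y - A y *m D *m A y.
  by rewrite trmx_mul DT A_sym e1 mulmxA mulmxBl mulmxBl e2.
have psd : 0 <= (row n (A y *m D) *m A x *m (row n (A y *m D))^T) 0 0.
  exact: A_psd.
have lin (M M' : 'M[R]_N) : (M - M') n n = M n n - M' n n by rewrite !mxE.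
have e5 : A y *m D *m A y = A y *m G y *m A y - A y *m G x *m A y.
  by rewrite eD mulmxBr mulmxBl.
by move: psd; rewrite !row_quad e3 e5 A_sym !lin subr_ge0.
Qed.

Lemma A_diag_decreasing n x y : x <= y -> A y n n <= A x n n.
Proof.
move=> xy; have := prim_le (primN (prim_A hv Lv n n)) xy; move=> /(_ _)/wrap[]; last lra.
by move=> t _; rewrite opprK -expr2 sqr_ge0.
Qed.

(** A_nn is nonincreasing and bounded below by 0, so it has little left to lose near +oo. *)
Lemma A_diag_increment n (d : R) : 0 < d -> exists X, forall x y, X <= x -> x <= y ->
  A x n n - A y n n <= d.
Proof.
move=> d0; pose S := [set A x n n | x in [set: R]].
have infS : has_inf S.
  split; first by exists (A 0 n n), 0.
  by exists 0 => _ [x _ <-]; exact: (A_diag_ge0 hv Lv).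
have [_ [X _ <-] hX] := inf_adherent d0 infS.
exists X => x y Xx xy; have := A_diag_decreasing n Xx.
have : inf S <= A y n n by apply: ge_inf; [case: infS|exists y].
by move=> h1 h2; have := ltW hX; lra.
Qed.

(** The absorption step: by the choices of l and eta, the oscillatory and the approximation terms
    each take at most a quarter of T l / (4 U), so half of it remains on the left. *)
Lemma oscillation_arith (T l U n' K eta c ep : R) : 0 < l -> 0 < U -> 0 < n' -> 0 < c -> 0 <= T ->
  eta * (48 * U * n') <= c -> l = 32 * U * n' * K ->
  T * l / (4 * U) <= n' * (2 * ep * l + 2 * K * T + 3 * eta / c * T * l) -> T <= 16 * U * n' * ep.
Proof.
move=> l0 U_gt0 n'0 c0 T0 etac lE0 sumosc.
have k1 : n' * (2 * K * T) = T * l / (16 * U) by rewrite lE0; field; rewrite gt_eqF.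
have k2 : n' * (3 * eta / c * T * l) <= T * l / (16 * U).
  have -> : n' * (3 * eta / c * T * l) = (eta * (48 * U * n')) / c / (16 * U) * (T * l).
    by field; rewrite !gt_eqF.
  rewrite [leRHS]mulrC; apply: ler_wpM2r; first by rewrite mulr_ge0// ltW.
  rewrite ler_pdivrMr ?mulr_gt0// mulVf ?gt_eqF ?mulr_gt0//.
  by rewrite ler_pdivrMr// mul1r.
have k3 : T * l / (8 * U) <= n' * (2 * ep * l).
  have -> : T * l / (8 * U) = T * l / (4 * U) - 2 * (T * l / (16 * U)) by field; rewrite gt_eqF.
  rewrite !mulrDr in sumosc; lra.
rewrite -(ler_pM2r l0); rewrite ler_pdivrMr ?mulr_gt0// in k3.
by apply: (le_trans k3); rewrite le_eqVlt; apply/orP; left; apply/eqP; ring.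
Qed.

(** The constants must be uniform over all frequencies within d1 of the om m, because l and eta are
    chosen from them before the k m. *)
Lemma frequency_bounds : exists U c d1 K : R, [/\ 0 < U, 0 < c, 0 < d1 & 0 < K] /\
  forall k : 'I_N -> R, (forall m, `|k m - om m| < d1) ->
  [/\ forall m, c <= k m /\ k m <= 2 * U,
      forall m, om m + k m <= 3 * U,
      forall j m, j != m -> k j - k m != 0,
      forall j m, j != m -> (k m)^-1 / `|k j - k m| <= K &
      forall j m, (k m)^-1 / (k j + k m) <= K].
Proof.
have [c0 c00 hc0] := fin_lower_bound om0.
have [c1 c10 hc1] : exists2 c1, 0 < c1 & forall j m, j != m -> c1 <= `|om j - om m|.
  have [] := @fin_lower_bound R _ (fun p : 'I_N * 'I_N => if p.1 == p.2 then 1 else `|om p.1 - om p.2|).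
    move=> [j m] /=; case: eqVneq => // jm; rewrite normr_gt0 subr_eq0.
    by apply: contra jm => /eqP /om_inj ->.
  by move=> c c_gt0 hc; exists c => // j m jm; have := hc (j, m); rewrite /= (negPf jm).
have [U0 U00 hU0] := fin_upper_bound om.
have U_gt0 : 0 < U0 + c0 by rewrite addr_gt0.
have d10 : 0 < Num.min (c0 / 2) (c1 / 4) by rewrite lt_min !divr_gt0.
have i0 : 0 < 2 / c0 by rewrite divr_gt0.
have i1 : 0 < 2 / c1 by rewrite divr_gt0.
have i2 : 0 < 1 / c0 by rewrite divr_gt0.
have K_gt0 : 0 < 2 / c0 * (2 / c1 + 1 / c0) by rewrite mulr_gt0// addr_gt0.
exists (U0 + c0), (c0 / 2), (Num.min (c0 / 2) (c1 / 4)), (2 / c0 * (2 / c1 + 1 / c0)).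
split; first by split=> //; rewrite divr_gt0.
move=> k hk.
have d1c m : `|k m - om m| < c0 / 2 by apply: lt_le_trans (hk m) _; rewrite ge_min lexx.
have d1c' m : `|k m - om m| < c1 / 4 by apply: lt_le_trans (hk m) _; rewrite ge_min lexx orbT.
have kom m : om m - c0 / 2 < k m < om m + c0 / 2 by have := d1c m; rewrite ltr_distl.
have klo m : c0 / 2 <= k m by have /andP[? ?] := kom m; have := hc0 m; lra.
have kgt m : 0 < k m by apply: lt_le_trans (klo m); rewrite divr_gt0.
have kgap j m : j != m -> c1 / 2 <= `|k j - k m|.
  move=> jm; have := hc1 j m jm; have := d1c' j; have := d1c' m.
  have := ler_normD (om j - k j) ((k j - k m) + (k m - om m)).
  have := ler_normD (k j - k m) (k m - om m).
  have -> : om j - k j + ((k j - k m) + (k m - om m)) = om j - om m by ring.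
  rewrite (distrC (om j) (k j)); lra.
have kinv m : (k m)^-1 <= 2 / c0.
  by rewrite -invf_div lef_pV2 ?posrE ?divr_gt0.
split.
- by move=> m; split=> //; have /andP[? ?] := kom m; have := hU0 m; lra.
- by move=> m; have /andP[? ?] := kom m; have := hU0 m; lra.
- by move=> j m /kgap h; rewrite -normr_gt0; apply: lt_le_trans h; rewrite divr_gt0.
- move=> j m jm; have kp : 0 < `|k j - k m| by apply: lt_le_trans (kgap _ _ jm); rewrite divr_gt0.
  apply: ler_pM => //; try by rewrite invr_ge0 ltW.
  apply: (@le_trans _ _ (2 / c1)); last by rewrite lerDl ltW.
  by rewrite -invf_div lef_pV2 ?posrE ?divr_gt0//; exact: kgap.
move=> j m; have kp : 0 < k j + k m by rewrite addr_gt0.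
apply: ler_pM => //; try by rewrite invr_ge0 ltW.
apply: (@le_trans _ _ (1 / c0)); last by rewrite lerDr ltW.
rewrite div1r lef_pV2 ?posrE//; have := klo j; have := klo m; lra.
Qed.

(** The detuning |om m - k m| is made small last, relative to the fixed window length l, so that the
    amplitudes hardly vary on a window. *)
Lemma jost_family (U c d1 l eta : R) : 0 < U -> 0 < c -> 0 < d1 -> 0 < l -> 0 < eta ->
  (forall k : 'I_N -> R, (forall m, `|k m - om m| < d1) ->
     forall m, c <= k m /\ om m + k m <= 3 * U) ->
  exists k : 'I_N -> R, [/\ forall m, jost q psi dpsi (k m), forall m, `|k m - om m| < d1 &
    forall m, 4 * `|om m ^+ 2 - k m ^+ 2| / k m * l <= 1 /\
              4 * `|om m ^+ 2 - k m ^+ 2| / k m * l * expR 1 <= eta].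
Proof.
move=> U0 c0 d10 l0 eta0 hU.
have E10 : 0 < expR 1 :> R by exact: expR_gt0.
have [m0 [m00 m01 m02]] : exists m0 : R, [/\ 0 < m0, m0 <= 1 & m0 * expR 1 <= eta].
  exists (Num.min 1 (eta / expR 1)); split.
  - by rewrite lt_min ltr01 divr_gt0.
  - by rewrite ge_min lexx.
  - by rewrite -ler_pdivlMr// ge_min lexx orbT.
have kap0 : 0 < m0 / l by rewrite divr_gt0.
have [d [d0 dd1 dkap]] : exists d : R, [/\ 0 < d, d <= d1 & d * (12 * U) <= m0 / l * c].
  exists (Num.min d1 (m0 / l * c / (12 * U))); split.
  - by rewrite lt_min d10 divr_gt0 ?mulr_gt0// invr_gt0.
  - by rewrite ge_min lexx.
  - by rewrite -ler_pdivlMr ?mulr_gt0// ge_min lexx orbT.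
have /choice [k hk] : forall m, exists k, jost q psi dpsi k /\ `|k - om m| < d.
  by move=> m; exact: dense_jost.
have hkd m : `|k m - om m| < d1 by apply: lt_le_trans dd1; exact: (hk m).2.
exists k; split=> [m|//|m]; first exact: (hk m).1.
have [klo kup] := hU k hkd m; have kgt : 0 < k m by exact: lt_le_trans klo.
have kw : 4 * `|om m ^+ 2 - k m ^+ 2| / k m <= m0 / l.
  have -> : om m ^+ 2 - k m ^+ 2 = (om m - k m) * (om m + k m) by ring.
  rewrite normrM ler_pdivrMr// [`|om m + k m|]gtr0_norm ?addr_gt0// distrC.
  have h2 : `|k m - om m| * (om m + k m) <= d * (3 * U).
    by apply: ler_pM => //; [rewrite ltW// addr_gt0|exact: ltW (hk m).2].
  have h3 : m0 / l * c <= m0 / l * k m by apply: ler_wpM2l => //; exact: ltW.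
  lra.
have kapl : 4 * `|om m ^+ 2 - k m ^+ 2| / k m * l <= m0 by rewrite -ler_pdivlMr.
split; first exact: le_trans kapl m01.
by apply: le_trans m02; apply: ler_wpM2r => //; exact: ltW.
Qed.

(** With A frozen at X, the sum g of A_mn(X) v_m has small square integral over [X - l, X] by
    [resolvent_increment]. There g is nearly a sum of free waves with amplitudes A_mn(X) z_m, and
    [oscillation_bound] controls each amplitude up to a fraction of their total T, which is
    absorbed. *)
Lemma amplitude_decay n (e : R) : 0 < e -> exists X0, forall X, X0 <= X -> forall m,
  `|A X m n| * (`|v m X| + `|dv m X|) <= e.
Proof.
move=> e0.
have [U [c0 [d1 [K [[U_gt0 c00 d10 K_gt0] freq]]]]] := frequency_bounds.
have [n' [n'0 n'N]] : exists n' : R, 0 < n' /\ N%:R <= n'.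
  by exists (N%:R + 1); split; [rewrite ltr_wpDl|lra].
(* With this window length the oscillatory terms 2 K T, taken n' times, make up exactly T l / (16
   U). *)
have [l [l0 lE0]] : exists l : R, 0 < l /\ l = 32 * U * n' * K.
  by exists (32 * U * n' * K); split=> //; rewrite !mulr_gt0.
(* With this eta the free-wave errors, taken n' times, are also at most T l / (16 U). *)
have [eta [eta0 eta1 etac]] : exists eta : R, [/\ 0 < eta, eta <= 1 & eta * (48 * U * n') <= c0].
  exists (Num.min 1 (c0 / (48 * U * n'))); split.
  - by rewrite lt_min ltr01 divr_gt0// !mulr_gt0.
  - by rewrite ge_min lexx.
  - by rewrite -ler_pdivlMr ?mulr_gt0// ge_min lexx orbT.
have [k [jk hkd hk]] : exists k : 'I_N -> R, [/\ forall m, jost q psi dpsi (k m), forall m, `|k m - om m| < d1 &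
    forall m, 4 * `|om m ^+ 2 - k m ^+ 2| / k m * l <= 1 /\
              4 * `|om m ^+ 2 - k m ^+ 2| / k m * l * expR 1 <= eta].
  apply: (jost_family U_gt0 c00 d10 l0 eta0) => k hk m.
  by have [h1 h2 _ _ _] := freq k hk; split; [exact: (h1 m).1|exact: h2].
have [kb _ kdiff hK hK'] := freq k hkd.
have klo m := (kb m).1; have kup m := (kb m).2.
have kgt m : 0 < k m by apply: lt_le_trans (klo m).
have kinv m : (k m)^-1 <= c0^-1 by rewrite lef_pV2 ?posrE.
have [X1 hX1] : exists X1, forall X, X1 <= X -> forall m, exists z : R[i],
    [/\ `|v m X| <= 2 * cabs z / k m, `|dv m X| <= (1 + k m) * cabs z / k m &
     forall s, X - l <= s <= X ->
      `|v m s - (k m)^-1 * Im (z * (cexp (k m) s)^*%C)| <= (k m)^-1 * (3 * eta * cabs z)].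
  apply: fin_eventually_right => m.
  have [h1 h2] := hk m.
  have [X hX] := jost_approximation (kgt m) (jk m) (hv m) eta0 eta1 (ltW l0) h1 h2.
  by exists (X + l) => Y XY; apply: hX; rewrite lerBrDr.
have C0 : 0 < (3 + 2 * U) / c0 * (16 * U * n').
  by rewrite !mulr_gt0 ?invr_gt0 ?addr_gt0 ?mulr_gt0.
have [ep [ep0 epE]] : exists ep : R, 0 < ep /\ (3 + 2 * U) / c0 * (16 * U * n') * ep = e.
  exists (e / ((3 + 2 * U) / c0 * (16 * U * n'))); split; first by rewrite divr_gt0.
  by rewrite mulrC divfK// gt_eqF.
(* An energy of at most ep^2 l balances the two parts of the Young bound: ep l and energy / ep <= ep
   l. *)
have dl0 : 0 < ep ^+ 2 * l by rewrite mulr_gt0// exprn_gt0.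
have [X2 hX2] := A_diag_increment n dl0.
exists (Num.max X1 (X2 + l)) => X; rewrite ge_max => /andP[XX1 XX2].
have /choice [z hz] := hX1 X XX1.
pose c := row n (A X).
have cE m : c 0 m = A X m n by rewrite mxE -[A X in LHS]A_sym mxE.
pose Z m : R[i] := cR (A X m n) * z m.
pose T := \sum_m cabs (Z m).
have T0 : 0 <= T by apply: sumr_ge0 => m _; exact: cabs_ge0.
have ZT m : cabs (Z m) <= T.
  by rewrite /T (bigD1 m)//= lerDl sumr_ge0// => j _; exact: cabs_ge0.
pose g s := (Vx v s *m c^T) 0 0.
have gE s : g s = \sum_m A X m n * v m s.
  by rewrite /g mxE; apply: eq_bigr => m _; rewrite mxE [c^T m 0]mxE cE mulrC.
have cv m : continuous (v m) by exact: (proj1 (rsol_cts (hv m))).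
have cg : continuous g.
  rewrite (_ : g = (fun s => \sum_m A X m n * v m s)); last by apply/funext.
  by apply: cts_sum => m s; apply: cvgM; [exact: cvg_cst|exact: cv].
have pGa := gram_quad_prim hv Lv c.
have lX : X - l <= X by rewrite gerBl ltW.
have inc := resolvent_increment (X - l) X n.
have inc2 : A (X - l) n n - A X n n <= ep ^+ 2 * l by apply: hX2 => //; rewrite lerBrDr.
have happ s : X - l <= s <= X ->
    `|g s - \sum_m (k m)^-1 * Im (Z m * (cexp (k m) s)^*%C)| <= (3 * eta / c0) * T.
  move=> hs; rewrite gE -sumrB; apply: (le_trans (ler_norm_sum _ _ _)).
  rewrite /T big_distrr /=; apply: ler_sum => m _.
  have [_ _ /(_ s hs) h] := hz m.
  have -> : A X m n * v m s - (k m)^-1 * Im (Z m * (cexp (k m) s)^*%C) =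
    A X m n * (v m s - (k m)^-1 * Im (z m * (cexp (k m) s)^*%C)).
    by rewrite /Z -mulrA cImM /=; ring.
  rewrite normrM /Z cabsM cabs_cR.
  have := ler_wpM2l (normr_ge0 (A X m n)) h => h1; apply: (le_trans h1).
  rewrite mulrCA; have -> : 3 * eta / c0 * (`|A X m n| * cabs (z m)) =
     c0^-1 * (`|A X m n| * (3 * eta * cabs (z m))) by ring.
  apply: ler_wpM2r; last exact: kinv.
  by rewrite !mulr_ge0 ?cabs_ge0// ltW.
have osc j := oscillation_bound (z := Z) (a := X - l) (b := X) (k := k) kgt kdiff lX cg pGa
   (ltW K_gt0) hK hK' happ j ep0.
have lE : X - (X - l) = l by ring.
have sumosc : T * l / (4 * U) <= n' * (2 * ep * l + 2 * K * T + 3 * eta / c0 * T * l).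
  have ineq j : cabs (Z j) * (l / (4 * U)) <= 2 * ep * l + 2 * K * T + 3 * eta / c0 * T * l.
    have := osc j; rewrite lE -/T.
    have h1 : cabs (Z j) * (l / (4 * U)) <= cabs (Z j) * l / (2 * k j).
      rewrite -mulrA; apply: ler_wpM2l; first exact: cabs_ge0.
      apply: ler_wpM2l; first exact: ltW.
      by rewrite lef_pV2 ?posrE ?mulr_gt0// (_ : 4 * U = 2 * (2 * U)) ?ler_pM2l//; ring.
    have h2 : ((c *m G X *m c^T) 0 0 - (c *m G (X - l) *m c^T) 0 0) / ep <= ep * l.
      rewrite ler_pdivrMr//; have -> : ep * l * ep = ep ^+ 2 * l by ring.
      exact: le_trans inc inc2.
    rewrite /= => h3; apply: (le_trans h1); apply: (le_trans h3).
    by rewrite (_ : 2 * ep * l = ep * l + ep * l) ?lerD2r ?lerD2l//; ring.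
  rewrite -mulrA /T big_distrl /=.
  apply: (@le_trans _ _ (\sum_(j < N) (2 * ep * l + 2 * K * T + 3 * eta / c0 * T * l))).
    by apply: ler_sum => j _; exact: ineq.
  rewrite sumr_const card_ord -[leLHS]mulr_natl; apply: ler_wpM2r; last exact: n'N.
  have h1 := mulr_ge0 (ltW K_gt0) T0; have h2 := mulr_ge0 (ltW ep0) (ltW l0).
  have h3 : 0 <= 3 * eta / c0 * T * l.
    apply: mulr_ge0; last exact: ltW.
    by apply: mulr_ge0 => //; rewrite divr_ge0 ?mulr_ge0// ltW.
  by rewrite -(mulrA 2 ep) -(mulrA 2 K) !addr_ge0// mulr_ge0.
have Tb : T <= 16 * U * n' * ep by exact: (oscillation_arith l0 U_gt0 n'0 c00 T0 etac lE0 sumosc).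
move=> m.
have [h1 h2 _] := hz m.
have z0 := cabs_ge0 (z m).
have h3 : `|v m X| + `|dv m X| <= (3 + 2 * U) / c0 * cabs (z m).
  have h4 : `|v m X| + `|dv m X| <= (3 + k m) * cabs (z m) * (k m)^-1 by rewrite (_ : (3 + k m) * cabs (z m) / k m = 2 * cabs (z m) / k m + (1 + k m) * cabs (z m) / k m) ?lerD//; ring.
  apply: (le_trans h4); rewrite mulrAC; apply: ler_wpM2r => //.
  have q1 : 3 + k m <= 3 + 2 * U by rewrite lerD2l.
  have q2 : 0 <= 3 + k m by rewrite addr_ge0// ltW.
  have q3 : 0 <= (k m)^-1 by rewrite invr_ge0 ltW.
  exact: (ler_pM q2 q3 q1 (kinv m)).
have h4 := ler_wpM2l (normr_ge0 (A X m n)) h3; apply: (le_trans h4).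
have -> : `|A X m n| * ((3 + 2 * U) / c0 * cabs (z m)) = (3 + 2 * U) / c0 * cabs (Z m).
  by rewrite /Z cabsM cabs_cR; ring.
have -> : e = (3 + 2 * U) / c0 * (16 * U * n' * ep) by rewrite -epE; ring.
apply: ler_wpM2l; last exact: le_trans (ZT m) Tb.
by rewrite divr_ge0 ?addr_ge0 ?mulr_ge0// ltW.
Qed.

Lemma W_P_decay n (e : R) : 0 < e -> exists X0, forall X, X0 <= X ->
  `|Wx v X 0 n| <= e /\ `|Px v dv X 0 n| <= e.
Proof.
move=> e0; have N0 : 0 < N%:R + 1 :> R by rewrite ltr_wpDl.
have [X0 hX] := amplitude_decay n (divr_gt0 e0 N0); exists X0 => X /hX h.
have tot : \sum_(m < N) (e / (N%:R + 1)) <= e.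
  have -> : \sum_(m < N) (e / (N%:R + 1)) = e * (N%:R / (N%:R + 1)).
    by rewrite sumr_const card_ord -[LHS]mulr_natr mulrAC mulrA.
  by rewrite ger_pMr// ler_pdivrMr// mul1r; lra.
split; rewrite mxE; apply: (le_trans (ler_norm_sum _ _ _)); apply: le_trans tot; apply: ler_sum => m _.
  rewrite mxE normrM mulrC; apply: le_trans (h m); apply: ler_wpM2l => //.
  by rewrite lerDl.
rewrite mxE normrM mulrC; apply: le_trans (h m); apply: ler_wpM2l => //.
by rewrite lerDr.
Qed.

Lemma A_offdiag_decay m n (e : R) : m != n -> 0 < e -> exists X0, forall X, X0 <= X -> `|A X m n| <= e.
Proof.
move=> mn e0.
have g0 : om n ^+ 2 - om m ^+ 2 != 0.
  rewrite subr_eq0 eqrXn2 ?ltW//; apply: contra mn => /eqP /om_inj ->; by rewrite eqxx.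
have g1 : 0 < `|om n ^+ 2 - om m ^+ 2| by rewrite normr_gt0.
pose e1 := Num.min 1 (e * `|om n ^+ 2 - om m ^+ 2| / 2).
have e10 : 0 < e1 by rewrite lt_min ltr01 divr_gt0// mulr_gt0.
have e11 : e1 <= 1 by rewrite ge_min lexx.
have e12 : e1 <= e * `|om n ^+ 2 - om m ^+ 2| / 2 by rewrite ge_min lexx orbT.
have [X1 h1] := W_P_decay m e10; have [X2 h2] := W_P_decay n e10.
exists (Num.max X1 X2) => X; rewrite ge_max => /andP[/h1 [a1 a2] /h2 [b1 b2]].
have := congr1 (fun M : 'M[R]_N => M m n) (A_commutator hv Lv hW X).
rewrite mul_mx_diag mul_diag_mx !mxE !big_ord1 ![(_^T) _ _]mxE => eq.
have eq' : A X m n * (om n ^+ 2 - om m ^+ 2) = Wx v X 0 m * Px v dv X 0 n - Px v dv X 0 m * Wx v X 0 n.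
  rewrite -eq; ring.
rewrite -(ler_pM2r g1) -normrM eq'.
apply: (le_trans (ler_normB _ _)); rewrite !normrM.
have t1 : `|Wx v X 0 m| * `|Px v dv X 0 n| <= e1 * 1 by apply: ler_pM => //; exact: le_trans e11.
have t2 : `|Px v dv X 0 m| * `|Wx v X 0 n| <= e1 * 1 by apply: ler_pM => //; exact: le_trans e11.
lra.
Qed.

Lemma W_orthogonal m n : m != n -> Rintegral leb setT (fun x => - Wx v x 0 m * - Wx v x 0 n) = 0.
Proof.
move=> mn.
have cW j : continuous (fun x => - Wx v x 0 j).
  by move=> x; apply: cvgN; exact: (prim_cts (mprim_W hv Lv 0 j)).
apply: Rintegral_line0.
  by apply: integrable_square_prod => //; [exact: W_L2 hv Lv m|exact: W_L2 hv Lv n].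
move=> e e0; have e2 : 0 < e / 2 by rewrite divr_gt0.
have [X1 h1] := A_at_left hv Lv e2; have [X2 h2] := A_offdiag_decay mn e2.
pose M := Num.max 0 (Num.max (- X1) X2).
have M0 : 0 <= M by rewrite le_max lexx.
exists (Num.trunc M).+1 => k kM.
have Mk : M <= k%:R.
  by apply: le_trans (ltW (truncnS_gt M)) _; rewrite ler_nat.
have k1 : - k%:R <= X1.
  have : - X1 <= M by rewrite !le_max lexx orbT.
  lra.
have k2 : X2 <= k%:R by apply: le_trans Mk; rewrite !le_max lexx !orbT.
have kk : - k%:R <= k%:R :> R by lra.
have -> : (fun x => - Wx v x 0 m * - Wx v x 0 n) = (fun x => - - (Wx v x 0 m * Wx v x 0 n)).
  by apply/funext => x; rewrite mulrNN opprK.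
rewrite -((primN (prim_A hv Lv m n)).2 _ _ kk).
have := h1 _ k1 m n; rewrite (negPf mn) subr0 => a1; have a2 := h2 _ k2.
rewrite opprK addrC; apply: (le_trans (ler_normB _ _)); lra.
Qed.

End Orthogonality.

(** * Specialisation to the weighted resonant solutions *)

Lemma rop_prim (R : realType) (q u du : R -> R) (la : R) : prim u du ->
  prim du (fun t => (q t - la) * u t) -> rop q u du (fun t => la * u t).
Proof.
move=> h1 h2.
have h3 : prim du (fun t => q t * u t - la * u t).
  by apply: prim_ext h2 _ _ => t //; rewrite mulrBl.
split; first exact: h1.1.
split; first exact: h3.1.
by move=> a b ab; split; [exact: h1.2|exact: h3.2].
Qed.

Theorem theorem3p1 (R : realType) (q : R -> R) (psi dpsi : R -> R -> R[i])
    (Rc : R -> R[i]) (N : nat) (omega alpha : 'I_N -> R) :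
  loc_int q ->
  semibounded q ->
  (@lebesgue_measure R).-negligible (~` good q psi dpsi Rc) ->
  (forall n, 0 < omega n) ->
  injective omega ->
  (forall n, resonance q (omega n)) ->
  (forall n, (forall x, cont_along (good q psi dpsi Rc) (psi x) (omega n)) /\
             cont_along (good q psi dpsi Rc) Rc (omega n)) ->
  (forall n, alpha n != 0) ->
  let phi := fun n => phi_fun psi Rc (omega n) in
  let G := Gplus alpha phi in
  let F := fun x => ln (\det (1%:M + G x)) in
  let qN := fun x => q x - 2 * derive1 (derive1 F) x in
  let y := fun x => - ((\row_n (alpha n * phi n x)) *m invmx (1%:M + G x)) in
  (* (i) *)
  (forall n, L2left (phi n)) /\
  (* (ii) *)
  (forall x m n, (@lebesgue_measure R).-integrable `]-oo, x]
                    (fun s => (phi m s * phi n s)%:E)) /\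
  (forall x (v : 'rV[R]_N), 0 <= (v *m G x *m v^T) 0 0) /\
  (* (iii) *)
  (forall x, derivable F x 1 /\ derivable (derive1 F) x 1) /\
  (forall n, is_eigen qN (omega n ^+ 2)) /\
  (* (iv) *)
  (forall x, 1%:M + G x \in unitmx) /\
  (forall n, exists dy : R -> R,
      rop qN (fun x => y x 0 n) dy (fun x => omega n ^+ 2 * y x 0 n) /\
      L2 (fun x => y x 0 n) /\ exists x, y x 0 n != 0) /\
  (forall m n, m != n ->
      Rintegral (@lebesgue_measure R) setT (fun x => y x 0 m * y x 0 n) = 0).
Proof.
move=> lq _ negS om0 om_inj res cont alpha0 phi G F qN y.
have /choice [dphi hphi] : forall n, exists dphi : R -> R,
    [/\ rsol q (omega n ^+ 2) (phi n) dphi, L2left (phi n), exists x, phi n x != 0 &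
     forall v dv, rsol q (omega n ^+ 2) v dv -> L2left v -> exists c, forall x, v x = c * phi n x].
  move=> n; have [c1 c2] := cont n.
  have [dphi [h1 h2 h3 h4 h5]] := phi_fun_resonant lq negS (om0 n) c1 c2 (res n).
  exists dphi; split; [by split|by []|by []|].
  by move=> v dv [p1 p2] Lv; exact: (h5 v dv p1 p2 Lv).
have sphi n : rsol q (omega n ^+ 2) (phi n) (dphi n) by have [] := hphi n.
have Lphi n : L2left (phi n) by have [] := hphi n.
have cphi n : continuous (phi n) by exact: (proj1 (rsol_cts (sphi n))).
have iphi m n x : (@lebesgue_measure R).-integrable `]-oo, x] (EFin \o (fun s => phi m s * phi n s)).
  by apply: integrable_square_prod => //; [exact: Lphi|exact: Lphi].
(* The weights are absorbed into the solutions, so that G becomes the Gram matrix of v. *)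
pose v n x := alpha n * phi n x; pose dv n x := alpha n * dphi n x.
have hv n : rsol q (omega n ^+ 2) (v n) (dv n) by exact: rsolZ.
have Lv n : L2left (v n).
  move=> a; rewrite (_ : (fun t => _) = (fun t => (alpha n ^+ 2)%:E * (phi n t ^+ 2)%:E)%E).
    by apply: integrableZl => //; exact: Lphi.
  by apply/funext => x; rewrite -EFinM exprMn.
have GE x : G x = gram v x.
  apply/matrixP => m n; rewrite !mxE -RintegralZl//.
  by apply: eq_Rintegral => s _; rewrite /v; ring.
(* Uniqueness of the resonant solution removes the limit l of the Wronskian at -oo; the factor
   alpha_m alpha_n then turns the integral into an entry of G. *)
have hW m n x : v m x * dv n x - dv m x * v n x = (omega m ^+ 2 - omega n ^+ 2) * gram v x m n.
  have [_ _ nzm unm] := hphi m.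
  have [l hl] := wronskian_lim (sphi m) (sphi n) (Lphi m) (Lphi n).
  have l0 := wronskian_lim0 lq (sphi m) (sphi n) (Lphi m) (Lphi n) nzm unm hl.
  transitivity (alpha m * alpha n * (phi m x * dphi n x - dphi m x * phi n x)).
    by rewrite /v /dv; ring.
  by rewrite hl l0 add0r -GE mxE; ring.
have dense n d : 0 < d -> exists k, jost q psi dpsi k /\ `|k - omega n| < d.
  by move=> d0; have [k [[jk _] kd]] := negligible_dense (omega n) negS d0; exists k.
have yE x n : y x 0 n = - Wx v x 0 n.
  rewrite /y mxE /Wx /Ax /Bx GE; congr (- (_ *m _) _ _); by apply/rowP => i; rewrite !mxE.
have FE : F = (fun x => ln (\det (Bx v x))) by apply/funext => x; rewrite /F GE.
have [derF d2F] := log_det_derivable hv Lv; rewrite -FE in derF d2F.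
(* The equation is linear, so it passes from W to y = - W, and [qN] is the transformed potential
   because (log det B)'' = 2 sigma - tau^2. *)
have rop_y n : rop qN (fun x => y x 0 n) (fun x => - (Px v dv x - taux v x *: Wx v x) 0 n)
    (fun x => omega n ^+ 2 * y x 0 n).
  apply: rop_prim.
    by apply: prim_ext (primN (mprim_W hv Lv 0 n)) _ _ => x //; rewrite yE.
  apply: prim_ext (primN (mprim_dW hv Lv hW 0 n)) _ _ => x //.
  rewrite yE mul_mx_diag /qN d2F; move: (Wx v x) => M.
  by rewrite !mxE; ring.
have L2y n : L2 (fun x => y x 0 n).
  have := W_L2 hv Lv n; congr L2; apply/funext => x; exact/esym/yE.
have nzy n : exists x, y x 0 n != 0.
  have [_ _ [x0 nz] _] := hphi n.
  have [x hx] : exists x, Wx v x 0 n != 0.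
    by apply: (W_nonzero hv Lv); exists x0; rewrite mulf_neq0.
  by exists x; rewrite yE oppr_eq0.
split; first by [].
split; first by move=> x m n; exact: iphi.
split; first by move=> x c; rewrite GE; exact: gram_psd hv Lv x c.
split; first by [].
split.
  by move=> n; do 2 eexists; split; [exact: rop_y|split; [exact: L2y|exact: nzy]].
split; first by move=> x; rewrite GE; exact: unit_B hv Lv x.
split.
  by move=> n; eexists; split; [exact: rop_y|split; [exact: L2y|exact: nzy]].
move=> m n mn; rewrite -[RHS](W_orthogonal om0 om_inj hv Lv hW dense mn).
by apply: eq_Rintegral => x _; rewrite !yE.
Qed.
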